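(* Let $\Pi\subset\mathbb{R}^2$ be the open triangle in the $(s,t)$-plane with vertices $$\Big(-1+\tfrac{2}{\alpha},\,-1+\tfrac{2}{\alpha}\Big),\qquad \Big(\tfrac12(11-5\alpha),\,\tfrac14(-25+11\alpha)\Big),\qquad \Big(\tfrac12(11-5\alpha),\,\tfrac12(11-5\alpha)\Big),$$ and for $(s,t)\in\Pi$ let $\mathcal{R}(s,t)$ be the five-atom piecewise isometry of the rhombus $R$ defined in the context. Then for every $(s,t)\in\Pi$: (a) The dressed subdomain of $\mathcal{R}(s,t)$ on the triangle $$C=[(2,1,0),(1,-1,1),(-1-s,\ \beta^4-s,\ 1-s)]$$ is, after merging adjacent atoms of the first-return map on which it acts by the same isometry, similar to the base triangle $\mathcal{B}(\tau)$ with shape parameter $$\tau=\tau_{\mathcal{C}}(s)=\omega^7(\alpha s+\beta^3)\in(0,1).$$ The return orbit of $C$, together with the orbits of 13 periodic tiles, tiles $R$. (b) Consequently the self-similarity of $\mathcal{R}(s,t)$ is that of $\mathcal{B}(\tau_{\mathcal{C}}(s))$, and $\mathcal{R}(s,t)$ is self-similar if and only if $s\in\mathbb{Q}(\sqrt5)$ (with $t$ an arbitrary real number subject to $(s,t)\in\Pi$). That is, the set of $(s,t)\in\Pi$ for which $\mathcal{R}(s,t)$ is self-similar is $\Pi\cap(\mathbb{Q}(\sqrt5)\times\mathbb{R})$.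
   Context: Constants: $\alpha=\sqrt5$, $\omega=(\sqrt5+1)/2$, $\beta=\omega^{-1}=(\sqrt5-1)/2$. Coordinates. Let $\mathbf{u}_m=(\cos\frac{2\pi m}{5},\sin\frac{2\pi m}{5})$, $m=0,\dots,4$. A point $\mathbf{x}$ of the plane is described by the coordinates $(X,Y)=(\mathbf{u}_0\cdot\mathbf{x},\mathbf{u}_1\cdot\mathbf{x})$; then $\mathbf{u}_2\cdot\mathbf{x}=-X+\beta Y$, $\mathbf{u}_3\cdot\mathbf{x}=-\beta X-\beta Y$, $\mathbf{u}_4\cdot\mathbf{x}=\beta X-Y$. $\mathtt{R}_m$ is the counterclockwise rotation by $2\pi m/5$ about the origin; in these coordinates $\mathtt{R}_1(X,Y)=(\beta X-Y,X)$ and $\mathtt{R}_m=\mathtt{R}_1^m$. $\mathtt{T}_{(a,b)}$ is the translation $(X,Y)\mapsto(X+a,Y+b)$. Tiles. $[(m_1,\dots,m_n),(\epsilon_1,\dots,\epsilon_n),(b_1,\dots,b_n)]$ denotes the convex polygon of all $\mathbf{x}$ such that, for each $i$, $\mathbf{u}_{m_i}\cdot\mathbf{x}<b_i$ if $\epsilon_i=1$ and $\mathbf{u}_{m_i}\cdot\mathbf{x}\ge b_i$ if $\epsilon_i=-1$. Dressed domains. A dressed domain is a set $X$ partitioned into tiles (atoms) $X_1,\dots,X_N$, with a map $\rho:X\to X$ acting on each $X_k$ by an isometry $\rho_k$ of the form $\mathtt{T}_{\mathbf d}\mathtt{R}_m$. For $Y\subset X$, the dressed subdomain on $Y$ is $Y$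 with the first-return map $\rho_Y$ of $\rho$ to $Y$. Two dressed domains, $X$ with map $\rho$ and $X'$ with map $\rho'$, are similar if there is $\mathtt{G}\in\mathfrak{G}$ with $\mathtt{G}(X)=X'$, $\mathtt{G}$ carrying atoms to atoms, and $\rho'=\mathtt{G}\circ\rho\circ\mathtt{G}^{-1}$; here $\mathfrak{G}$ is the group generated by the dihedral symmetry group of the regular pentagon (with axes along the $\mathbf u_m$), translations, and homotheties $\mathbf{x}\mapsto\eta\mathbf{x}$, $\eta>0$. Tilings by orbits. The return orbit of $Y$ is the family of sets $\rho^k(Y_j)$, $0\le k<n_j$, where the $Y_j$ are the pieces of $Y$ with a common itinerary (through the atoms of $X$) up to the first return time $n_j$ to $Y$. A periodic tile is a convex polygon $P\subset X$ such that each of $P,\rho(P),\dots,\rho^{n-1}(P)$ lies in a single atom and $\rho^n(P)=P$ for some $n\ge1$; with $n$ minimal, these sets form its orbit. A family of sets tiles $X$ if they are pairwise disjoint subsets of $X$ whose areas sum to the area of $X$. The rhombus map $\mathcal{R}(s,t)$. The domain is $R=[(0,1,0,1),(-1,-1,1,1),(-t,-s,1-t,1-s)]$, with atoms - $R_1=[(0,2,1),(-1,-1,1),(-t,-s,1-s)]$, - $R_2=[(0,1,2,0,1,2),(-1,-1,-1,1,1,1),(-t,-t,-1-s,1-t,1-s,-s)]$, - $R_3=[(0,2,1),(1,1,-1),(1-t,-1-s,-t)]$, - $R_4=[(0,1,2,1),(-1,-1,-1,1),(-t,-s,-1-s,-t)]$, - $R_5=[(1,0,1,2),(-1,1,1,1),(-s,1-t,-t,-1-s)]$,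 and isometries $\rho_{R_1}=\mathtt{T}_{(0,0)}\mathtt{R}_4$, $\rho_{R_2}=\mathtt{T}_{(0,1)}\mathtt{R}_4$, $\rho_{R_3}=\mathtt{T}_{(0,2)}\mathtt{R}_4$, $\rho_{R_4}=\mathtt{T}_{(1,1)}\mathtt{R}_4$, $\rho_{R_5}=\mathtt{T}_{(1,2)}\mathtt{R}_4$. The base triangle $\mathcal{B}(\tau)$, $0<\tau<1$ ($\tau$ is the shape parameter). The domain is $B=[(1,0,2),(-1,1,1),(\tau-\omega^2,0,0)]$, with atoms - $B_1=[(0,2,3),(1,1,1),(0,0,\omega-\omega\tau)]$, - $B_2=[(1,4,0,3,2),(-1,1,1,-1,1),(\tau-\omega^2,\omega^2-\omega\tau,0,\omega-\omega\tau,0)]$, - $B_3=[(1,0,4),(-1,1,-1),(\tau-\omega^2,0,\omega^2-\omega\tau)]$, and isometries $\rho_1=\mathtt{T}_{(\omega\tau-\omega,\,-\omega^2+\omega^2\tau)}\mathtt{R}_2$, $\rho_2=\mathtt{T}_{(0,\,\omega^2\tau-\omega^3)}\mathtt{R}_3$, $\rho_3=\mathtt{T}_{(\omega\tau-2\omega,\,\omega^2\tau-2\omega^2)}\mathtt{R}_2$. Renormalization function and self-similarity. Define $r:[0,1]\to[0,1]$ by $r(\tau)=\omega^2\tau$ for $0<\tau<\beta^2$, $r(\tau)=\omega^3(\beta-\tau)$ for $\beta^2<\tau<\beta$, $r(\tau)=\omega^2(1-\tau)$ for $\beta<\tau<1$, and $r(\tau)=0$ for $\tau\in\{0,\beta^2,\beta,1\}$;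 $r$ describes how the shape parameter of a base triangle changes under induction on a suitable smaller triangle. $\mathcal{B}(\tau)$ is self-similar if $\tau$ is eventually periodic under $r$. If a dressed domain has a dressed subdomain similar (after merging adjacent atoms with equal isometry) to some $\mathcal{B}(\tau)$, whose return orbit together with the orbits of finitely many periodic tiles tiles the whole domain, then the dressed domain is called self-similar if $\mathcal{B}(\tau)$ is self-similar. *)

(* Defs.v *)
From HB Require Import structures.
From mathcomp Require Import all_boot all_order all_algebra.
From mathcomp Require Import all_classical all_reals all_analysis.
From Stdlib Require Import Relation_Operators.

Set Implicit Arguments.
Unset Strict Implicit.
Unset Printing Implicit Defensive.

Import Order.TTheory GRing.Theory Num.Theory.
Import numFieldNormedType.Exports.

Local Open Scope classical_set_scope.
Local Open Scope ring_scope.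

(* A point x of the Euclidean plane is represented throughout by the pair
   (X, Y) = (u_0 . x, u_1 . x), where u_m = (cos (2 pi m/5), sin (2 pi m/5));
   these are linear, not orthonormal, coordinates. *)
Notation plane R := (R * R)%type (only parsing).

Section Plane.
Variable R : realType.
Implicit Types x d : plane R.

Definition alpha : R := Num.sqrt 5.
Definition omega : R := (alpha + 1) / 2.
Definition beta : R := (alpha - 1) / 2.

(* udot m x = u_m . x, for m = 0, ..., 4 *)
Definition udot (m : nat) x : R :=
  match m with
  | 0 => x.1
  | 1 => x.2
  | 2 => - x.1 + beta * x.2
  | 3 => - beta * x.1 - beta * x.2
  | _ => beta * x.1 - x.2
  end.

Definition rot1 x : plane R := (beta * x.1 - x.2, x.1).
Definition transl d x : plane R := (x.1 + d.1, x.2 + d.2).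
Definition homoth (eta : R) x : plane R := (eta * x.1, eta * x.2).

(* T_d R_m *)
Definition TR d (m : nat) x : plane R := transl d (iter m rot1 x).

(* Reflection in the axis along u_0; it fixes u_0 and exchanges u_1 and u_4.
   Together with rot1 it generates the symmetry group of the pentagon. *)
Definition refl0 x : plane R := (x.1, beta * x.1 - x.2).

(* The group generated by the symmetries of the pentagon, the translations
   and the positive homotheties. *)
Inductive simgroup : (plane R -> plane R) -> Prop :=
| simgroup_rot : simgroup rot1
| simgroup_refl : simgroup refl0
| simgroup_transl d : simgroup (transl d)
| simgroup_homoth eta : 0 < eta -> simgroup (homoth eta)
| simgroup_id : simgroup id
| simgroup_comp f g : simgroup f -> simgroup g -> simgroup (f \o g)
| simgroup_inv f g : simgroup f -> cancel f g -> cancel g f -> simgroup g.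

(* tile [:: m_1; ...] [:: e_1; ...] [:: b_1; ...]: the points x such that, for
   each i, u_(m_i) . x < b_i if e_i = 1 and u_(m_i) . x >= b_i if e_i = -1. *)
Definition halfplane (m : nat) (e : int) (b : R) x : bool :=
  if e == 1 then udot m x < b else b <= udot m x.

Definition tile (ms : seq nat) (es : seq int) (bs : seq R) : set (plane R) :=
  [set x | all (fun h => halfplane h.1 h.2.1 h.2.2 x) (zip ms (zip es bs))].

(* Convex polygons with arbitrary edge directions: bounded sets with nonempty
   interior cut out by finitely many open or closed half-planes. *)
Definition convex_polygon (P : set (plane R)) : Prop :=
  [/\ exists hs : seq (plane R * R * bool),
        P = [set x | all (fun h => let v := h.1.1.1 * x.1 + h.1.1.2 * x.2 in
                                   if h.2 then v < h.1.2 else v <= h.1.2) hs],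
      exists M : R, forall x, P x -> `|x.1| <= M /\ `|x.2| <= M
    & interior P !=set0].

(* Lebesgue measure in the coordinates (X, Y).  It is a constant multiple of
   Euclidean area, and only enters homogeneous equations between areas. *)
Definition area (A : set (plane R)) : \bar R :=
  (lebesgue_measure \x lebesgue_measure)%E
    (A : set (measurableTypeR R * measurableTypeR R)).

Definition tiles (I : choiceType) (D : set I) (F : I -> set (plane R))
    (X : set (plane R)) : Prop :=
  [/\ trivIset D F, forall i, D i -> F i `<=` X
    & (esum D (fun i => area (F i)) = area X)%E].

(* The map is only relevant on the domain. *)
Record dressed := Dressed {
  dom : set (plane R);
  dmap : plane R -> plane R;
  atoms : set (set (plane R)) }.

Implicit Types (D : dressed) (Y : set (plane R)).

(* A dressed domain given by its domain and the list of its atoms, each with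
   the data (d, m) of the isometry T_d R_m acting on it. *)
Fixpoint piecewise (l : seq (set (plane R) * (plane R * nat))) x : plane R :=
  if l is (A, (d, m)) :: l' then
    if x \in A then TR d m x else piecewise l' x
  else x.

Definition dress (X : set (plane R))
    (l : seq (set (plane R) * (plane R * nat))) : dressed :=
  Dressed X (piecewise l) [set` map fst l].

Definition is_return_time D Y x (n : nat) : Prop :=
  [/\ (0 < n)%N, Y (iter n (dmap D) x)
    & forall k, (0 < k < n)%N -> ~ Y (iter k (dmap D) x)].

(* Left equal to x itself if x never returns to Y. *)
Definition first_return D Y x : plane R :=
  iter (xget 0%N [set n | is_return_time D Y x n]) (dmap D) x.

(* The points of Y whose itinerary, up to the first return to Y, is the word w
   in the atoms of D; the return time is then the length of w. *)
Definition return_piece D Y (w : seq (set (plane R))) : set (plane R) :=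
  [set x | [/\ Y x, is_return_time D Y x (size w)
    & forall k, (k < size w)%N ->
        atoms D (nth set0 w k) /\ nth set0 w k (iter k (dmap D) x)]].

Definition subdomain D Y : dressed :=
  Dressed Y (first_return D Y)
    [set A | A !=set0 /\ exists w, A = return_piece D Y w].

Definition same_isometry D (A B : set (plane R)) : Prop :=
  exists d m, forall x, A x \/ B x -> dmap D x = TR d m x.

(* The closures share at least two points: for convex sets, a segment. *)
Definition edge_adjacent (A B : set (plane R)) : Prop :=
  exists p q, [/\ p <> q, (closure A `&` closure B) p
                        & (closure A `&` closure B) q].

Definition mergeable D : set (plane R) -> set (plane R) -> Prop :=
  clos_refl_trans _ (fun A B =>
    [/\ atoms D A, atoms D B, edge_adjacent A B & same_isometry D A B]).

Definition merge_atoms D : dressed :=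
  Dressed (dom D) (dmap D)
    [set U | exists2 A, atoms D A & U = \bigcup_(B in mergeable D A) B].

Definition dressed_similar D D' : Prop :=
  exists G, [/\ simgroup G, G @` dom D = dom D',
    [set G @` A | A in atoms D] = atoms D'
    & forall x, dom D x -> dmap D' (G x) = G (dmap D x)].

(* P is a periodic tile, n is the least period of P as a set. *)
Definition periodic_tile D (P : set (plane R)) (n : nat) : Prop :=
  [/\ convex_polygon P, P `<=` dom D,
      forall k, (k < n)%N ->
        exists2 A, atoms D A & iter k (dmap D) @` P `<=` A
    & [/\ (0 < n)%N, iter n (dmap D) @` P = P
        & forall k, (0 < k < n)%N -> iter k (dmap D) @` P <> P]].

(* The return orbit of Y and the orbits of N periodic tiles, as one family. *)
Definition orbit_index D Y N (n : 'I_N -> nat) :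
    set (seq (set (plane R)) * nat + 'I_N * nat) :=
  [set i | match i with
           | inl wk => return_piece D Y wk.1 !=set0 /\ (wk.2 < size wk.1)%N
           | inr jk => (jk.2 < n jk.1)%N
           end].

Definition orbit_set D Y N (P : 'I_N -> set (plane R))
    (i : seq (set (plane R)) * nat + 'I_N * nat) : set (plane R) :=
  match i with
  | inl wk => iter wk.2 (dmap D) @` return_piece D Y wk.1
  | inr jk => iter jk.2 (dmap D) @` P jk.1
  end.

Definition orbits_tile D Y (N : nat) : Prop :=
  exists (P : 'I_N -> set (plane R)) (n : 'I_N -> nat),
    (forall j, periodic_tile D (P j) (n j)) /\
    tiles (orbit_index D Y n) (orbit_set D Y P) (dom D).

Definition rhombus (s t : R) : dressed :=
  dress
    (tile [:: 0; 1; 0; 1]%N [:: -1; -1; 1; 1] [:: - t; - s; 1 - t; 1 - s])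
    [:: (tile [:: 0; 2; 1]%N [:: -1; -1; 1] [:: - t; - s; 1 - s],
          ((0, 0), 4%N));
        (tile [:: 0; 1; 2; 0; 1; 2]%N [:: -1; -1; -1; 1; 1; 1]
           [:: - t; - t; - 1 - s; 1 - t; 1 - s; - s],
          ((0, 1), 4%N));
        (tile [:: 0; 2; 1]%N [:: 1; 1; -1] [:: 1 - t; - 1 - s; - t],
          ((0, 2), 4%N));
        (tile [:: 0; 1; 2; 1]%N [:: -1; -1; -1; 1]
           [:: - t; - s; - 1 - s; - t],
          ((1, 1), 4%N));
        (tile [:: 1; 0; 1; 2]%N [:: -1; 1; 1; 1]
           [:: - s; 1 - t; - t; - 1 - s],
          ((1, 2), 4%N))].

Definition base_triangle (tau : R) : dressed :=
  dress
    (tile [:: 1; 0; 2]%N [:: -1; 1; 1] [:: tau - omega ^+ 2; 0; 0])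
    [:: (tile [:: 0; 2; 3]%N [:: 1; 1; 1] [:: 0; 0; omega - omega * tau],
          ((omega * tau - omega, - omega ^+ 2 + omega ^+ 2 * tau), 2%N));
        (tile [:: 1; 4; 0; 3; 2]%N [:: -1; 1; 1; -1; 1]
           [:: tau - omega ^+ 2; omega ^+ 2 - omega * tau; 0;
               omega - omega * tau; 0],
          ((0, omega ^+ 2 * tau - omega ^+ 3), 3%N));
        (tile [:: 1; 0; 4]%N [:: -1; 1; -1]
           [:: tau - omega ^+ 2; 0; omega ^+ 2 - omega * tau],
          ((omega * tau - 2 * omega, omega ^+ 2 * tau - 2 * omega ^+ 2),
            2%N))].

(* The values outside [0, 1] are irrelevant. *)
Definition renorm (tau : R) : R :=
  if (0 < tau) && (tau < beta ^+ 2) then omega ^+ 2 * tau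
  else if (beta ^+ 2 < tau) && (tau < beta) then omega ^+ 3 * (beta - tau)
  else if (beta < tau) && (tau < 1) then omega ^+ 2 * (1 - tau)
  else 0.

Definition base_self_similar (tau : R) : Prop :=
  exists m n, (0 < n)%N /\ iter (m + n) renorm tau = iter m renorm tau.

Definition self_similar D : Prop :=
  exists Y tau,
    [/\ Y `<=` dom D, 0 < tau < 1,
        dressed_similar (merge_atoms (subdomain D Y)) (base_triangle tau),
        exists N, orbits_tile D Y N
      & base_self_similar tau].

Definition open_triangle (p q r : R * R) : set (R * R) :=
  [set x | exists a b c : R, [/\ 0 < a, 0 < b, 0 < c, a + b + c = 1 &
     x = (a * p.1 + b * q.1 + c * r.1, a * p.2 + b * q.2 + c * r.2)]].

Definition Pi_triangle : set (R * R) :=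
  open_triangle (- 1 + 2 / alpha, - 1 + 2 / alpha)
    ((11 - 5 * alpha) / 2, (- 25 + 11 * alpha) / 4)
    ((11 - 5 * alpha) / 2, (11 - 5 * alpha) / 2).

Definition triangleC (s : R) : set (plane R) :=
  tile [:: 2; 1; 0]%N [:: 1; -1; 1] [:: - 1 - s; beta ^+ 4 - s; 1 - s].

Definition tauC (s : R) : R := omega ^+ 7 * (alpha * s + beta ^+ 3).

Definition Qsqrt5 : set R :=
  [set x | exists a b : rat, x = ratr a + ratr b * alpha].

End Plane.

Arguments Pi_triangle R : clear implicits.
Arguments Qsqrt5 R : clear implicits.

(* Main.v *)
Require Import Defs.
From Stdlib Require Import ZArith Relation_Operators.
From mathcomp Require Import all_boot all_order all_algebra.
From mathcomp Require Import all_classical all_reals all_analysis.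
From mathcomp Require Import measurable_realfun.
From mathcomp Require Import ring lra zify ssrZ.

Set Implicit Arguments.
Unset Strict Implicit.
Unset Printing Implicit Defensive.

Import Order.TTheory GRing.Theory Num.Theory.
Import numFieldNormedType.Exports.

Local Open Scope classical_set_scope.
Local Open Scope ring_scope.

(* The edges of the atoms of R(s, t), and of all their images that matter, lie
   on lines u_m . x = k - s or u_m . x = k - t with k in Z[omega].  Inclusion
   and disjointness of such polygons, for all (s, t) in Pi at once, reduce to
   signs at the three vertices of Pi of affine forms over Z[omega], which are
   decided by computation.  In this way 8 return orbits and 13 periodic orbits
   are seen to cover R, and they are disjoint because their itineraries differ.

   For 0 < tau < 1, the renormalization orbit of a tau in K = Q(sqrt 5) has a
   bounded denominator and a bounded Galois conjugate, hence is finite.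
   Conversely r is piecewise affine over K and expanding, so an eventually
   periodic tau solves a nondegenerate affine equation over K.

   It remains to see that any Y in R(s, t) similar to some B(tau), tau in K,
   forces s in K.  The return isometries of Y have translations in Z[omega]^2,
   so the similarity is defined over K.  Up to integer shifts of X, the map rho
   is discontinuous only where Y = -s.  If s is not in K, the orbit of a generic
   point z of the common edge of B_1 and B_2 avoids this line, so that a point
   of B_1 close to z shadows z until the second return of z to Y; but the first
   three returns of such a point to Y are elsewhere. *)

(** * Arithmetic of Z[omega] *)

(** The definition of [self_similar] leaves Y free, so the converse in (b) cannot use the tiles of
    C: nothing is known of Y beyond the similarity of its return map with B(tau). The contradiction
    is that B(tau) is discontinuous across the edge between B_1 and B_2, whose place in the rhombus
    is defined over K, whereas rho is discontinuous only across a line whose offset involves s. Two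
    returns of z are followed because the first one lies on the boundary of B(tau), where a nearby
    orbit may miss Y; the second is interior, so the shadowing point is certainly in Y at that time.
    The position X of z along the edge is a free parameter: it is taken outside K + K s, so that K +
    K X, which contains the coordinates of the whole orbit, does not contain s. Areas are never
    computed: covering and disjointness give the identity of areas by additivity. The polygons,
    words, centres and partition tree are certificates. As all edges are normal to one of five
    vectors, checking them only compares offsets. *)

Section Golden.
Variable R : realType.
Notation w := (omega R).

Lemma alpha_sqr : alpha R * alpha R = 5 :> R.
Proof. by rewrite -expr2 /alpha sqr_sqrtr. Qed.

Lemma alpha_gt2 : 2 < alpha R.
Proof.
rewrite /alpha -[ltLHS]ger0_norm // -sqrtr_sqr ltr_sqrt //; lra.
Qed.

Lemma alpha_lt : alpha R < 9 / 4.
Proof.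
rewrite /alpha -[ltRHS]ger0_norm // -sqrtr_sqr ltr_sqrt //; lra.
Qed.

Lemma alphaE : alpha R = 2 * w - 1.
Proof. by rewrite /omega; field. Qed.

Lemma betaE : beta R = w - 1.
Proof. by rewrite /omega /beta; field. Qed.

Lemma omega_sqr : w * w = w + 1 :> R.
Proof. by have := alpha_sqr; rewrite alphaE => h; lra. Qed.

Lemma omega_bounds : 3 / 2 < w < 13 / 8.
Proof. by have := alpha_gt2; have := alpha_lt; rewrite alphaE; lra. Qed.

End Golden.

(* (a, b) : zg stands for a + b omega *)
Definition zg := (Z * Z)%type.
Definition zgadd (x y : zg) : zg := (Z.add x.1 y.1, Z.add x.2 y.2).
Definition zgopp (x : zg) : zg := (Z.opp x.1, Z.opp x.2).
Definition zgmul (x y : zg) : zg :=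
  (Z.add (Z.mul x.1 y.1) (Z.mul x.2 y.2),
   Z.add (Z.add (Z.mul x.1 y.2) (Z.mul x.2 y.1)) (Z.mul x.2 y.2)).
Definition zgsub x y := zgadd x (zgopp y).
Definition zg0 : zg := (Z0, Z0).
Definition zg1 : zg := (Zpos 1, Z0).
Definition zgb : zg := (Zneg 1, Zpos 1).
Definition zgeq (x y : zg) := Z.eqb x.1 y.1 && Z.eqb x.2 y.2.

(* 2 (a + b omega) = (2 a + b) + b sqrt 5 *)
Definition zgnonneg (x : zg) : bool :=
  let u := Z.add (Z.mul (Zpos 2) x.1) x.2 in let b := x.2 in
  let bb := Z.mul (Zpos 5) (Z.mul b b) in let uu := Z.mul u u in
  if Z.leb Z0 u then Z.leb Z0 b || Z.leb bb uu
  else Z.leb Z0 b && Z.leb uu bb.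
Definition zgpos (x : zg) : bool :=
  let u := Z.add (Z.mul (Zpos 2) x.1) x.2 in let b := x.2 in
  let bb := Z.mul (Zpos 5) (Z.mul b b) in let uu := Z.mul u u in
  if Z.ltb Z0 u then Z.leb Z0 b || Z.ltb bb uu
  else Z.ltb Z0 b && Z.ltb uu bb.

Section GoldenVal.
Variable R : realType.
Notation w := (omega R).

Definition zr (n : Z) : R := (int_of_Z n)%:~R.
Lemma zrD m n : zr (Z.add m n) = zr m + zr n.
Proof. by rewrite /zr (raddfD int_of_Z) rmorphD. Qed.
Lemma zrN n : zr (Z.opp n) = - zr n.
Proof. by rewrite /zr (raddfN int_of_Z) rmorphN. Qed.
Lemma zrM m n : zr (Z.mul m n) = zr m * zr n.
Proof. by rewrite /zr (rmorphM int_of_Z) rmorphM. Qed.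
Lemma zr0 : zr Z0 = 0. Proof. by []. Qed.
Lemma zr_pos p : zr (Zpos p) = (Pos.to_nat p)%:R.
Proof. by rewrite /zr /=; case: (Pos.to_nat p) (Pos2Nat.is_pos p). Qed.
Lemma zr_ge0 n : Z.leb Z0 n -> 0 <= zr n.
Proof. by case: n => [|p|p] // _; rewrite zr_pos ler0n. Qed.
Lemma zr_le m n : Z.leb m n -> zr m <= zr n.
Proof.
move=> /Z.leb_le h; rewrite -subr_ge0 -zrN -zrD; apply: zr_ge0.
by apply/Z.leb_le; lia.
Qed.
Lemma zr_lt m n : Z.ltb m n -> zr m < zr n.
Proof.
move=> /Z.ltb_lt h; apply: (@lt_le_trans _ _ (zr (Z.add m (Zpos 1)))).
  by rewrite zrD zr_pos ltrDl ltr01.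
by apply: zr_le; apply/Z.leb_le; lia.
Qed.

Definition zv (x : zg) : R := zr x.1 + zr x.2 * w.

Lemma zvD x y : zv (zgadd x y) = zv x + zv y.
Proof. by rewrite /zv /= !zrD; ring. Qed.
Lemma zvN x : zv (zgopp x) = - zv x.
Proof. by rewrite /zv /= !zrN; ring. Qed.
Lemma zvB x y : zv (zgsub x y) = zv x - zv y.
Proof. by rewrite zvD zvN. Qed.
Lemma zvM x y : zv (zgmul x y) = zv x * zv y.
Proof. have ww := omega_sqr R; rewrite /zv /= !(zrD, zrM); ring: ww. Qed.
Lemma zv0 : zv zg0 = 0. Proof. by rewrite /zv /= zr0; ring. Qed.
Lemma zv1 : zv zg1 = 1. Proof. by rewrite /zv /zr /= mul0r addr0. Qed.
Lemma zvb : zv zgb = beta R.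
Proof. by rewrite betaE /zv /zr /= mul1r mulrN1z addrC. Qed.

Lemma zgeqP x y : zgeq x y -> x = y.
Proof. by case: x y => [a b] [c d] /andP[/= /Z.eqb_eq -> /Z.eqb_eq ->]. Qed.

Lemma zv_sqrt5 x :
  2 * zv x = zr (Z.add (Z.mul (Zpos 2) x.1) x.2) + zr x.2 * alpha R.
Proof.
by rewrite /zv alphaE zrD zrM (_ : zr (Zpos 2) = 2) //; ring.
Qed.

Lemma addr_ge0_sqr (u x : R) : 0 <= u -> x ^+ 2 <= u ^+ 2 -> 0 <= u + x.
Proof. by move=> u0 xu; rewrite leNgt; apply/negP => h; nra. Qed.

Lemma addr_gt0_sqr (u x : R) : 0 <= u -> x ^+ 2 < u ^+ 2 -> 0 < u + x.
Proof. by move=> u0 xu; rewrite ltNge; apply/negP => h; nra. Qed.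

Lemma zgnonnegP x : zgnonneg x -> 0 <= zv x.
Proof.
rewrite /zgnonneg => h; rewrite -(pmulr_rge0 _ (ltr0Sn R 1)) zv_sqrt5.
move: h; set u := Z.add _ _; set b := x.2.
have al : 0 <= alpha R by have := alpha_gt2 R; lra.
have aa := alpha_sqr R.
have E5 : zr (Z.mul (Zpos 5) (Z.mul b b)) = (zr b * alpha R) ^+ 2.
  by rewrite !zrM (_ : zr (Zpos 5) = 5) //; ring: aa.
have Eu : zr (Z.mul u u) = zr u ^+ 2 by rewrite zrM expr2.
case: ifP => [/zr_ge0 hu /orP[/zr_ge0 hb|/zr_le]|hu /andP[/zr_ge0 hb /zr_le]].
- by rewrite addr_ge0 ?mulr_ge0.
- by rewrite E5 Eu; apply: addr_ge0_sqr.
- by rewrite E5 Eu addrC; apply: addr_ge0_sqr; rewrite mulr_ge0.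
Qed.

Lemma zgposP x : zgpos x -> 0 < zv x.
Proof.
rewrite /zgpos => h; rewrite -(pmulr_rgt0 _ (ltr0Sn R 1)) zv_sqrt5.
move: h; set u := Z.add _ _; set b := x.2.
have al : 0 < alpha R by have := alpha_gt2 R; lra.
have aa := alpha_sqr R.
have E5 : zr (Z.mul (Zpos 5) (Z.mul b b)) = (zr b * alpha R) ^+ 2.
  by rewrite !zrM (_ : zr (Zpos 5) = 5) //; ring: aa.
have Eu : zr (Z.mul u u) = zr u ^+ 2 by rewrite zrM expr2.
case: ifP => [/zr_lt hu /orP[/zr_ge0 hb|/zr_lt]|hu /andP[/zr_lt hb /zr_lt]].
- by rewrite zr0 in hu; rewrite ltr_wpDr // mulr_ge0 // ltW.
- by rewrite zr0 in hu; rewrite E5 Eu; apply: addr_gt0_sqr; rewrite ltW.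
- rewrite zr0 in hb; rewrite E5 Eu addrC; apply: addr_gt0_sqr.
  by rewrite mulr_ge0 ?ltW.
Qed.

End GoldenVal.

(** * Polygons with edge offsets in Z[omega] - s and Z[omega] - t *)

Section Plane.
Variable R : realType.
Implicit Types (x y d : R * R).

Lemma udotD m x y : udot m (x + y) = udot m x + udot m y.
Proof. by case: m => [|[|[|[|m]]]] //=; ring. Qed.

Lemma udotN m x : udot m (- x) = - udot m x.
Proof. by case: m => [|[|[|[|m]]]] //=; ring. Qed.

Lemma udotZ m (a : R) x : udot m (a * x.1, a * x.2) = a * udot m x.
Proof. by case: m => [|[|[|[|m]]]] //=; ring. Qed.

Lemma translE d x : transl d x = x + d.
Proof. by []. Qed.

Lemma rot1_is_additive : {morph @rot1 R : x y / x + y}.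
Proof. by move=> x y; congr pair; rewrite /=; ring. Qed.

Lemma iter_rot1D m : {morph iter m (@rot1 R) : x y / x + y}.
Proof. by elim: m => [//|m ih] x y; rewrite !iterS ih rot1_is_additive. Qed.

Lemma iter_rot10 m : iter m (@rot1 R) 0 = 0.
Proof. by apply: (addrI (iter m (@rot1 R) 0)); rewrite -iter_rot1D !addr0. Qed.

Lemma iter_rot1N m x : iter m (@rot1 R) (- x) = - iter m (@rot1 R) x.
Proof.
by apply/eqP; rewrite -addr_eq0 -iter_rot1D addNr iter_rot10.
Qed.

Lemma rot1_5 x : iter 5 (@rot1 R) x = x.
Proof.
by case: x => a b; congr pair; rewrite /= betaE;
  have ww := omega_sqr R; ring: ww.
Qed.

Lemma iter_rot1_5 k x : iter (5 * k) (@rot1 R) x = x.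
Proof. by elim: k => // k ih; rewrite mulnS iterD rot1_5. Qed.

Lemma iter_rot1_mod m x : iter (m %% 5) (@rot1 R) x = iter m (@rot1 R) x.
Proof. by rewrite {2}(divn_eq m 5) addnC mulnC iterD iter_rot1_5. Qed.

Lemma udot_rot1 m x : (m < 5)%N -> udot ((m + 1) %% 5) (rot1 x) = udot m x.
Proof.
have ww := omega_sqr R.
by case: m => [|[|[|[|[|m]]]]] //= _; rewrite betaE; ring: ww.
Qed.

Lemma udot_rot m r x : (m < 5)%N ->
  udot ((m + r) %% 5) (iter r (@rot1 R) x) = udot m x.
Proof.
move=> m5; elim: r => [|r ih]; first by rewrite addn0 modn_small.
by rewrite -{}ih iterS -[RHS]udot_rot1 ?ltn_mod // modnDml addnS addn1.
Qed.

Lemma udot_TR d m r x : (m < 5)%N ->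
  udot ((m + r) %% 5) (TR d r x) = udot m x + udot ((m + r) %% 5) d.
Proof. by move=> m5; rewrite /TR translE udotD udot_rot. Qed.

(** [rot1] has order 5, so the inverse of its r-th power is its power 4r; inverses of rotations are
    written in this way throughout. *)
Lemma TRK d r : cancel (fun y => iter (4 * r) (@rot1 R) (y - d)) (TR d r).
Proof.
by move=> y; rewrite /TR translE -iterD -mulSn iter_rot1_5 subrK.
Qed.

Lemma TR_inj d r : injective (@TR R d r).
Proof.
move=> x y; rewrite /TR !translE => /addIr.
move=> /(congr1 (iter (4 * r) (@rot1 R))).
by rewrite -!iterD -!mulSnr !iter_rot1_5.
Qed.

Lemma TR_comp d1 r1 d2 r2 x :
  TR d2 r2 (TR d1 r1 x) = TR (iter r2 (@rot1 R) d1 + d2) (r1 + r2) x.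
Proof.
by rewrite /TR !translE iter_rot1D -iterD addrA [(r2 + r1)%N]addnC.
Qed.

Lemma TR_mod d r x : TR d (r %% 5) x = TR d r x.
Proof. by rewrite /TR iter_rot1_mod. Qed.

End Plane.

Definition unorm (m : nat) : zg * zg :=
  match m with
  | 0 => (zg1, zg0)
  | 1 => (zg0, zg1)
  | 2 => (zgopp zg1, zgb)
  | 3 => (zgopp zgb, zgopp zgb)
  | _ => (zgb, zgopp zg1)
  end.

Definition zgdot (m : nat) (d : zg * zg) : zg :=
  zgadd (zgmul (unorm m).1 d.1) (zgmul (unorm m).2 d.2).

Arguments zgadd : simpl never.
Arguments zgopp : simpl never.
Arguments zgmul : simpl never.
Arguments zgdot : simpl never.

Definition zgrot1 (d : zg * zg) : zg * zg := (zgsub (zgmul zgb d.1) d.2, d.1).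

(* (k, (c, c')) stands for k + c s + c' t *)
Definition aff := (zg * (zg * zg))%type.
Definition affadd (f g : aff) : aff :=
  (zgadd f.1 g.1, (zgadd f.2.1 g.2.1, zgadd f.2.2 g.2.2)).
Definition affscale (l : zg) (f : aff) : aff :=
  (zgmul l f.1, (zgmul l f.2.1, zgmul l f.2.2)).
Definition affopp (f : aff) : aff :=
  (zgopp f.1, (zgopp f.2.1, zgopp f.2.2)).

(* The vertices of Pi, multiplied by 20 to clear denominators. *)
Definition pi_vertices : seq (zg * zg) :=
  [:: ((Zneg 28, Zpos 16), (Zneg 28, Zpos 16));
      ((Zpos 160, Zneg 100), (Zneg 180, Zpos 110));
      ((Zpos 160, Zneg 100), (Zpos 160, Zneg 100))].
Definition affat (f : aff) (v : zg * zg) : zg :=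
  zgadd (zgmul (Zpos 20, Z0) f.1) (zgadd (zgmul f.2.1 v.1) (zgmul f.2.2 v.2)).
Definition affnonneg (f : aff) := all (fun v => zgnonneg (affat f v)) pi_vertices.
(** In the open triangle all barycentric weights are positive, so nonnegative values at the
    vertices, one of them positive, make the form positive on Pi. *)
Definition affpos (f : aff) :=
  affnonneg f && has (fun v => zgpos (affat f v)) pi_vertices.

(* (m, (e, (c, k))) stands for u_m . x < b if e, and b <= u_m . x otherwise,
   where b = k - t if c, and b = k - s otherwise. *)
Definition cstr := (nat * (bool * (bool * zg)))%type.
Definition ctile := seq cstr.

Definition off_aff (b : bool * zg) : aff :=
  (b.2, if b.1 then (zg0, zgopp zg1) else (zgopp zg1, zg0)).

(* The coefficients l and q of u_m = l u_i + q u_j, as a function of j - i and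
   m - i modulo 5; the entries for j = i are junk. *)
Definition cramer (i j m : nat) : zg * zg :=
  let b := zgb in let mb := zgopp zgb in let m1 := zgopp zg1 in
  let w := (Z0, Zpos 1) in let mw := (Z0, Zneg 1) in
  nth (zg0, zg0) (nth [::]
    [:: [::];
     [:: (zg1, zg0); (zg0, zg1); (m1, b); (mb, mb); (b, m1)];
     [:: (zg1, zg0); (w, w); (zg0, zg1); (mw, m1); (m1, mw)];
     [:: (zg1, zg0); (m1, mw); (mw, m1); (zg0, zg1); (w, w)];
     [:: (zg1, zg0); (b, m1); (mb, mb); (m1, b); (zg0, zg1)]]
    ((j + 5 - i) %% 5)%N) ((m + 5 - i) %% 5)%N.

(* [has] and [all] without evaluation of the tail under call by value *)
Fixpoint lazy_has (T : Type) (p : T -> bool) (s : seq T) : bool :=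
  if s is x :: s' then if p x then true else lazy_has p s' else false.
Fixpoint lazy_all (T : Type) (p : T -> bool) (s : seq T) : bool :=
  if s is x :: s' then if p x then lazy_all p s' else false else true.

(* Does u_m = l u_i + q u_j combine the half-planes h1 and h2 into h? *)
Definition combine (h1 h2 h : cstr) : bool :=
  let: (i, (ei, bi)) := h1 in let: (j, (ej, bj)) := h2 in
  let: (m, (e, b)) := h in
  let: (l, q) := cramer i j m in
  let chk c := zgeq (zgadd (zgmul l (c (unorm i))) (zgmul q (c (unorm j))))
                    (c (unorm m)) in
  if zgnonneg (if eqb ei e then l else zgopp l) then
  if zgnonneg (if eqb ej e then q else zgopp q) then
  if chk fst && chk snd then
    let v := affadd (off_aff b) (affopp (affadd (affscale l (off_aff bi))
                (affscale q (off_aff bj)))) in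
    if e then
      if ei && zgpos l || ej && zgpos q then affnonneg v else affpos v
    else affnonneg (affopp v)
  else false else false else false.

(** In the plane a consequence of finitely many linear inequalities follows from at most two of
    them, hence the search over pairs; a single one is the case of a zero coefficient. One pair has
    to serve for all of Pi, so the test is sound without being complete. *)
Definition implies (T : ctile) (h : cstr) : bool :=
  lazy_has (fun h1 => lazy_has (fun h2 => combine h1 h2 h) T) T.
Definition included (T T' : ctile) : bool := lazy_all (implies T) T'.
Definition negc (h : cstr) : cstr := (h.1, (~~ h.2.1, h.2.2)).
(** Disjoint convex polygons of the plane can be separated along an edge of one of them, so it is
    enough to try the complements of the given half-planes. *)
Definition separated (T T' : ctile) : bool :=
  if lazy_has (fun h => implies T (negc h)) T' then true
  else lazy_has (fun h => implies T' (negc h)) T.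

Definition ciso := ((zg * zg) * nat)%type.
Definition imc (f : ciso) (h : cstr) : cstr :=
  let m := ((h.1 + f.2) %% 5)%N in
  (m, (h.2.1, (h.2.2.1, zgadd h.2.2.2 (zgdot m f.1)))).
Definition imt (f : ciso) (T : ctile) : ctile := map (imc f) T.
Definition wft (T : ctile) := all (fun h : cstr => h.1 < 5)%N T.
Definition ccomp (g f : ciso) : ciso :=
  (let d := iter g.2 zgrot1 f.1 in (zgadd d.1 g.1.1, zgadd d.2 g.1.2),
   ((f.2 + g.2) %% 5)%N).

(* (n, (p, q)) stands for the point (p / n, q / n) *)
Definition cpoint := (positive * (aff * aff))%type.
Definition strictly_in (p : cpoint) (T : ctile) : bool :=
  all (fun h : cstr => let v := affadd (affscale (Zpos p.1, Z0) (off_aff h.2.2))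
      (affopp (affadd (affscale (unorm h.1).1 p.2.1)
                      (affscale (unorm h.1).2 p.2.2))) in
    affpos (if h.2.1 then v else affopp v)) T.
Definition weakly_in (p : cpoint) (T : ctile) : bool :=
  all (fun h : cstr => let v := affadd (affscale (Zpos p.1, Z0) (off_aff h.2.2))
      (affopp (affadd (affscale (unorm h.1).1 p.2.1)
                      (affscale (unorm h.1).2 p.2.2))) in
    affnonneg (if h.2.1 then v else affopp v)) T.

Lemma lazy_hasE (T : Type) (p : T -> bool) s : lazy_has p s = has p s.
Proof. by elim: s => //= x s ->; case: ifP. Qed.
Lemma lazy_allE (T : Type) (p : T -> bool) s : lazy_all p s = all p s.
Proof. by elim: s => //= x s ->; case: ifP. Qed.

Section Engine.
Variables (R : realType) (s t : R).
Hypothesis st_Pi : Pi_triangle R (s, t).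

Lemma udotE m (x : R * R) :
  udot m x = zv R (unorm m).1 * x.1 + zv R (unorm m).2 * x.2.
Proof.
by case: m => [|[|[|[|m]]]] /=; rewrite ?(zvN, zv0, zv1, zvb); ring.
Qed.

Definition zvp (d : zg * zg) : R * R := (zv R d.1, zv R d.2).

Lemma zv_dot m d : zv R (zgdot m d) = udot m (zvp d).
Proof. by rewrite udotE zvD !zvM. Qed.

Lemma zvp_rot1 d : zvp (zgrot1 d) = rot1 (zvp d).
Proof. by rewrite /zvp /zgrot1 /rot1 /= zvB zvM zvb. Qed.

Lemma zvp_iter_rot1 m d : zvp (iter m zgrot1 d) = iter m (@rot1 R) (zvp d).
Proof. by elim: m => //= m ih; rewrite zvp_rot1 ih. Qed.

Definition av (f : aff) : R := zv R f.1 + zv R f.2.1 * s + zv R f.2.2 * t.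

Lemma avD f g : av (affadd f g) = av f + av g.
Proof. by rewrite /av /= !zvD; ring. Qed.
Lemma avN f : av (affopp f) = - av f.
Proof. by rewrite /av /= !zvN; ring. Qed.
Lemma avZ l f : av (affscale l f) = zv R l * av f.
Proof. by rewrite /av /= !zvM; ring. Qed.

Lemma av_vertices f : exists a b c : R, [/\ 0 < a, 0 < b, 0 < c &
  20 * av f = a * zv R (affat f (nth (zg0, zg0) pi_vertices 0)) +
    b * zv R (affat f (nth (zg0, zg0) pi_vertices 1)) +
    c * zv R (affat f (nth (zg0, zg0) pi_vertices 2))].
Proof.
have [a [b [c [a0 b0 c0 abc [hs ht]]]]] := st_Pi.
exists a, b, c; split=> //.
have al : 2 / alpha R = 2 / 5 * alpha R.
  have aa := alpha_sqr R; have a2 := alpha_gt2 R.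
  have a_neq0 : alpha R != 0 by lra.
  by apply: (mulIf a_neq0); rewrite divfK // -[RHS]mulrA aa; field.
rewrite /= in hs ht; rewrite al in hs ht.
have -> : c = 1 - a - b by lra.
have hs' : s = a * (- 1 + 2 / 5 * alpha R) + (1 - a) * ((11 - 5 * alpha R) / 2).
  by rewrite hs (_ : c = 1 - a - b); [field | lra].
have ht' : t = a * (- 1 + 2 / 5 * alpha R) + b * ((- 25 + 11 * alpha R) / 4)
              + (1 - a - b) * ((11 - 5 * alpha R) / 2).
  by rewrite ht (_ : c = 1 - a - b); [field | lra].
rewrite /av hs' ht' /= /affat !(zvD, zvM) /=.
rewrite alphaE.
have e20 : zv R (Zpos 20, Z0) = 20 by rewrite /zv /zr /= mul0r addr0.
have e1 : zv R (Zneg 28, Zpos 16) = - 28 + 16 * omega R by [].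
have e2 : zv R (Zpos 160, Zneg 100) = 160 - 100 * omega R.
  by rewrite /zv /= -mulNr.
have e3 : zv R (Zneg 180, Zpos 110) = - 180 + 110 * omega R by [].
by rewrite e20 e1 e2 e3; field.
Qed.

Lemma affnonnegP f : affnonneg f -> 0 <= av f.
Proof.
have [a [b [c [a0 b0 c0 E]]]] := av_vertices f.
rewrite /affnonneg /pi_vertices /= => /and4P[/(zgnonnegP R) h1
  /(zgnonnegP R) h2 /(zgnonnegP R) h3 _].
rewrite -(pmulr_rge0 _ (ltr0Sn R 19)) E.
by rewrite !addr_ge0 // mulr_ge0 // ltW.
Qed.

Lemma affposP f : affpos f -> 0 < av f.
Proof.
have [a [b [c [a0 b0 c0 E]]]] := av_vertices f.
rewrite /affpos => /andP[]; rewrite /affnonneg /pi_vertices /=.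
move=> /and4P[/(zgnonnegP R) h1 /(zgnonnegP R) h2 /(zgnonnegP R) h3 _].
rewrite -(pmulr_rgt0 _ (ltr0Sn R 19)) E orbF.
have m1 := mulr_ge0 (ltW a0) h1; have m2 := mulr_ge0 (ltW b0) h2.
have m3 := mulr_ge0 (ltW c0) h3.
case/or3P => /(zgposP R) h.
- by have := mulr_gt0 a0 h; lra.
- by have := mulr_gt0 b0 h; lra.
- by have := mulr_gt0 c0 h; lra.
Qed.

Definition off (b : bool * zg) : R := zv R b.2 - (if b.1 then t else s).

Lemma av_off b : av (off_aff b) = off b.
Proof.
by case: b => [[|] k]; rewrite /av /off /= zvN zv0 zv1; ring.
Qed.

Definition hold (h : cstr) (x : R * R) : bool :=
  let b := off h.2.2 in
  if h.2.1 then udot h.1 x < b else b <= udot h.1 x.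
Definition cset (T : ctile) : set (R * R) := [set x | all (hold^~ x) T].

Lemma hold_negc h x : hold (negc h) x = ~~ hold h x.
Proof. by case: h => m [[|] b]; rewrite /hold /= -?leNgt -?ltNge. Qed.

(** Multiplying by coefficients of the right sign and adding bounds u_m . x by the combined offset.
    A strict conclusion needs either a strict premise with a positive coefficient or a gap between
    the offsets that is positive on Pi. *)
Lemma combineP h1 h2 h x :
  hold h1 x -> hold h2 x -> combine h1 h2 h -> hold h x.
Proof.
case: h1 h2 h => i [ei bi] [j [ej bj]] [m [e b]].
rewrite /combine; case: (cramer i j m) => l q.
move=> hi hj; case: ifP => // hl; case: ifP => // hq.
case: ifP => // /andP[/zgeqP/(congr1 (zv R)) E1 /zgeqP/(congr1 (zv R)) E2].
set v := affadd _ _.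
have vE : av v = off b - (zv R l * off bi + zv R q * off bj).
  by rewrite /v avD avN avD !avZ !av_off.
have uE : udot m x = zv R l * udot i x + zv R q * udot j x.
  by rewrite !udotE -E1 -E2 !(zvD, zvM); ring.
rewrite /hold /= in hi hj *.
have {}hl : if e then zv R l * udot i x <= zv R l * off bi
            else zv R l * off bi <= zv R l * udot i x.
  case: e hl {hq vE v} => /=; case: (ei) hi => /= hi /(zgnonnegP R); rewrite ?zvN;
    rewrite ?oppr_ge0 => hl; do ?[by rewrite ler_wpM2l // ?ltW
                               | by rewrite ler_wnM2l // ?ltW].
have {}hq : if e then zv R q * udot j x <= zv R q * off bj
            else zv R q * off bj <= zv R q * udot j x.
  case: e hq {vE hl v} => /=; case: (ej) hj => /= hj /(zgnonnegP R);
    rewrite ?zvN ?oppr_ge0 => hq; do ?[by rewrite ler_wpM2l // ?ltW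
                               | by rewrite ler_wnM2l // ?ltW].
case: e hl hq => /= hl hq; last first.
  by move=> /affnonnegP; rewrite avN vE; lra.
case: ifP => [/orP[/andP[ei1 /(zgposP R) l0]|/andP[ej1 /(zgposP R) q0]]|_].
- move=> /affnonnegP; rewrite vE.
  have : zv R l * udot i x < zv R l * off bi by rewrite ltr_pM2l // ei1 in hi *.
  by lra.
- move=> /affnonnegP; rewrite vE.
  have : zv R q * udot j x < zv R q * off bj by rewrite ltr_pM2l // ej1 in hj *.
  by lra.
- by move=> /affposP; rewrite vE; lra.
Qed.

Lemma impliesP T h x : implies T h -> cset T x -> hold h x.
Proof.
rewrite /implies lazy_hasE => /hasP[h1 h1T]; rewrite lazy_hasE.
by move=> /hasP[h2 h2T c] /allP Tx; apply: combineP (Tx _ h1T) (Tx _ h2T) c.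
Qed.

Lemma includedP T T' : included T T' -> cset T `<=` cset T'.
Proof.
rewrite /included lazy_allE => /allP TT' x Tx.
by apply/allP => h /TT' /impliesP; apply.
Qed.

Lemma separatedP T T' x : separated T T' -> cset T x -> ~ cset T' x.
Proof.
rewrite /separated !lazy_hasE; case: ifP => [/hasP[h hT /impliesP i] _|_
  /hasP[h hT /impliesP i]] Tx T'x.
- by have := i _ Tx; rewrite hold_negc (allP T'x).
- by have := i _ T'x; rewrite hold_negc (allP Tx).
Qed.

Definition isoR (f : ciso) : R * R -> R * R := TR (zvp f.1) f.2.

Lemma hold_im f h x : (h.1 < 5)%N -> hold (imc f h) (isoR f x) = hold h x.
Proof.
case: h => m [e [c k]] /= m5; rewrite /hold /imc /= udot_TR //.
rewrite /off /= zvD zv_dot addrAC.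
by case: e; rewrite ?ltrD2r ?lerD2r.
Qed.

Lemma cset_im f T x : wft T -> cset (imt f T) (isoR f x) <-> cset T x.
Proof.
move=> /allP wT; rewrite /cset /= all_map.
by split=> /allP H; apply/allP => h hT; have := H h hT; rewrite /= hold_im // wT.
Qed.

Lemma wft_im f T : wft (imt f T).
Proof. by apply/allP => _ /mapP[h _ ->] /=; rewrite ltn_mod. Qed.

Lemma image_cset f T : wft T -> isoR f @` cset T = cset (imt f T).
Proof.
move=> wT; apply/seteqP; split=> [_ [x Tx <-]|y Ty]; first exact/cset_im.
exists (iter (4 * f.2) (@rot1 R) (y - zvp f.1)); last exact: TRK.
by apply/(cset_im f _ wT); rewrite /isoR TRK.
Qed.

Lemma isoR_comp g f x : isoR (ccomp g f) x = isoR g (isoR f x).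
Proof.
rewrite /isoR /ccomp /= TR_mod TR_comp; congr TR.
by rewrite -zvp_iter_rot1 /zvp /= !zvD.
Qed.

Lemma isoR_inj f : injective (isoR f).
Proof. exact: TR_inj. Qed.

Definition pointR (p : cpoint) : R * R :=
  (av p.2.1 / zr R (Zpos p.1), av p.2.2 / zr R (Zpos p.1)).

Lemma udot_point m (p : cpoint) : zr R (Zpos p.1) * udot m (pointR p) =
  av (affadd (affscale (unorm m).1 p.2.1) (affscale (unorm m).2 p.2.2)).
Proof.
have p0 : zr R (Zpos p.1) != 0.
  by rewrite zr_pos pnatr_eq0; have := Pos2Nat.is_pos p.1; lia.
by rewrite udotE avD !avZ /pointR /=; field.
Qed.

Lemma zr_pos_gt0 p : 0 < zr R (Zpos p).
Proof. by rewrite zr_pos ltr0n; have := Pos2Nat.is_pos p; lia. Qed.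

Lemma strictly_inP p T : strictly_in p T -> forall h, h \in T ->
  if h.2.1 then udot h.1 (pointR p) < off h.2.2
  else off h.2.2 < udot h.1 (pointR p).
Proof.
move=> /allP H h /H /=; have p0 := zr_pos_gt0 p.1.
have E : zv R (Zpos p.1, Z0) = zr R (Zpos p.1) by rewrite /zv /= zr0 mul0r addr0.
by case: ifP => _ /affposP; rewrite ?avN avD avN avZ -udot_point av_off E
  ?oppr_gt0 ?subr_gt0 ?subr_lt0 ltr_pM2l.
Qed.

Lemma weakly_inP p T : weakly_in p T -> forall h, h \in T ->
  if h.2.1 then udot h.1 (pointR p) <= off h.2.2
  else off h.2.2 <= udot h.1 (pointR p).
Proof.
move=> /allP H h /H /=; have p0 := zr_pos_gt0 p.1.
have E : zv R (Zpos p.1, Z0) = zr R (Zpos p.1) by rewrite /zv /= zr0 mul0r addr0.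
by case: ifP => _ /affnonnegP; rewrite ?avN avD avN avZ -udot_point av_off E
  ?oppr_ge0 ?subr_ge0 ?subr_le0 ler_pM2l.
Qed.

Lemma strictly_in_cset p T : strictly_in p T -> cset T (pointR p).
Proof.
move=> /strictly_inP H; apply/allP => h /H; rewrite /hold /=.
by case: ifP => // _ /ltW.
Qed.

End Engine.

(** * Return orbits and periodic orbits of the rhombus map *)

Delimit Scope Z_scope with bigZ.
Arguments Zpos _%positive.
Definition upS (m : nat) (a b : Z) : cstr := (m, (true, (false, (a, b)))).
Definition upT (m : nat) (a b : Z) : cstr := (m, (true, (true, (a, b)))).
Definition loS (m : nat) (a b : Z) : cstr := (m, (false, (false, (a, b)))).
Definition loT (m : nat) (a b : Z) : cstr := (m, (false, (true, (a, b)))).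
Definition afc (a b c d e f : Z) : aff := ((a, b), ((c, d), (e, f))).
Arguments upS _%nat _%bigZ _%bigZ.
Arguments upT _%nat _%bigZ _%bigZ.
Arguments loS _%nat _%bigZ _%bigZ.
Arguments loT _%nat _%bigZ _%bigZ.
Arguments afc _%bigZ _%bigZ _%bigZ _%bigZ _%bigZ _%bigZ.

(* Binary space partitions: [BS m a b l r] and [BT m a b l r] split along
   u_m . x = a + b omega - s, respectively a + b omega - t, into the lower part
   l and the upper part r; the leaf [L i] is covered by the i-th tile. *)
Inductive bsp : Type :=
| L of nat
| Node of nat & bool * zg & bsp & bsp.
Definition BS (m : nat) (a b : Z) := Node m (false, (a, b)).
Definition BT (m : nat) (a b : Z) := Node m (true, (a, b)).
Arguments BS _%nat _%bigZ _%bigZ _ _.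
Arguments BT _%nat _%bigZ _%bigZ _ _.
Arguments L _%nat.

Definition rhombus_tile : ctile := [:: loT 0 0 0; loS 1 0 0; upT 0 1 0; upS 1 1 0].
Definition rhombus_atoms : seq ctile :=
  [:: [:: loT 0 0 0; loS 2 0 0; upS 1 1 0];
      [:: loT 0 0 0; loT 1 0 0; loS 2 (-1) 0; upT 0 1 0; upS 1 1 0; upS 2 0 0];
      [:: upT 0 1 0; upS 2 (-1) 0; loT 1 0 0];
      [:: loT 0 0 0; loS 1 0 0; loS 2 (-1) 0; upT 1 0 0];
      [:: loS 1 0 0; upT 0 1 0; upT 1 0 0; upS 2 (-1) 0]].
Definition rhombus_isos : seq ciso :=
  [:: ((zg0, zg0), 4%N); ((zg0, zg1), 4%N); ((zg0, (Zpos 2, Z0)), 4%N);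
      ((zg1, zg1), 4%N); ((zg1, (Zpos 2, Z0)), 4%N)].
Definition triangle_tile : ctile := [:: upS 2 (-1) 0; loS 1 5 (-3); upS 0 1 0].

(* Tiles with the itineraries of their orbits; the atoms R_1, ..., R_5 are
   numbered from 0. *)
Definition return_orbits : seq (ctile * seq nat) := [::
  ([:: upS 2 (-1) 0; upS 0 1 0; upS 3 12 (-8)],
   [:: 2; 0; 1; 1; 0; 1; 1; 0; 2; 0; 1; 1; 0; 1; 0; 1; 0; 1; 1; 0; 2; 0;
     1; 1; 0; 1; 1; 0]%N);
  ([:: upS 2 (-1) 0; loT 1 5 (-3); upS 0 1 0; loT 3 12 (-8); upS 4 (-11) 7],
   [:: 2; 0; 1; 1; 0; 1; 1; 0; 2; 0; 1; 1; 0; 1; 0; 1; 0; 1; 1; 0; 2; 0;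
     1; 1; 0; 1; 0; 1; 0; 1; 1; 0; 2; 0; 1; 1; 0; 1; 0; 1; 0; 1; 1; 0; 2;
     0; 1; 1; 0; 1; 1; 0]%N);
  ([:: upS 2 (-1) 0; upS 0 1 0; loS 3 12 (-8); upT 3 12 (-8)],
   [:: 2; 0; 1; 1; 0; 1; 1; 0; 2; 0; 1; 1; 0; 1; 0; 1; 0; 1; 1; 0; 2; 0;
     1; 1; 0; 1; 0; 3; 1; 1; 1; 0; 4; 1; 1; 1; 0; 3; 1; 1; 0; 1; 1; 0; 2;
     0; 1; 1; 0; 1; 1; 0]%N);
  ([:: upS 2 (-1) 0; loS 1 5 (-3); upT 1 5 (-3); upS 4 (-11) 7],
   [:: 2; 0; 1; 1; 0; 1; 1; 0; 2; 0; 1; 1; 0; 1; 0; 3; 1; 1; 1; 0; 4; 1;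
     1; 1; 0; 3; 1; 1; 0; 1; 1; 0; 2; 0; 1; 1; 0; 1; 0; 1; 0; 1; 1; 0; 2;
     0; 1; 1; 0; 1; 1; 0]%N);
  ([:: loT 1 5 (-3); upS 0 1 0; loT 4 (-11) 7],
   [:: 2; 0; 1; 1; 0; 1; 1; 0; 2; 0; 1; 1; 0; 1; 0; 1; 0; 1; 1; 0; 2; 0;
     1; 1; 0; 1; 0; 1; 0; 1; 1; 0; 1; 1; 0; 1; 1; 0; 1; 0; 1; 0; 1; 1; 0;
     1; 1; 0; 1; 1; 0; 1; 0; 1; 0; 1; 1; 0; 2; 0; 1; 1; 0; 1; 0; 1; 0; 1;
     1; 0; 2; 0; 1; 1; 0; 1; 1; 0]%N);
  ([:: loT 1 5 (-3); upS 0 1 0; loS 4 (-11) 7; upT 4 (-11) 7],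
   [:: 2; 0; 1; 1; 0; 1; 1; 0; 2; 0; 1; 1; 0; 1; 0; 1; 0; 1; 1; 0; 2; 0;
     1; 1; 0; 1; 0; 1; 0; 1; 1; 0; 1; 3; 1; 1; 1; 0; 3; 1; 1; 0; 1; 1; 0;
     1; 1; 0; 1; 1; 0; 1; 0; 3; 1; 1; 1; 0; 4; 1; 1; 1; 0; 3; 1; 1; 0; 1;
     1; 0; 2; 0; 1; 1; 0; 1; 1; 0]%N);
  ([:: loS 1 5 (-3); upS 0 1 0; upT 1 5 (-3); loT 4 (-11) 7],
   [:: 2; 0; 1; 1; 0; 1; 1; 0; 2; 0; 1; 1; 0; 1; 0; 3; 1; 1; 1; 0; 4; 1;
     1; 1; 0; 3; 1; 1; 0; 1; 1; 0; 1; 1; 0; 1; 1; 0; 1; 0; 3; 1; 1; 1; 0;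
     3; 2; 0; 1; 1; 0; 1; 0; 1; 0; 1; 1; 0; 2; 0; 1; 1; 0; 1; 0; 1; 0; 1;
     1; 0; 2; 0; 1; 1; 0; 1; 1; 0]%N);
  ([:: loS 1 5 (-3); upT 1 5 (-3); loS 4 (-11) 7; upT 4 (-11) 7],
   [:: 2; 0; 1; 1; 0; 1; 1; 0; 2; 0; 1; 1; 0; 1; 0; 3; 1; 1; 1; 0; 4; 1;
     1; 1; 0; 3; 1; 1; 0; 1; 1; 0; 1; 3; 1; 1; 1; 0; 3; 1; 3; 1; 1; 1; 0;
     3; 2; 0; 1; 1; 0; 1; 0; 3; 1; 1; 1; 0; 4; 1; 1; 1; 0; 3; 1; 1; 0; 1;
     1; 0; 2; 0; 1; 1; 0; 1; 1; 0]%N)].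

Definition periodic_orbits : seq (ctile * seq nat) := [::
  ([:: upS 0 1 0; upS 1 1 0; upS 2 0 0; upS 3 1 (-1); upS 4 0 0],
   [:: 1]%N);
  ([:: loT 0 0 0; loT 2 0 0; loT 1 2 (-1); loT 3 1 (-1); loT 4 1 (-1)],
   [:: 0; 1]%N);
  ([:: loT 0 0 0; loT 2 0 0; upS 1 1 0; loT 1 (-1) 1; loT 3 (-1) 0; upS 2 2
    (-1); upS 3 1 (-1); loT 4 (-1) 0; upS 4 1 (-1); upS 0 2 (-1)],
   [:: 0; 1; 1]%N);
  ([:: upS 1 1 0; upS 2 2 (-1); upS 3 4 (-3); upS 4 (-1) 0; upS 0 5 (-3)],
   [:: 0; 1; 1; 0; 1; 1; 0; 2]%N);
  ([:: loT 2 0 0; loS 3 1 (-1); upT 3 1 (-1); loT 4 1 (-1)],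
   [:: 0; 1; 0; 1; 0; 1; 0; 3; 1; 1]%N);
  ([:: loS 3 1 (-1); upT 3 1 (-1); loS 4 1 (-1); upT 4 1 (-1)],
   [:: 0; 1; 0; 3; 1; 1; 0; 3; 1; 1]%N);
  ([:: loT 0 5 (-3); loT 2 0 0; loT 1 7 (-4); loT 3 9 (-6); loT 4 1 (-1)],
   [:: 0; 1; 0; 1; 0; 1; 1; 0; 2; 0; 1; 1]%N);
  ([:: loT 0 (-3) 2; loT 2 0 0; loT 1 (-1) 1; loT 3 (-4) 2; loT 4 1 (-1)],
   [:: 0; 1; 0; 1; 0; 1; 1; 0; 1; 1; 0; 1; 1]%N);
  ([:: upS 1 1 0; upS 2 2 (-1); loS 4 (-1) 0; upT 4 (-1) 0],
   [:: 0; 1; 1; 0; 1; 1; 0; 1; 3; 1; 1; 1; 0; 3; 2]%N);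
  ([:: loS 0 5 (-3); loT 1 7 (-4); loT 4 1 (-1); upT 0 5 (-3)],
   [:: 0; 1; 0; 1; 0; 1; 1; 0; 2; 0; 1; 1; 0; 1; 0; 1; 0; 1; 1; 0; 2; 0;
     1; 1; 0; 1; 0; 1; 0; 1; 1; 0; 2; 0; 1; 1; 0; 1; 0; 3; 1; 1; 1; 0; 4;
     1; 1; 1; 0; 3; 1; 1; 0; 1; 1; 0; 2; 0; 1; 1]%N);
  ([:: loS 0 5 (-3); upT 1 7 (-4); loS 1 7 (-4); upT 0 5 (-3)],
   [:: 0; 1; 0; 1; 0; 1; 1; 0; 2; 0; 1; 1; 0; 1; 0; 3; 1; 1; 1; 0; 4; 1;
     1; 1; 0; 3; 1; 1; 0; 1; 1; 0; 2; 0; 1; 1; 0; 1; 0; 3; 1; 1; 1; 0; 4;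
     1; 1; 1; 0; 3; 1; 1; 0; 1; 1; 0; 2; 0; 1; 1]%N);
  ([:: loT 0 (-3) 2; loT 2 0 0; upT 1 (-1) 1; loS 1 (-1) 1],
   [:: 0; 1; 0; 1; 0; 1; 1; 0; 1; 1; 0; 1; 1; 0; 1; 0; 1; 0; 1; 1; 0; 1;
     1; 0; 1; 1; 0; 1; 0; 1; 0; 1; 1; 0; 1; 3; 1; 1; 1; 0; 3; 1; 1; 0; 1;
     1; 0; 1; 1; 0; 1; 1; 0; 1; 0; 3; 1; 1; 1; 0; 3; 2; 0; 1; 1]%N);
  ([:: loS 0 (-3) 2; upT 1 (-1) 1; loS 1 (-1) 1; upT 0 (-3) 2],
   [:: 0; 1; 0; 1; 0; 1; 1; 0; 1; 3; 1; 1; 1; 0; 3; 1; 1; 0; 1; 1; 0; 1;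
     1; 0; 1; 1; 0; 1; 0; 3; 1; 1; 1; 0; 3; 4; 1; 1; 1; 0; 3; 1; 1; 0; 1;
     1; 0; 1; 1; 0; 1; 1; 0; 1; 0; 3; 1; 1; 1; 0; 3; 2; 0; 1; 1]%N)].

(** The means of the vertices of the tiles, with the number of vertices as denominator. They
    witness, for all (s, t) in Pi at once, that the tiles have nonempty interior. *)
Definition return_centers : seq cpoint := [::
  (3%positive, (afc 21 (-11) (-4) 2 0 0, afc (-4) 3 3 (-2) 0 0));
  (5%positive, (afc 18 (-8) (-2) 0 0 (-1), afc 16 (-9) 4 (-2) (-1) 1));
  (4%positive, (afc 40 (-22) (-5) 3 (-1) 1, afc (-8) 6 5 (-1) 1 1));
  (4%positive, (afc (-6) 6 3 (-4) 1 (-2), afc 20 (-12) (-2) 0 (-2) 0));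
  (3%positive, (afc 6 (-2) (-2) 0 0 (-2), afc 20 (-12) 1 (-1) (-1) 0));
  (4%positive, (afc 10 (-4) (-2) (-1) 0 (-3), afc 30 (-18) 3 (-2) (-1) 0));
  (4%positive, (afc 10 (-4) (-2) (-1) 0 (-3), afc 20 (-12) (-2) 0 (-2) 0));
  (4%positive, (afc 16 (-8) 0 (-4) 0 (-4), afc 20 (-12) (-2) 0 (-2) 0))].

Definition periodic_centers : seq cpoint := [::
  (5%positive, (afc 2 1 0 0 0 0, afc 2 1 0 0 0 0));
  (5%positive, (afc (-4) 3 0 0 0 0, afc 6 (-2) 0 0 0 0));
  (10%positive, (afc 6 (-2) 0 0 0 0, afc (-4) 8 0 0 0 0));
  (5%positive, (afc 14 (-8) 0 0 0 0, afc (-6) 7 0 0 0 0));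
  (4%positive, (afc (-2) 2 0 1 0 1, afc 6 (-2) 0 1 0 1));
  (4%positive, (afc (-12) 8 4 (-2) 4 (-2), afc 16 (-8) (-4) 4 (-4) 4));
  (5%positive, (afc 3 (-1) 0 0 0 0, afc 13 (-6) 0 0 0 0));
  (5%positive, (afc (-8) 6 0 0 0 0, afc 2 1 0 0 0 0));
  (4%positive, (afc 4 (-2) 1 (-1) 1 (-1), afc (-2) 4 0 1 0 1));
  (4%positive, (afc 20 (-12) (-2) 0 (-2) 0, afc (-4) 4 1 (-1) 1 (-1)));
  (4%positive, (afc 20 (-12) (-2) 0 (-2) 0, afc 28 (-16) (-2) 0 (-2) 0));
  (4%positive, (afc (-2) 2 1 (-1) 1 (-1), afc (-4) 4 (-2) 0 (-2) 0));
  (4%positive, (afc (-12) 8 (-2) 0 (-2) 0, afc (-4) 4 (-2) 0 (-2) 0))].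

(** Pairs of return tiles, each with two distinct points common to the closures: the witnesses of
    [edge_adjacent] by which the tiles get merged. *)
Definition adjacencies : seq (nat * nat * (cpoint * cpoint)) := [::
  ((1, 2)%N,
   ((1%positive, (afc 19 (-11) (-1) 1 (-1) 1, afc (-11) 7 1 (-1) 1 0)),
    (1%positive, (afc 1 0 (-1) 0 0 0, afc 7 (-4) 1 0 0 1))));
  ((1, 3)%N,
   ((1%positive, (afc (-7) 5 1 0 1 (-1), afc 5 (-3) 0 0 (-1) 0)),
    (1%positive, (afc 4 (-2) 0 (-1) 0 (-1), afc 5 (-3) 0 0 (-1) 0))));
  ((4, 5)%N,
   ((1%positive, (afc 4 (-2) 0 0 0 (-2), afc 5 (-3) 0 0 (-1) 0)),
    (1%positive, (afc 1 0 (-1) 0 0 0, afc 10 (-6) 1 (-1) 1 0))));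
  ((4, 6)%N,
   ((1%positive, (afc 1 0 (-1) 0 0 0, afc 5 (-3) 0 0 (-1) 0)),
    (1%positive, (afc 4 (-2) 0 0 0 (-2), afc 5 (-3) 0 0 (-1) 0))));
  ((5, 7)%N,
   ((1%positive, (afc 4 (-2) 0 (-1) 0 (-1), afc 5 (-3) 0 0 (-1) 0)),
    (1%positive, (afc 4 (-2) 0 0 0 (-2), afc 5 (-3) 0 0 (-1) 0))));
  ((6, 7)%N,
   ((1%positive, (afc 4 (-2) 0 (-1) 0 (-1), afc 5 (-3) (-1) 0 0 0)),
    (1%positive, (afc 4 (-2) 0 0 0 (-2), afc 5 (-3) 0 0 (-1) 0))))].

Definition cover_tree : bsp :=
BS 2 (-2) 1 (BS 2 9 (-6) (BS 4 (-3) 2 (BT 1 2 (-1) (BT 2 4 (-3) (BS 0 1 0 (BS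
4 5 (-3) (BS 1 2 (-1) (BS 3 (-1) 0 (BS 2 4 (-3) (L 503) (BS 4 (-8) 5 (L 126)
(BT 4 (-8) 5 (L 490) (L 334)))) (BT 3 (-1) 0 (L 556) (L 500))) (BS 4 (-8) 5
(BS 2 4 (-3) (L 142) (L 664)) (BT 4 (-8) 5 (L 428) (L 350)))) (BS 2 (-9) 5 (BS
3 (-1) 0 (BT 1 10 (-6) (BS 1 10 (-6) (L 2) (L 82)) (BT 4 5 (-3) (L 134) (L
30))) (BT 3 (-1) 0 (L 556) (L 500))) (BS 3 (-1) 0 (BT 2 (-9) 5 (BT 4 5 (-3) (L
420) (L 264)) (BT 4 5 (-3) (L 342) (L 186))) (BT 3 (-1) 0 (L 556) (L 500)))))
(BT 4 5 (-3) (BS 2 (-9) 5 (BS 4 5 (-3) (L 118) (L 656)) (BS 1 2 (-1) (BT 2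
(-9) 5 (L 482) (L 326)) (L 528))) (BS 1 10 (-6) (BS 3 (-1) 0 (L 158) (BT 3
(-1) 0 (L 444) (L 366))) (BT 1 10 (-6) (L 680) (L 620))))) (BT 0 (-4) 3 (BS 3
1 (-1) (BT 4 0 0 (BS 4 0 0 (L 496) (BS 1 2 (-1) (L 565) (L 453))) (BT 0 (-1) 1
(BS 0 (-1) 1 (L 25) (L 559)) (BS 1 2 (-1) (L 500) (BS 0 (-4) 3 (L 375) (L
805))))) (BS 0 (-1) 1 (BT 1 0 0 (L 157) (BT 3 1 (-1) (L 105) (L 53))) (BT 0
(-1) 1 (BT 3 1 (-1) (L 469) (L 391)) (BT 3 1 (-1) (L 313) (L 235))))) (BS 1 2
(-1) (BS 3 (-1) 0 (BT 0 9 (-5) (BS 0 9 (-5) (L 22) (L 178)) (BS 4 (-8) 5 (L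
74) (BT 4 (-8) 5 (L 412) (L 256)))) (BT 3 (-1) 0 (L 556) (L 500))) (BS 3 (-1)
0 (BS 0 9 (-5) (L 102) (BT 0 9 (-5) (L 640) (L 604))) (BS 2 (-4) 2 (BT 3 (-1)
0 (L 466) (L 310)) (BT 2 (-4) 2 (L 779) (L 740))))))) (BT 4 0 0 (BS 0 1 0 (BS
0 9 (-5) (BS 3 (-1) 0 (BS 4 0 0 (L 496) (BS 2 (-4) 2 (L 154) (BT 2 (-4) 2 (L
440) (L 362)))) (BS 4 0 0 (L 496) (BT 0 (-4) 3 (BS 0 (-4) 3 (L 297) (L 766))
(BT 3 (-1) 0 (L 792) (L 727))))) (BS 3 7 (-5) (BS 4 0 0 (L 496) (BS 1 (-6) 4
(L 114) (BT 1 (-6) 4 (L 478) (L 322)))) (BS 4 0 0 (L 496) (BT 0 9 (-5) (L 676)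
(BT 3 7 (-5) (L 652) (L 616)))))) (BS 2 (-4) 2 (BS 1 7 (-4) (BT 3 (-6) 3 (BS 3
(-6) 3 (L 148) (L 434)) (BS 4 0 0 (L 356) (L 524))) (BT 4 8 (-5) (BS 4 8 (-5)
(L 108) (L 646)) (BT 1 7 (-4) (L 670) (L 610)))) (BT 4 (-5) 3 (BT 3 2 (-2) (BS
3 2 (-2) (L 564) (L 459)) (BS 4 (-5) 3 (L 381) (L 811))) (BS 1 (-1) 1 (BT 2
(-4) 2 (L 472) (L 316)) (BT 1 (-1) 1 (L 785) (L 746)))))) (BT 0 9 (-5) (BT 2
(-4) 2 (BS 2 (-4) 2 (BS 3 (-1) 0 (BS 0 9 (-5) (L 50) (L 580)) (BT 3 (-1) 0 (L
388) (L 232))) (BS 3 (-1) 0 (L 284) (BT 3 (-1) 0 (L 818) (L 714)))) (BT 0 (-4)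
3 (BS 0 (-4) 3 (L 219) (L 701)) (BS 3 (-1) 0 (L 206) (BT 3 (-1) 0 (L 753) (L
553))))) (BS 2 4 (-3) (BS 0 1 0 (BT 3 7 (-5) (BS 3 7 (-5) (L 10) (L 90)) (BS 4
(-8) 5 (L 38) (BT 4 (-8) 5 (L 272) (L 194)))) (L 518)) (BS 3 7 (-5) (BS 0 1 0
(BS 1 (-6) 4 (BT 2 4 (-3) (L 166) (L 62)) (BT 1 (-6) 4 (L 400) (L 244))) (L
518)) (BT 2 4 (-3) (BT 3 7 (-5) (L 688) (L 628)) (BT 3 7 (-5) (L 592) (L
540)))))))) (BT 0 9 (-5) (BT 0 (-4) 3 (BT 3 1 (-1) (BS 4 2 (-1) (BT 1 0 0 (BS
3 1 (-1) (L 568) (L 456)) (BS 3 1 (-1) (L 500) (BT 2 (-4) 2 (BS 2 (-4) 2 (L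
378) (L 808)) (BT 4 (-3) 2 (L 782) (L 743))))) (BS 0 (-4) 3 (BT 1 0 0 (BT 4 2
(-1) (L 463) (L 385)) (BT 4 2 (-1) (L 307) (L 229))) (BT 1 0 0 (L 815) (BT 4 2
(-1) (L 776) (L 711))))) (BT 0 (-1) 1 (BS 0 (-1) 1 (BT 1 0 0 (BT 4 (-3) 2 (L
443) (L 365)) (BT 4 (-3) 2 (L 287) (L 209))) (BT 1 0 0 (L 795) (BT 4 (-3) 2 (L
756) (L 691)))) (BT 1 0 0 (BS 2 (-4) 2 (L 300) (BT 2 (-4) 2 (L 769) (L 730)))
(BT 2 (-4) 2 (BS 2 (-4) 2 (L 222) (L 704)) (BT 4 (-3) 2 (L 717) (L 543))))))
(BS 2 (-1) 0 (BS 0 9 (-5) (BS 3 (-4) 2 (BT 4 2 (-1) (BS 4 2 (-1) (L 8) (L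
164)) (BT 1 0 0 (L 112) (L 60))) (BT 1 0 0 (BT 3 (-4) 2 (L 476) (L 320)) (BT 3
(-4) 2 (L 398) (L 242)))) (BT 4 2 (-1) (BS 4 2 (-1) (L 88) (L 686)) (BT 1 0 0
(L 650) (L 590)))) (BT 2 (-1) 0 (BS 3 (-4) 2 (BS 4 2 (-1) (L 562) (BT 4 2 (-1)
(L 450) (L 294))) (BT 1 0 0 (L 789) (BT 3 (-4) 2 (L 763) (L 724)))) (BT 4 2
(-1) (BS 4 2 (-1) (L 500) (BS 3 (-4) 2 (L 372) (BT 3 (-4) 2 (L 802) (L 737))))
(BT 3 (-4) 2 (BS 3 (-4) 2 (L 216) (L 698)) (BT 1 0 0 (L 750) (L 550))))))) (BT
4 2 (-1) (BS 1 5 (-3) (BS 4 2 (-1) (BS 2 (-1) 0 (BT 3 4 (-3) (BS 3 4 (-3) (BS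
0 1 0 (L 509) (L 569)) (BS 1 (-8) 5 (L 140) (BT 1 (-8) 5 (L 426) (L 348))))
(BS 1 (-8) 5 (L 36) (BT 1 (-8) 5 (L 270) (L 192)))) (BT 2 (-1) 0 (L 562) (L
500))) (BS 3 4 (-3) (BS 0 1 0 (BS 1 (-8) 5 (L 124) (BT 1 (-8) 5 (L 488) (L
332))) (L 569)) (BT 3 4 (-3) (L 662) (L 626)))) (BS 2 (-1) 0 (BS 4 (-11) 7 (BS
0 1 0 (BT 3 12 (-8) (BS 3 12 (-8) (L 0) (L 80)) (BT 1 5 (-3) (L 132) (L 28)))
(L 569)) (BS 0 1 0 (BT 1 5 (-3) (BT 4 (-11) 7 (L 418) (L 340)) (BT 4 (-11) 7
(L 262) (L 184))) (L 569))) (BS 0 1 0 (BT 2 (-1) 0 (L 562) (L 500)) (BS 1 (-3)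
2 (BT 2 (-1) 0 (L 457) (L 301)) (BT 1 (-3) 2 (L 770) (BT 4 (-3) 2 (L 796) (L
731))))))) (BT 3 4 (-3) (BS 3 4 (-3) (BS 0 1 0 (BS 1 (-8) 5 (BS 2 7 (-5) (L
20) (BT 2 7 (-5) (L 176) (L 72))) (BT 1 (-8) 5 (L 410) (L 254))) (L 569)) (BS
2 7 (-5) (BS 0 1 0 (L 100) (L 464)) (BT 2 7 (-5) (L 638) (L 602)))) (BS 4 (-6)
4 (BT 1 0 0 (BS 2 7 (-5) (L 152) (BT 2 7 (-5) (L 674) (L 614))) (BS 2 7 (-5)
(BS 0 1 0 (L 48) (L 386)) (BT 2 7 (-5) (L 578) (L 538)))) (BS 0 1 0 (BT 1 0 0
(BT 4 (-6) 4 (L 438) (L 360)) (BT 4 (-6) 4 (L 282) (L 204))) (BT 1 0 0 (L 790)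
(BT 4 (-6) 4 (L 816) (L 751))))))))) (BT 3 1 (-1) (BT 3 9 (-6) (BT 4 0 0 (BS 0
1 0 (BT 0 (-1) 1 (BS 4 0 0 (L 496) (BS 1 (-3) 2 (BS 3 9 (-6) (L 109) (L 647))
(BS 0 (-1) 1 (BT 1 (-3) 2 (L 473) (L 317)) (L 786)))) (BS 4 0 0 (L 496) (BT 2
1 (-1) (BS 2 1 (-1) (L 565) (L 460)) (BS 3 (-4) 2 (L 382) (BT 3 (-4) 2 (L 812)
(L 747)))))) (BS 3 (-3) 1 (BS 4 6 (-4) (BS 2 (-7) 4 (L 113) (BT 2 (-7) 4 (L
477) (L 321))) (BT 1 9 (-5) (BS 1 9 (-5) (L 153) (L 675)) (BT 4 6 (-4) (L 651)
(L 615)))) (BT 1 (-4) 3 (BT 2 1 (-1) (BS 2 1 (-1) (L 564) (L 452)) (BS 1 (-4)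
3 (L 296) (L 765))) (BS 4 (-2) 1 (BT 3 (-3) 1 (L 439) (L 361)) (BT 4 (-2) 1 (L
791) (L 726)))))) (BT 2 1 (-1) (BT 0 (-1) 1 (BS 2 1 (-1) (BS 0 (-1) 1 (BS 3 9
(-6) (L 5) (L 85)) (L 559)) (BS 0 (-1) 1 (BS 3 9 (-6) (L 161) (L 683)) (L
447))) (BS 2 1 (-1) (L 500) (BT 1 (-3) 2 (BS 1 (-3) 2 (L 369) (L 799)) (BS 3
(-4) 2 (L 304) (BT 3 (-4) 2 (L 773) (L 734)))))) (BT 0 (-1) 1 (BS 0 (-1) 1 (BS
1 (-3) 2 (BS 3 9 (-6) (L 57) (L 587)) (BT 1 (-3) 2 (L 395) (L 239))) (BS 1
(-3) 2 (L 291) (BT 1 (-3) 2 (L 760) (L 721)))) (BT 1 (-3) 2 (BS 1 (-3) 2 (L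
213) (L 695)) (BS 3 (-4) 2 (L 226) (BT 3 (-4) 2 (L 708) (L 547))))))) (BT 2 1
(-1) (BT 1 (-8) 5 (BS 3 1 (-1) (BS 0 (-1) 1 (BT 4 5 (-3) (BS 4 5 (-3) (L 506)
(BS 1 (-8) 5 (L 129) (L 493))) (BS 1 (-8) 5 (BT 2 9 (-6) (L 181) (L 77)) (L
415))) (BT 0 (-1) 1 (L 559) (L 500))) (BS 4 5 (-3) (BS 1 (-8) 5 (L 145) (L
431)) (BT 2 9 (-6) (L 643) (BT 4 5 (-3) (L 667) (L 607))))) (BS 1 5 (-3) (BS 2
1 (-1) (BS 0 (-1) 1 (BS 4 5 (-3) (BS 3 1 (-1) (L 506) (L 353)) (BT 4 5 (-3) (L
337) (L 259))) (BT 0 (-1) 1 (L 559) (L 500))) (BT 4 (-8) 5 (BS 4 (-8) 5 (L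
121) (L 485)) (BS 3 1 (-1) (L 329) (L 521)))) (BS 0 (-1) 1 (BT 1 5 (-3) (BS 4
(-8) 5 (BS 2 1 (-1) (L 137) (L 659)) (BT 4 (-8) 5 (L 423) (L 345))) (BS 4 (-8)
5 (BS 2 1 (-1) (L 33) (L 623)) (BT 4 (-8) 5 (L 267) (L 189)))) (BT 0 (-1) 1 (L
559) (L 500))))) (BT 4 0 0 (BS 0 (-6) 4 (BS 4 8 (-5) (BS 3 1 (-1) (L 496) (BS
1 (-3) 2 (L 155) (BT 1 (-3) 2 (L 441) (L 363)))) (BS 3 1 (-1) (L 496) (BT 2 6
(-4) (BS 2 6 (-4) (L 115) (L 653)) (BT 4 8 (-5) (L 677) (L 617))))) (BT 2 (-7)
4 (BS 4 0 0 (L 496) (BS 0 7 (-4) (BS 2 (-7) 4 (L 149) (L 435)) (BT 0 7 (-4) (L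
671) (L 611)))) (BS 3 1 (-1) (BS 4 0 0 (L 496) (L 357)) (BT 0 (-6) 4 (L 479)
(BS 4 0 0 (L 323) (L 525)))))) (BS 0 7 (-4) (BS 3 1 (-1) (BT 1 5 (-3) (BS 1 5
(-3) (L 17) (L 97)) (BS 2 (-7) 4 (L 45) (BT 2 (-7) 4 (L 279) (L 201)))) (L
515)) (BS 1 5 (-3) (BS 3 1 (-1) (BS 4 (-8) 5 (BT 0 7 (-4) (L 173) (L 69)) (BT
4 (-8) 5 (L 407) (L 251))) (L 515)) (BT 0 7 (-4) (BT 1 5 (-3) (L 635) (L 575))
(BT 1 5 (-3) (L 599) (L 535)))))))) (BS 0 2 (-1) (BT 3 6 (-4) (BS 4 0 0 (BT 1
5 (-3) (BS 1 5 (-3) (BS 3 6 (-4) (L 504) (BS 1 (-8) 5 (L 135) (BT 1 (-8) 5 (L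
421) (L 343)))) (BS 3 (-7) 4 (L 127) (BT 3 (-7) 4 (L 491) (L 335)))) (BS 3
(-7) 4 (BS 4 8 (-5) (L 23) (BT 4 8 (-5) (L 179) (L 75))) (BT 3 (-7) 4 (L 413)
(L 257)))) (BS 1 (-8) 5 (BT 2 6 (-4) (BS 2 6 (-4) (BS 3 6 (-4) (L 15) (L 95))
(BS 3 6 (-4) (L 171) (L 633))) (BS 3 6 (-4) (BT 4 0 0 (L 119) (L 67)) (BT 4 0
0 (L 657) (L 597)))) (BT 1 (-8) 5 (BT 4 0 0 (L 483) (L 405)) (BT 4 0 0 (L 327)
(L 249))))) (BT 0 10 (-6) (BS 0 10 (-6) (BS 3 (-2) 1 (BT 4 0 0 (BS 4 0 0 (L 3)
(L 159)) (BT 1 0 0 (L 107) (L 55))) (BT 1 0 0 (BT 3 (-2) 1 (L 471) (L 315))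
(BT 3 (-2) 1 (L 393) (L 237)))) (BT 4 0 0 (BS 4 0 0 (L 83) (L 681)) (BT 1 0 0
(L 645) (L 585)))) (BS 2 6 (-4) (BT 1 0 0 (BS 4 (-8) 5 (L 147) (BT 4 (-8) 5 (L
433) (L 355))) (BS 4 (-8) 5 (L 43) (BT 4 (-8) 5 (L 277) (L 199)))) (BT 4 0 0
(BS 1 (-8) 5 (BS 4 0 0 (L 31) (L 621)) (BT 1 (-8) 5 (L 265) (L 187))) (BT 1 0
0 (BT 2 6 (-4) (L 669) (L 609)) (BT 2 6 (-4) (L 573) (L 533))))))) (BT 4 0 0
(BT 1 5 (-3) (BT 0 2 (-1) (BS 3 (-7) 4 (BS 1 5 (-3) (L 143) (L 665)) (BT 3
(-7) 4 (L 429) (BS 4 0 0 (L 351) (L 529)))) (BT 2 6 (-4) (BS 4 0 0 (BS 1 5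
(-3) (BS 2 6 (-4) (L 11) (L 91)) (BS 2 6 (-4) (L 167) (L 689))) (L 519)) (BS 4
0 0 (BS 3 (-7) 4 (BS 1 5 (-3) (L 39) (L 629)) (BT 3 (-7) 4 (L 273) (L 195)))
(L 519)))) (BT 4 8 (-5) (BT 0 2 (-1) (BS 4 8 (-5) (L 103) (L 641)) (BS 1 (-3)
2 (BS 4 8 (-5) (L 51) (L 581)) (BT 1 (-3) 2 (L 285) (L 207)))) (BS 2 6 (-4)
(BS 4 0 0 (BS 0 (-6) 4 (L 63) (BT 0 (-6) 4 (L 401) (L 245))) (L 519)) (BT 0 2
(-1) (L 605) (BT 2 6 (-4) (L 593) (L 541)))))) (BS 0 7 (-4) (BT 1 0 0 (BS 2 1
(-1) (BS 3 (-7) 4 (L 117) (BT 3 (-7) 4 (L 481) (L 325))) (BT 0 2 (-1) (L 523)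
(BT 2 1 (-1) (L 527) (L 517)))) (BS 2 1 (-1) (BS 3 (-7) 4 (BS 4 5 (-3) (L 13)
(BT 4 5 (-3) (L 169) (L 65))) (BT 3 (-7) 4 (L 403) (L 247))) (BT 0 2 (-1) (L
513) (BT 2 1 (-1) (L 511) (L 498))))) (BT 4 5 (-3) (BS 2 1 (-1) (BT 0 7 (-4)
(BS 4 5 (-3) (L 93) (L 631)) (BS 1 (-8) 5 (BS 4 5 (-3) (L 41) (L 571)) (BT 1
(-8) 5 (L 275) (L 197)))) (BT 2 1 (-1) (L 511) (L 498))) (BT 1 0 0 (BT 0 7
(-4) (L 655) (BT 2 9 (-6) (L 679) (L 619))) (BT 0 7 (-4) (L 595) (BT 2 9 (-6)
(L 583) (L 531)))))))))) (BS 3 1 (-1) (BT 3 4 (-3) (BS 3 (-1) 0 (BT 4 4 (-3)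
(BS 0 2 (-1) (BT 2 5 (-3) (BS 2 5 (-3) (BS 4 4 (-3) (L 508) (BS 2 (-8) 5 (L
139) (BT 2 (-8) 5 (L 425) (L 347)))) (BS 4 (-9) 5 (L 131) (BT 4 (-9) 5 (L 495)
(L 339)))) (BT 0 10 (-6) (BS 0 10 (-6) (L 27) (L 183)) (BS 4 (-9) 5 (L 79) (BT
4 (-9) 5 (L 417) (L 261))))) (BT 0 2 (-1) (BS 2 (-8) 5 (BS 4 4 (-3) (L 123) (L
661)) (BT 2 (-8) 5 (L 487) (L 331))) (BT 3 7 (-5) (BS 3 7 (-5) (BS 4 4 (-3) (L
19) (L 99)) (BS 4 4 (-3) (L 175) (L 637))) (BS 2 (-8) 5 (BS 4 4 (-3) (L 71) (L
601)) (BT 2 (-8) 5 (L 409) (L 253)))))) (BT 1 9 (-5) (BT 2 0 0 (BS 2 0 0 (L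
496) (BS 4 (-4) 2 (BS 1 9 (-5) (L 111) (L 649)) (BT 4 (-4) 2 (L 475) (L
319)))) (BT 0 2 (-1) (BS 0 2 (-1) (BS 1 9 (-5) (L 7) (L 87)) (BS 1 9 (-5) (L
163) (L 685))) (BS 4 (-4) 2 (BS 1 9 (-5) (L 59) (L 589)) (BT 4 (-4) 2 (L 397)
(L 241))))) (BT 2 0 0 (BS 2 0 0 (L 496) (BS 0 (-6) 4 (BS 3 7 (-5) (L 151) (BT
3 7 (-5) (L 673) (L 613))) (BT 0 (-6) 4 (L 437) (L 359)))) (BT 0 2 (-1) (BS 2
(-8) 5 (BS 0 2 (-1) (L 35) (L 625)) (BT 2 (-8) 5 (L 269) (L 191))) (BS 0 (-6)
4 (BS 3 7 (-5) (L 47) (BT 3 7 (-5) (L 577) (L 537))) (BT 0 (-6) 4 (L 281) (L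
203))))))) (BS 4 (-1) 0 (BS 2 2 (-1) (BT 0 5 (-3) (BS 0 5 (-3) (BS 3 4 (-3) (L
502) (BS 0 (-8) 5 (L 125) (BT 0 (-8) 5 (L 489) (L 333)))) (BS 3 (-9) 5 (L 133)
(BT 3 (-9) 5 (L 419) (L 341)))) (BT 2 10 (-6) (BS 2 10 (-6) (L 1) (L 81)) (BS
3 (-9) 5 (L 29) (BT 3 (-9) 5 (L 263) (L 185))))) (BS 0 (-8) 5 (BS 3 4 (-3) (BT
4 7 (-5) (BS 4 7 (-5) (L 9) (L 89)) (BT 2 2 (-1) (L 141) (L 37))) (BT 4 7 (-5)
(BS 4 7 (-5) (L 165) (L 687)) (BT 2 2 (-1) (L 663) (L 627)))) (BT 0 (-8) 5 (BT
2 2 (-1) (L 427) (L 271)) (BT 2 2 (-1) (L 349) (L 193))))) (BT 0 2 (-1) (BS 0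
2 (-1) (BT 2 0 0 (BS 2 0 0 (L 496) (L 567)) (BT 3 (-1) 0 (L 561) (BT 4 (-1) 0
(L 555) (L 499)))) (BT 1 (-4) 3 (BT 2 0 0 (BS 2 0 0 (L 496) (L 462)) (BS 1
(-4) 3 (L 306) (L 775))) (BS 4 (-4) 2 (BT 3 (-1) 0 (L 449) (L 371)) (BT 4 (-4)
2 (L 801) (L 736))))) (BT 2 0 0 (BS 2 0 0 (L 496) (BT 1 (-4) 3 (BS 1 (-4) 3 (L
384) (L 814)) (BT 3 (-1) 0 (L 788) (L 749)))) (BT 4 (-4) 2 (BT 3 (-1) 0 (BS 4
(-4) 2 (L 293) (L 762)) (BS 4 (-4) 2 (L 215) (L 697))) (BT 1 (-4) 3 (BS 1 (-4)
3 (L 228) (L 710)) (BT 3 (-1) 0 (L 723) (L 549)))))))) (BS 4 1 (-1) (BS 2 2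
(-1) (BS 2 5 (-3) (BT 0 5 (-3) (BS 1 (-1) 1 (BS 0 5 (-3) (L 505) (BS 2 (-8) 5
(L 128) (BT 2 (-8) 5 (L 492) (L 336)))) (BT 1 (-1) 1 (L 558) (L 499))) (BS 1
(-1) 1 (BS 2 (-8) 5 (BS 3 9 (-6) (L 24) (BT 3 9 (-6) (L 180) (L 76))) (BT 2
(-8) 5 (L 414) (L 258))) (BT 2 0 0 (BS 2 0 0 (L 496) (L 567)) (BT 1 (-1) 1 (L
558) (L 499))))) (BS 1 (-1) 1 (BS 0 (-8) 5 (BT 4 9 (-6) (BS 4 9 (-6) (L 4) (L
84)) (BT 2 5 (-3) (L 136) (L 32))) (BT 0 (-8) 5 (BT 2 5 (-3) (L 422) (L 266))
(BT 2 5 (-3) (L 344) (L 188)))) (BS 4 (-1) 0 (BS 0 (-8) 5 (BS 1 9 (-5) (L 21)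
(BT 1 9 (-5) (L 177) (L 73))) (BT 0 (-8) 5 (L 411) (L 255))) (BT 1 (-1) 1 (L
558) (BT 4 (-1) 0 (L 555) (L 499)))))) (BS 3 (-4) 2 (BS 1 9 (-5) (BT 2 2 (-1)
(BS 4 (-1) 0 (L 101) (BT 4 (-1) 0 (L 465) (L 309))) (BS 4 (-1) 0 (L 49) (BT 4
(-1) 0 (L 387) (L 231)))) (BT 4 7 (-5) (BS 2 (-6) 4 (BS 4 7 (-5) (L 61) (L
591)) (BT 2 (-6) 4 (L 399) (L 243))) (BT 1 9 (-5) (BT 2 2 (-1) (L 639) (L
579)) (BT 2 2 (-1) (L 603) (L 539))))) (BT 1 (-4) 3 (BS 1 (-4) 3 (BT 2 2 (-1)
(L 374) (L 218)) (BT 2 2 (-1) (L 804) (L 700))) (BT 3 (-4) 2 (BT 4 (-1) 0 (BS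
4 (-1) 0 (L 283) (L 817)) (BT 2 2 (-1) (L 778) (L 713))) (BT 4 (-1) 0 (BS 4
(-1) 0 (L 205) (L 752)) (BT 2 2 (-1) (L 739) (L 552))))))) (BS 3 9 (-6) (BT 0
(-3) 2 (BS 0 (-3) 2 (BS 1 (-1) 1 (BT 2 0 0 (BS 2 0 0 (L 496) (L 156)) (BT 4 1
(-1) (L 104) (L 52))) (BT 1 (-1) 1 (BT 4 1 (-1) (L 468) (L 390)) (BT 4 1 (-1)
(L 312) (L 234)))) (BT 2 0 0 (BS 2 0 0 (L 496) (L 442)) (BT 1 (-1) 1 (BS 1
(-1) 1 (L 286) (L 755)) (BT 4 1 (-1) (L 781) (L 716))))) (BT 2 0 0 (BT 3 (-4)
2 (BS 2 0 0 (L 496) (BS 3 (-4) 2 (BT 4 1 (-1) (L 455) (L 299)) (L 768))) (BS 2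
0 0 (L 496) (BS 1 (-1) 1 (L 364) (BT 1 (-1) 1 (L 794) (L 729))))) (BT 3 (-4) 2
(BS 3 (-4) 2 (BT 4 1 (-1) (L 377) (L 221)) (BT 4 1 (-1) (L 807) (L 703))) (BT
1 (-1) 1 (BS 1 (-1) 1 (L 208) (L 690)) (BT 4 1 (-1) (L 742) (L 542)))))) (BT 0
5 (-3) (BS 0 5 (-3) (BS 2 (-8) 5 (BT 1 7 (-4) (BS 1 7 (-4) (L 12) (L 92)) (BT
4 1 (-1) (L 144) (L 40))) (BT 2 (-8) 5 (BT 4 1 (-1) (L 430) (L 274)) (BT 4 1
(-1) (L 352) (L 196)))) (BT 1 7 (-4) (BS 1 7 (-4) (L 168) (L 630)) (BT 4 1
(-1) (L 666) (L 570)))) (BT 2 0 0 (BS 1 7 (-4) (BS 2 0 0 (L 496) (BS 4 (-7) 4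
(L 116) (BT 4 (-7) 4 (L 480) (L 324)))) (BS 2 0 0 (L 496) (BT 1 7 (-4) (L 654)
(BT 3 9 (-6) (L 678) (L 618))))) (BT 1 7 (-4) (BS 4 (-7) 4 (BS 1 7 (-4) (L 64)
(L 594)) (BT 4 (-7) 4 (L 402) (L 246))) (BT 3 9 (-6) (BT 4 1 (-1) (L 642) (L
582)) (BT 4 1 (-1) (L 606) (L 530))))))))) (BS 1 2 (-1) (BS 2 8 (-5) (BS 3
(-2) 1 (BT 0 2 (-1) (BS 0 2 (-1) (BS 4 0 0 (BT 4 (-2) 1 (BS 4 (-2) 1 (L 6) (L
560)) (BT 2 (-2) 1 (L 557) (BT 3 1 (-1) (L 566) (L 501)))) (BT 2 (-2) 1 (BT 4
0 0 (L 445) (L 289)) (BT 4 0 0 (L 367) (L 211)))) (BT 1 (-3) 2 (BS 1 (-3) 2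
(BT 2 (-2) 1 (L 467) (L 311)) (L 780)) (BS 4 (-5) 3 (BT 3 1 (-1) (L 454) (L
376)) (BT 4 (-5) 3 (L 806) (L 741))))) (BT 1 (-3) 2 (BS 1 (-3) 2 (BT 2 (-2) 1
(L 389) (L 233)) (BT 2 (-2) 1 (L 819) (L 715))) (BT 3 1 (-1) (BT 4 (-5) 3 (BS
4 (-5) 3 (L 298) (L 767)) (BT 2 (-2) 1 (L 793) (L 728))) (BT 4 (-5) 3 (BS 4
(-5) 3 (L 220) (L 702)) (BT 2 (-2) 1 (L 754) (L 554)))))) (BS 4 0 0 (BT 3 3
(-2) (BT 1 0 0 (BS 3 3 (-2) (L 563) (L 451)) (BS 3 3 (-2) (L 501) (BT 2 (-5) 3
(BS 2 (-5) 3 (L 373) (L 803)) (BS 4 (-5) 3 (L 308) (BT 4 (-5) 3 (L 777) (L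
738)))))) (BT 2 (-5) 3 (BT 1 0 0 (BS 2 (-5) 3 (L 295) (L 764)) (BS 2 (-5) 3 (L
217) (L 699))) (BT 4 (-5) 3 (BS 4 (-5) 3 (L 230) (L 712)) (BT 1 0 0 (L 725) (L
551))))) (BT 0 (-3) 2 (BS 0 (-3) 2 (BT 1 0 0 (BT 4 0 0 (L 458) (L 380)) (BT 4
0 0 (L 302) (L 224))) (BT 1 0 0 (L 810) (BT 4 0 0 (L 771) (L 706)))) (BT 2
(-2) 1 (BT 1 0 0 (L 784) (BT 3 (-2) 1 (L 758) (L 719))) (BT 3 (-2) 1 (BT 4 0 0
(L 797) (L 693)) (BT 1 0 0 (L 745) (BT 4 0 0 (L 732) (L 545)))))))) (BT 2 0 0
(BS 2 0 0 (BS 3 6 (-4) (BT 0 5 (-3) (BS 4 (-2) 1 (BS 0 5 (-3) (L 507) (BS 3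
(-7) 4 (L 138) (BT 3 (-7) 4 (L 424) (L 346)))) (BT 4 (-2) 1 (L 560) (L 501)))
(BS 4 (-2) 1 (BS 3 (-7) 4 (BT 2 8 (-5) (L 86) (L 34)) (BT 3 (-7) 4 (L 268) (L
190))) (BT 4 (-2) 1 (L 560) (L 501)))) (BS 0 (-8) 5 (BS 4 (-2) 1 (BT 1 10 (-6)
(BS 1 10 (-6) (L 26) (L 182)) (BT 3 6 (-4) (L 130) (L 78))) (BT 4 (-2) 1 (L
560) (L 501))) (BS 4 (-2) 1 (BT 0 (-8) 5 (BT 3 6 (-4) (L 494) (L 416)) (BT 3 6
(-4) (L 338) (L 260))) (BT 4 (-2) 1 (L 560) (L 501))))) (BS 1 10 (-6) (BS 3
(-2) 1 (BS 4 (-2) 1 (L 106) (BT 4 (-2) 1 (L 470) (L 314))) (BT 1 (-3) 2 (BS 1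
(-3) 2 (L 379) (L 809)) (BT 3 (-2) 1 (L 783) (L 744)))) (BS 3 6 (-4) (BS 0
(-8) 5 (L 146) (BT 0 (-8) 5 (L 432) (L 354))) (BT 1 10 (-6) (L 644) (BT 3 6
(-4) (L 668) (L 608)))))) (BT 1 10 (-6) (BT 3 (-2) 1 (BS 3 (-2) 1 (BS 4 (-2) 1
(BS 1 10 (-6) (L 54) (L 584)) (BT 4 (-2) 1 (L 392) (L 236))) (BS 4 (-2) 1 (L
288) (BT 4 (-2) 1 (L 757) (L 718)))) (BT 1 (-3) 2 (BS 1 (-3) 2 (L 223) (L
705)) (BS 4 (-2) 1 (L 210) (BT 4 (-2) 1 (L 692) (L 544))))) (BS 3 6 (-4) (BS 0
(-8) 5 (BS 4 6 (-4) (L 14) (BT 4 6 (-4) (L 94) (L 42))) (BT 0 (-8) 5 (L 276)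
(L 198))) (BS 4 6 (-4) (BS 2 (-8) 5 (BT 3 6 (-4) (L 170) (L 66)) (BT 2 (-8) 5
(L 404) (L 248))) (BT 3 6 (-4) (BT 4 6 (-4) (L 632) (L 572)) (BT 4 6 (-4) (L
596) (L 532)))))))) (BS 2 0 0 (BS 2 8 (-5) (BT 0 (-3) 2 (BS 0 (-3) 2 (BT 1 2
(-1) (BS 4 (-2) 1 (L 162) (BT 4 (-2) 1 (L 448) (L 370))) (BS 4 (-2) 1 (BT 3 1
(-1) (L 110) (L 58)) (BT 4 (-2) 1 (L 292) (L 214)))) (BS 4 (-2) 1 (BT 3 1 (-1)
(L 474) (L 396)) (BT 1 2 (-1) (L 800) (BT 4 (-2) 1 (L 761) (L 696))))) (BT 2
(-5) 3 (BT 1 2 (-1) (BS 2 (-5) 3 (BT 3 1 (-1) (L 461) (L 305)) (L 774)) (BS 2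
(-5) 3 (BT 3 1 (-1) (L 383) (L 227)) (BT 3 1 (-1) (L 813) (L 709)))) (BT 3 1
(-1) (BS 4 (-2) 1 (L 318) (BT 4 (-2) 1 (L 787) (L 748))) (BT 4 (-2) 1 (BS 4
(-2) 1 (L 240) (L 722)) (BT 1 2 (-1) (L 735) (L 548)))))) (BT 0 5 (-3) (BS 0 5
(-3) (BS 3 (-7) 4 (BT 4 6 (-4) (BS 4 6 (-4) (L 18) (L 174)) (BT 1 2 (-1) (L
122) (L 70))) (BT 1 2 (-1) (BT 3 (-7) 4 (L 486) (L 330)) (BT 3 (-7) 4 (L 408)
(L 252)))) (BT 4 6 (-4) (BS 4 6 (-4) (L 98) (L 636)) (BT 1 2 (-1) (L 660) (L
600)))) (BT 3 1 (-1) (BS 4 6 (-4) (BS 1 (-6) 4 (L 150) (BT 1 (-6) 4 (L 436) (L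
358))) (BT 2 8 (-5) (L 648) (BT 4 6 (-4) (L 672) (L 612)))) (BT 4 6 (-4) (BS 1
(-6) 4 (BS 4 6 (-4) (L 46) (L 576)) (BT 1 (-6) 4 (L 280) (L 202))) (BT 1 2
(-1) (BT 2 8 (-5) (L 684) (L 624)) (BT 2 8 (-5) (L 588) (L 536))))))) (BT 4 9
(-6) (BT 1 (-1) 1 (BS 1 (-1) 1 (BS 2 (-3) 2 (BT 3 1 (-1) (BS 4 9 (-6) (L 160)
(L 682)) (BS 4 9 (-6) (L 56) (L 586))) (BT 2 (-3) 2 (L 394) (L 238))) (BS 2
(-3) 2 (BT 3 1 (-1) (L 446) (L 290)) (BT 2 (-3) 2 (L 759) (L 720)))) (BT 3 1
(-1) (BT 2 (-3) 2 (BS 2 (-3) 2 (L 368) (L 798)) (BS 4 (-4) 2 (L 303) (BT 4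
(-4) 2 (L 772) (L 733)))) (BT 2 (-3) 2 (BS 2 (-3) 2 (L 212) (L 694)) (BS 4
(-4) 2 (L 225) (BT 4 (-4) 2 (L 707) (L 546)))))) (BT 1 7 (-4) (BS 4 1 (-1) (BT
2 5 (-3) (BS 1 7 (-4) (BS 2 5 (-3) (L 16) (L 96)) (BS 2 5 (-3) (L 172) (L
634))) (BS 3 (-7) 4 (BS 1 7 (-4) (L 44) (L 574)) (BT 3 (-7) 4 (L 278) (L
200)))) (BT 2 0 0 (BT 1 2 (-1) (L 522) (BT 3 1 (-1) (L 526) (L 516))) (BT 1 2
(-1) (L 512) (BT 3 1 (-1) (L 510) (BT 4 1 (-1) (L 514) (L 497)))))) (BT 3 1
(-1) (BS 0 (-8) 5 (BS 2 5 (-3) (L 120) (BT 2 5 (-3) (L 658) (L 622))) (BS 4 1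
(-1) (BT 0 (-8) 5 (L 484) (L 328)) (BT 4 1 (-1) (L 520) (L 510)))) (BS 4 1
(-1) (BS 0 (-8) 5 (BS 2 5 (-3) (L 68) (BT 2 5 (-3) (L 598) (L 534))) (BT 0
(-8) 5 (L 406) (L 250))) (BT 4 1 (-1) (L 514) (L 497))))))))).

Definition ratom a := nth [::] rhombus_atoms a.
Definition riso a := nth ((zg0, zg0), 0%N) rhombus_isos a.

Fixpoint trace (T : ctile) (w : seq nat) : seq ctile :=
  T :: if w is a :: w' then trace (imt (riso a) T) w' else [::].
(** The last entry of the trace is left out: it is back in C, or is the initial periodic tile, and
    would be counted twice. *)
Definition levels (T : ctile) (w : seq nat) := take (size w) (trace T w).
Definition last_level (T : ctile) (w : seq nat) := last T (trace T w).
Fixpoint follows (T : ctile) (w : seq nat) : bool :=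
  if w is a :: w' then
    [&& a < 5, included T (ratom a) & follows (imt (riso a) T) w']%N
  else true.
Definition word_iso (w : seq nat) : ciso :=
  foldl (fun f a => ccomp (riso a) f) ((zg0, zg0), 0%N) w.

Definition all_tiles : seq ctile :=
  flatten [seq levels o.1 o.2 | o <- return_orbits ++ periodic_orbits].

(** Earlier constraints with the same normal and the same side are dropped to keep the cells short.
    This can only enlarge a cell, so a successful check remains conclusive. *)
Definition add_cstr (h : cstr) (T : ctile) : ctile :=
  h :: [seq h' <- T | ~~ ((h'.1 == h.1) && (h'.2.1 == h.2.1))].
Fixpoint covers (tiles : seq ctile) (T : ctile) (b : bsp) : bool :=
  match b with
  | L i => (i < size tiles)%N && included T (nth [::] tiles i)
  | Node m o l r => covers tiles (add_cstr (m, (true, o)) T) l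
                    && covers tiles (add_cstr (m, (false, o)) T) r
  end.

(** Level 0 and the image after the last letter lie in C and the levels between avoid it, which
    makes the length of the word the first return time. *)
Definition return_ok (o : ctile * seq nat) : bool :=
  [&& wft o.1, follows o.1 o.2, included o.1 triangle_tile,
      included (last_level o.1 o.2) triangle_tile
    & all (fun T => separated T triangle_tile) (behead (levels o.1 o.2))].
Definition periodic_ok (o : ctile * seq nat) : bool :=
  [&& wft o.1, follows o.1 o.2, included o.1 (last_level o.1 o.2),
      included (last_level o.1 o.2) o.1, (0 < size o.2)%N
    & all (fun T => separated T triangle_tile) (levels o.1 o.2)].

Lemma return_orbits_ok : all return_ok return_orbits.
Proof. by vm_compute. Qed.
Lemma periodic_orbits_ok : all periodic_ok periodic_orbits.
Proof. by vm_compute. Qed.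
Lemma cover_ok : covers all_tiles rhombus_tile cover_tree.
Proof. by vm_compute. Qed.

Fixpoint pairwise_separated (s : seq ctile) : bool :=
  if s is T :: s' then all (separated T) s' && pairwise_separated s' else true.
Lemma atoms_separated : pairwise_separated rhombus_atoms.
Proof. by vm_compute. Qed.
Lemma images_separated : pairwise_separated
  [seq imt (riso a) (ratom a) | a <- iota 0 5].
Proof. by vm_compute. Qed.
Lemma atoms_included : all (fun T => included T rhombus_tile && wft T) rhombus_atoms.
Proof. by vm_compute. Qed.
Lemma images_included : all (fun a => included (imt (riso a) (ratom a)) rhombus_tile)
  (iota 0 5).
Proof. by vm_compute. Qed.

(* 130 letters suffice to tell the shifts of the periodic words apart. *)
Definition cyclic_letter (w : seq nat) (n : nat) := nth 0%N w (n %% size w).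
Definition words_differ (w w' : seq nat) (k : nat) : bool :=
  lazy_has (fun n => cyclic_letter w n != cyclic_letter w' (k + n)) (iota 0 130).
(** For i = j this makes the length of a word the least period of its tile; for distinct i and j it
    makes the orbits disjoint. *)
Definition shifts_differ (os : seq (ctile * seq nat)) : bool :=
  all (fun i => all (fun j => all (fun k =>
      ((i == j) && (k == 0%N)) ||
      words_differ (nth ([::], [::]) os i).2 (nth ([::], [::]) os j).2 k)
    (iota 0 (size (nth ([::], [::]) os j).2))) (iota 0 (size os)))
    (iota 0 (size os)).
Lemma periodic_shifts_differ : shifts_differ periodic_orbits.
Proof. by vm_compute. Qed.
Lemma centers_ok : all (fun p => strictly_in p.1 p.2.1)
  (zip return_centers return_orbits ++ zip periodic_centers periodic_orbits).
Proof. by vm_compute. Qed.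

(** * Itineraries *)

Definition rhombus_map (R : realType) (s t : R) : R * R -> R * R :=
  dmap (rhombus s t).
Arguments rhombus_map : simpl never.

Section Dynamics.
Variables (R : realType) (s t : R).
Hypothesis st_Pi : Pi_triangle R (s, t).
Notation cs := (cset s t).
Notation rho := (rhombus_map s t).

Lemma off_lit c (a b : Z) :
  off s t (c, (a, b)) = zr R a + zr R b * omega R - (if c then t else s).
Proof. by []. Qed.

Lemma zr_lits : (zr R Z0 = 0) * (zr R (Zpos 1) = 1) * (zr R (Zneg 1) = - 1) *
  (zr R (Zpos 2) = 2).
Proof. by []. Qed.

Lemma rhombus_tileE : tile [:: 0; 1; 0; 1]%N [:: -1; -1; 1; 1]
  [:: - t; - s; 1 - t; 1 - s] = cs rhombus_tile.
Proof.
apply/funext => x; rewrite /tile /cset /= /halfplane /hold /= !off_lit !zr_lits.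
by rewrite !mul0r !addr0 !add0r.
Qed.

Lemma rhombusE : rhombus s t = dress (cs rhombus_tile)
  [seq (cs (ratom a), (zvp R (riso a).1, (riso a).2)) | a <- iota 0 5].
Proof.
rewrite /rhombus rhombus_tileE; congr dress; rewrite /=.
have tileE T ms es bs : [seq h.1 | h : cstr <- T] = ms ->
    [seq (if h.2.1 then 1 else -1) | h : cstr <- T] = es ->
    [seq off s t h.2.2 | h : cstr <- T] = bs -> tile ms es bs = cs T.
  move=> <- <- <-; apply/funext => x; rewrite /tile /cset /=; congr is_true.
  elim: T => //= h T ->; congr (_ && _).
  by rewrite /halfplane /hold /=; case: h.2.1.
have z0 : zvp R (zg0, zg0) = (0, 0) by rewrite /zvp /= !zv0.
have z1 : zvp R (zg0, zg1) = (0, 1) by rewrite /zvp /= zv0 zv1.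
have z2 : zvp R (zg0, (Zpos 2, Z0)) = (0, 2).
  by rewrite /zvp /= zv0 /zv /= zr_lits mul0r addr0.
have z3 : zvp R (zg1, zg1) = (1, 1) by rewrite /zvp /= zv1.
have z4 : zvp R (zg1, (Zpos 2, Z0)) = (1, 2).
  by rewrite /zvp /= zv1 /zv /= zr_lits mul0r addr0.
rewrite z0 z1 z2 z3 z4.
by congr [:: (_, _); (_, _); (_, _); (_, _); (_, _)]; apply: tileE => //=;
  rewrite !off_lit !zr_lits !mul0r !addr0 !add0r.
Qed.

Lemma pairwise_separatedP os i j x : pairwise_separated os ->
  (i < size os)%N -> (j < size os)%N ->
  cs (nth [::] os i) x -> cs (nth [::] os j) x -> i = j.
Proof.
elim: os i j => // T os ih [|i] [|j] //= /andP[/allP sep pw].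
- move=> _ hj Tx jx; exfalso.
  by apply: (separatedP st_Pi (sep _ (mem_nth _ hj)) Tx jx).
- move=> hi _ ix Tx; exfalso.
  by apply: (separatedP st_Pi (sep _ (mem_nth _ hi)) Tx ix).
- by move=> *; congr S; apply: ih.
Qed.

Lemma atom_unique a b x : (a < 5)%N -> (b < 5)%N ->
  cs (ratom a) x -> cs (ratom b) x -> a = b.
Proof. by move=> a5 b5; apply: (pairwise_separatedP atoms_separated). Qed.

Lemma mem_ratom a : (a < 5)%N -> ratom a \in rhombus_atoms.
Proof. exact: (@mem_nth _ [::] rhombus_atoms). Qed.

Lemma atom_sub a x : (a < 5)%N -> cs (ratom a) x -> cs rhombus_tile x.
Proof.
move=> a5; apply: (includedP st_Pi).
by have /allP/(_ _ (mem_ratom a5))/andP[] := atoms_included.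
Qed.

Lemma wft_atom a : (a < 5)%N -> wft (ratom a).
Proof. by move=> a5; have /allP/(_ _ (mem_ratom a5))/andP[] := atoms_included. Qed.

Lemma rhoE a x : (a < 5)%N -> cs (ratom a) x -> rho x = isoR (riso a) x.
Proof.
move=> a5 ax; rewrite /rhombus_map rhombusE /dress [dmap _]/=.
have H l : a \in l -> all (fun b => b < 5)%N l ->
    piecewise [seq (cs (ratom a), (zvp R (riso a).1, (riso a).2)) | a <- l] x
      = isoR (riso a) x.
  elim: l => //= b l ih; rewrite inE => al /andP[b5 l5].
  case: ifPn => [/set_mem bx|bx]; first by rewrite (atom_unique b5 a5 bx ax).
  apply: ih => //; case/orP: al => // /eqP ab.
  by move: bx; rewrite -ab mem_set.
by apply: (H (iota 0 5)); rewrite ?mem_iota.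
Qed.

Lemma domE : dom (rhombus s t) = cs rhombus_tile.
Proof. by rewrite rhombusE. Qed.

Lemma atomsE A : atoms (rhombus s t) A <->
  exists2 a, (a < 5)%N & A = cs (ratom a).
Proof.
rewrite rhombusE.
have E X l : atoms (dress X l) A = (A \in [seq i.1 | i <- l]) by [].
rewrite {}E -map_comp; split.
  by move=> /mapP[a]; rewrite mem_iota => /andP[_ a5] ->; exists a.
by move=> [a a5 ->]; apply/mapP; exists a => //; rewrite mem_iota.
Qed.

Lemma coversP tiles T b x : covers tiles T b -> cs T x ->
  exists2 i, (i < size tiles)%N & cs (nth [::] tiles i) x.
Proof.
elim: b T => [i|m o l ihl r ihr] T /=.
  by move=> /andP[i_lt inc] Tx; exists i => //; apply: (includedP st_Pi) Tx.
move=> /andP[cl cr] Tx.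
have add h : hold s t h x -> cs (add_cstr h T) x.
  move=> hx; apply/andP; split=> //; apply/allP => h'; rewrite mem_filter.
  by move=> /andP[_ h'T]; apply: (allP Tx).
have [lt|ge] := boolP (hold s t (m, (true, o)) x).
  by apply: ihl cl _; apply: add.
by apply: ihr cr _; apply: add; rewrite -(hold_negc s t) in ge.
Qed.

Lemma size_trace T w : size (trace T w) = (size w).+1.
Proof. by elim: w T => //= a w ih T; rewrite ih. Qed.

Lemma size_levels T w : size (levels T w) = size w.
Proof. by rewrite size_takel // size_trace. Qed.

(** [word_iso] accumulates from the left while [follows] recurses on the head; this changes the
    accumulator, comparing isometries only through the points they produce. *)
Lemma word_iso_ext w f g (x y : R * R) : isoR f x = isoR g y ->
  isoR (foldl (fun f a => ccomp (riso a) f) f w) x =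
  isoR (foldl (fun f a => ccomp (riso a) f) g w) y.
Proof. by elim: w f g => //= a w ih f g fg; apply: ih; rewrite !isoR_comp fg. Qed.

Lemma isoR_id (x : R * R) : isoR ((zg0, zg0), 0%N) x = x.
Proof. by case: x => a b; rewrite /isoR /TR /transl /zvp /= !zv0 !addr0. Qed.

Lemma word_iso_cons a w (x : R * R) :
  isoR (word_iso (a :: w)) x = isoR (word_iso w) (isoR (riso a) x).
Proof.
by rewrite /word_iso /=; apply: word_iso_ext; rewrite isoR_comp !isoR_id.
Qed.

Lemma follows_iter T w x : wft T -> follows T w -> cs T x -> forall k,
  (k < size w)%N ->
  [/\ (nth 0%N w k < 5)%N, cs (ratom (nth 0%N w k)) (iter k rho x)
    & cs (nth [::] (trace T w) k) (iter k rho x)].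
Proof.
elim: w T x => // a w ih T x wT /and3P[a5 inc fol] Tx [_|k kw] /=.
  by split=> //; apply: (includedP st_Pi inc).
have Ex : rho x = isoR (riso a) x.
  by apply: rhoE a5 _; apply: (includedP st_Pi inc).
rewrite -iterS iterSr Ex; apply: ih => //; first exact: wft_im.
exact/cset_im.
Qed.

Lemma follows_iso T w x : wft T -> follows T w -> cs T x ->
  iter (size w) rho x = isoR (word_iso w) x /\ cs (last_level T w) (iter (size w) rho x).
Proof.
elim: w T x => [|a w ih] T x wT; first by rewrite isoR_id.
move=> /and3P[a5 inc fol] Tx.
have Ex : rho x = isoR (riso a) x.
  by apply: rhoE a5 _; apply: (includedP st_Pi inc).
rewrite [size _]/= iterSr Ex word_iso_cons.
have -> : last_level T (a :: w) = last_level (imt (riso a) T) w.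
  by rewrite /last_level /=; case: w {ih fol}.
by apply: ih => //; [exact: wft_im | exact/cset_im].
Qed.

Lemma image_trace T w k : wft T -> follows T w -> (k <= size w)%N ->
  iter k rho @` cs T = cs (nth [::] (trace T w) k).
Proof.
elim: w T k => [|a w ih] T [|k] //= wT.
- by rewrite image_id.
- by rewrite image_id.
move=> /and3P[a5 inc fol] kw; rewrite -ih //; last exact: wft_im.
rewrite -image_cset //.
have -> : [set isoR (riso a) x | x in cs T] = rho @` cs T.
  apply/seteqP; split=> _ [x Tx <-]; exists x => //.
    by rewrite (rhoE a5) //; apply: (includedP st_Pi inc).
  by rewrite (rhoE a5) //; apply: (includedP st_Pi inc).
rewrite image_comp; congr image; apply/funext => x.
by rewrite /comp -iterSr.
Qed.

Lemma nth_levels T w k : (k < size w)%N ->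
  nth [::] (levels T w) k = nth [::] (trace T w) k.
Proof. by move=> kw; rewrite nth_take. Qed.

Lemma last_levelE T w : last_level T w = nth [::] (trace T w) (size w).
Proof. by rewrite /last_level (last_nth [::]) size_trace; case: w. Qed.

Definition orbits := return_orbits ++ periodic_orbits.

Lemma orbits_follow o : o \in orbits -> wft o.1 /\ follows o.1 o.2.
Proof.
rewrite mem_cat => /orP[/(allP return_orbits_ok)|/(allP periodic_orbits_ok)].
  by case/and5P.
by case/and5P.
Qed.

Lemma cover_orbits x : cs rhombus_tile x -> exists o k,
  [/\ o \in orbits, (k < size o.2)%N & cs (nth [::] (trace o.1 o.2) k) x].
Proof.
move=> /(coversP cover_ok)[i i_lt].
have := mem_nth [::] i_lt; move: (nth _ _ _) => T /flatten_mapP[c hc].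
move=> /(nthP [::])[k]; rewrite size_levels => kw; rewrite nth_levels // => <-.
by exists c, k.
Qed.

(** The cover by orbit levels also shows that the five atoms cover R, because every level lies in an
    atom. *)
Lemma in_atom x : cs rhombus_tile x -> exists2 a, (a < 5)%N & cs (ratom a) x.
Proof.
move=> /cover_orbits[c [k [/orbits_follow[wo fo] kw]]].
rewrite -image_trace // 1?ltnW // => -[y cy <-].
by have [a5 ay _] := follows_iter wo fo cy kw; exists (nth 0%N c.2 k).
Qed.

Lemma rho_sub x : cs rhombus_tile x -> cs rhombus_tile (rho x).
Proof.
move=> /in_atom[a a5 ax]; rewrite (rhoE a5 ax).
have /(includedP st_Pi) : included (imt (riso a) (ratom a)) rhombus_tile.
  by apply: (allP images_included); rewrite mem_iota.
by apply; apply/cset_im => //; apply: wft_atom.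
Qed.

Lemma iter_rho_sub k x : cs rhombus_tile x -> cs rhombus_tile (iter k rho x).
Proof. by move=> Rx; elim: k => [//|k ih]; rewrite iterS; apply: rho_sub. Qed.

(** The images of the five atoms are pairwise disjoint, and on each atom rho is an isometry. *)
Lemma rho_inj x y : cs rhombus_tile x -> cs rhombus_tile y ->
  rho x = rho y -> x = y.
Proof.
move=> /in_atom[a a5 ax] /in_atom[b b5 bx]; rewrite (rhoE a5) // (rhoE b5) // => E.
have ab : a = b.
  have := pairwise_separatedP images_separated (i := a) (j := b)
    (x := isoR (riso a) x).
  rewrite size_map size_iota => /(_ a5 b5).
  rewrite !(nth_map 0%N) ?size_iota // !nth_iota // !add0n; apply.
    by apply/cset_im => //; apply: wft_atom.
  by rewrite E; apply/cset_im => //; apply: wft_atom.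
by apply: (@isoR_inj R (riso a)); rewrite E ab.
Qed.

Lemma iter_rho_inj k x y : cs rhombus_tile x -> cs rhombus_tile y ->
  iter k rho x = iter k rho y -> x = y.
Proof.
move=> Rx Ry; elim: k => [//|k ih]; rewrite !iterS => /rho_inj E; apply: ih; apply: E;
  exact: iter_rho_sub.
Qed.

End Dynamics.

Lemma return_words_uniq : uniq [seq o.2 | o <- return_orbits].
Proof. by vm_compute. Qed.

(** * The first-return pieces of C *)

Section Tiling.
Variables (R : realType) (s t : R).
Hypothesis st_Pi : Pi_triangle R (s, t).
Notation cs := (cset s t).
Notation rho := (rhombus_map s t).
Notation D := (rhombus s t).

Lemma triangleCE : triangleC s = cs triangle_tile.
Proof.
apply/funext => x; rewrite /triangleC /tile /cset /= /halfplane /hold /=.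
rewrite !off_lit !zr_lits !mul0r !addr0.
suff -> : beta R ^+ 4 = zr R (Zpos 5) + zr R (Zneg 3) * omega R by [].
rewrite (_ : zr R (Zpos 5) = 5) // (_ : zr R (Zneg 3) = - 3) // betaE.
by have ww := omega_sqr R; ring: ww.
Qed.

Lemma triangle_sub x : cs triangle_tile x -> cs rhombus_tile x.
Proof. by apply: (includedP st_Pi); vm_compute. Qed.

Definition orbit_word (w : seq nat) : seq (set (R * R)) :=
  [seq cs (ratom a) | a <- w].

Lemma return_orbitP o x : o \in return_orbits -> cs o.1 x ->
  [/\ cs triangle_tile x, cs triangle_tile (iter (size o.2) rho x)
    & forall k, (0 < k < size o.2)%N -> ~ cs triangle_tile (iter k rho x)].
Proof.
move=> oret ox; have /and5P[wo fo iC lC sep] := allP return_orbits_ok _ oret.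
split; first exact: (includedP st_Pi iC).
  by apply: (includedP st_Pi lC); have [] := follows_iso st_Pi wo fo ox.
move=> k /andP[k0 kw]; have [_ _ kx] := follows_iter st_Pi wo fo ox kw.
apply: (separatedP st_Pi _ kx); rewrite -nth_levels //.
have -> : nth [::] (levels o.1 o.2) k = nth [::] (behead (levels o.1 o.2)) k.-1.
  by rewrite nth_behead prednK.
by apply: (allP sep); rewrite mem_nth // size_behead size_levels -ltnS
  !prednK // (leq_trans k0) // ltnW.
Qed.

Lemma return_orbit_size o : o \in return_orbits -> (0 < size o.2)%N.
Proof. by move: o; apply/allP; vm_compute. Qed.

Lemma periodic_iter o x q : o \in periodic_orbits -> cs o.1 x ->
  cs o.1 (iter (size o.2 * q) rho x).
Proof.
move=> oper ox.
have /and5P[wo fo _ inc _] := allP periodic_orbits_ok _ oper.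
elim: q => [|q ih]; first by rewrite muln0.
rewrite mulnS iterD; have [_] := follows_iso st_Pi wo fo ih.
exact: (includedP st_Pi inc).
Qed.

Lemma periodic_letter o x q : o \in periodic_orbits -> cs o.1 x ->
  [/\ (cyclic_letter o.2 q < 5)%N, cs (ratom (cyclic_letter o.2 q)) (iter q rho x)
    & ~ cs triangle_tile (iter q rho x)].
Proof.
move=> oper ox; have /and5P[wo fo _ _ /andP[n0 sep]] := allP periodic_orbits_ok _ oper.
have qn : (q %% size o.2 < size o.2)%N by rewrite ltn_mod.
have qx := periodic_iter (q %/ size o.2) oper ox.
have -> : iter q rho x =
    iter (q %% size o.2) rho (iter (size o.2 * (q %/ size o.2)) rho x).
  by rewrite -iterD mulnC addnC -divn_eq.
have [a5 ax lx] := follows_iter st_Pi wo fo qx qn.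
split=> //; apply: (separatedP st_Pi _ lx); rewrite -nth_levels //.
by apply: (allP sep); rewrite mem_nth // size_levels.
Qed.

Lemma zip_centers (ps : seq cpoint) (os : seq (ctile * seq nat)) o :
  size ps = size os -> all (fun p => strictly_in p.1 p.2.1) (zip ps os) ->
  o \in os -> exists p, strictly_in p o.1.
Proof.
elim: os ps => // o' os ih [|p ps] //= [/ih{}ih] /andP[po /ih{}ih].
by rewrite inE => /orP[/eqP ->|]; [exists p | exact: ih].
Qed.

Lemma orbit_center o : o \in orbits -> exists p, strictly_in p o.1.
Proof.
have := centers_ok; rewrite all_cat => /andP[rc pc].
rewrite mem_cat => /orP[]; first exact: zip_centers rc.
exact: zip_centers pc.
Qed.

Lemma return_time_unique Y x m n : is_return_time D Y x m ->
  is_return_time D Y x n -> m = n.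
Proof.
move=> [m0 mC mN] [n0 nC nN]; case: (ltngtP m n) => // h.
- by case: (nN m) => //; rewrite m0.
- by case: (mN n) => //; rewrite n0.
Qed.

Lemma first_returnE Y x n : is_return_time D Y x n ->
  first_return D Y x = iter n rho x.
Proof.
move=> xn; rewrite /first_return; congr iter.
by apply: (return_time_unique _ xn); apply: (xgetPex 0%N); exists n.
Qed.

Lemma return_orbit_time o x : o \in return_orbits -> cs o.1 x ->
  is_return_time D (triangleC s) x (size o.2).
Proof.
move=> oret ox; have [_ nC nN] := return_orbitP oret ox.
by split; rewrite ?triangleCE //; exact: return_orbit_size.
Qed.

(** A point of C lies in some level of the cover. Periodic levels avoid C, and so do the levels of
    positive height of the return orbits; only the return tiles themselves remain. *)
Lemma triangle_cover x : cs triangle_tile x ->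
  exists2 o, o \in return_orbits & cs o.1 x.
Proof.
move=> xC; have [c [k [co kw]]] := cover_orbits st_Pi (triangle_sub xC).
have [wo fo] := orbits_follow co.
rewrite -(image_trace st_Pi) // 1?ltnW // => -[y cy yx].
move: co; rewrite mem_cat => /orP[cret|cper]; last first.
  by have [_ _ []] := periodic_letter k cper cy; rewrite yx.
exists c => //; case: k kw yx => [|k] kw; first by move=> /= <-.
by move=> yx; have [_ _ /(_ k.+1 kw)] := return_orbitP cret cy; rewrite yx.
Qed.

Lemma nth_orbit_word w k : (k < size w)%N ->
  nth set0 (orbit_word w) k = cs (ratom (nth 0%N w k)).
Proof. by move=> kw; rewrite (nth_map 0%N). Qed.

Lemma return_piece_in o x : o \in return_orbits -> cs o.1 x ->
  return_piece D (triangleC s) (orbit_word o.2) x.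
Proof.
move=> oret ox; have [xC _ _] := return_orbitP oret ox.
have /and5P[wo fo _ _ _] := allP return_orbits_ok _ oret.
split; rewrite ?triangleCE ?size_map //.
  by rewrite -triangleCE; exact: return_orbit_time.
move=> k kw; rewrite nth_orbit_word //.
have [a5 ax _] := follows_iter st_Pi wo fo ox kw.
by split=> //; apply/atomsE; exists (nth 0%N o.2 k).
Qed.

(** [return_piece] is defined for arbitrary words of sets. Since the atoms are disjoint and the
    return time is unique, a word with a point in its piece must be the word of the tile containing
    this point. *)
Lemma return_piece_word V x : return_piece D (triangleC s) V x ->
  exists o, [/\ o \in return_orbits, cs o.1 x & V = orbit_word o.2].
Proof.
move=> [xC xV Vk].
have [c cret cx] : exists2 o, o \in return_orbits & cs o.1 x.
  by apply: triangle_cover; rewrite -triangleCE.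
have /and5P[wo fo _ _ _] := allP return_orbits_ok _ cret.
have sz := return_time_unique xV (return_orbit_time cret cx).
exists c; split=> //; apply: (@eq_from_nth _ set0); first by rewrite size_map.
move=> k kV; have [/atomsE[a a5 aE] kx] := Vk k kV.
rewrite sz in kV; have [b5 bx _] := follows_iter st_Pi wo fo cx kV.
rewrite nth_orbit_word // aE; rewrite aE in kx.
by rewrite (atom_unique st_Pi a5 b5 kx bx).
Qed.

(** Equality is between words of sets, and it passes to the indices because every atom visited
    contains a point of the orbit of a centre. The words of indices are pairwise distinct. *)
Lemma orbit_word_inj o o' : o \in return_orbits -> o' \in return_orbits ->
  orbit_word o.2 = orbit_word o'.2 -> o = o'.
Proof.
move=> oret oret' E.
have [c co] : exists p, strictly_in p o.1.
  by apply: orbit_center; rewrite mem_cat oret.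
have ox := strictly_in_cset st_Pi co.
have /and5P[wo fo _ _ _] := allP return_orbits_ok _ oret.
have [c' co'] : exists p, strictly_in p o'.1.
  by apply: orbit_center; rewrite mem_cat oret'.
have ox' := strictly_in_cset st_Pi co'.
have /and5P[wo' fo' _ _ _] := allP return_orbits_ok _ oret'.
have sz : size o.2 = size o'.2 by have := congr1 size E; rewrite !size_map.
have w_eq : o.2 = o'.2.
  apply: (@eq_from_nth _ 0%N) => // k kw.
  have [a5 ax _] := follows_iter st_Pi wo fo ox kw.
  have kw' := kw; rewrite sz in kw'.
  have [b5 _ _] := follows_iter st_Pi wo' fo' ox' kw'.
  apply: (atom_unique st_Pi a5 b5 ax).
  by rewrite -nth_orbit_word // -E nth_orbit_word.
have [i i_lt oi] := nthP ([::], [::]) oret.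
have [j j_lt oj] := nthP ([::], [::]) oret'.
rewrite -oi -oj; congr nth; apply/eqP.
rewrite -(nth_uniq [::] _ _ return_words_uniq) ?size_map //.
by rewrite !(nth_map ([::], [::])) // oi oj w_eq.
Qed.

Lemma return_orbit_unique o o' x : o \in return_orbits -> o' \in return_orbits ->
  cs o.1 x -> cs o'.1 x -> o = o'.
Proof.
move=> oret oret' ox ox'; have [c [cret _ E]] := return_piece_word (return_piece_in oret ox).
have [c' [cret' _ E']] := return_piece_word (return_piece_in oret' ox').
have [xC xT xV] := return_piece_in oret ox.
have [_ xT' xV'] := return_piece_in oret' ox'.
apply: orbit_word_inj => //.
have sz := return_time_unique xT xT'.
apply: (@eq_from_nth _ set0) => // k kw.
have [/atomsE[a a5 aE] kx] := xV k kw.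
rewrite sz in kw; have [/atomsE[b b5 bE] kx'] := xV' k kw.
by rewrite aE bE in kx kx' *; rewrite (atom_unique st_Pi a5 b5 kx kx').
Qed.

Lemma return_pieceE o : o \in return_orbits ->
  return_piece D (triangleC s) (orbit_word o.2) = cs o.1.
Proof.
move=> oret; apply/seteqP; split=> x; last exact: return_piece_in.
by move=> /return_piece_word[c [cret cx /orbit_word_inj ->]].
Qed.

End Tiling.

(** * Measure and topology of the polygons *)

Section Area.
Variable R : realType.
Notation plane2 := (measurableTypeR R * measurableTypeR R)%type.

Lemma measurable_udot m : measurable_fun setT (@udot R m : plane2 -> measurableTypeR R).
Proof.
rewrite (_ : @udot R m = fun x => zv R (unorm m).1 * x.1 + zv R (unorm m).2 * x.2).
  by apply: measurable_funD; apply: measurable_funM.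
by apply/funext => x; rewrite udotE.
Qed.

Lemma measurable_hold (s t : R) h :
  measurable ([set x | hold s t h x] : set plane2).
Proof.
case: h => m [e b]; set f := (@udot R m : plane2 -> measurableTypeR R).
have H (Y : set (measurableTypeR R)) : measurable Y -> measurable (f @^-1` Y).
  by move=> mY; rewrite -[_ @^-1` _]setTI; apply: measurable_udot.
rewrite /hold /=; case: e.
  rewrite (_ : [set _ | _] = f @^-1` `]-oo, off s t b[); first exact: H.
  by apply/seteqP; split=> x /=; rewrite in_itv.
rewrite (_ : [set _ | _] = f @^-1` `[off s t b, +oo[); first exact: H.
by apply/seteqP; split=> x /=; rewrite in_itv /= andbT.
Qed.

Lemma measurable_cset (s t : R) T : measurable (cset s t T : set plane2).
Proof.
elim: T => [|h T ih].
  by rewrite (_ : cset _ _ _ = setT) //; apply/seteqP; split.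
rewrite (_ : cset _ _ _ = [set x | hold s t h x] `&` cset s t T).
  by apply: measurableI => //; apply: measurable_hold.
by apply/seteqP; split=> x /= /andP.
Qed.

(** Additivity of the measure reduces the condition on areas to a finite measurable partition. *)
Lemma area_finite_partition (I : choiceType) (A : set I) F (X : set (R * R)) :
  finite_set A -> trivIset A F ->
  (forall i, A i -> measurable (F i : set plane2)) ->
  \bigcup_(i in A) F i = X -> esum A (fun i => area (F i)) = area X.
Proof.
move=> fA tF mF <-.
have F0 i : A i -> (0 <= area (F i))%E by move=> _; apply: measure_ge0.
by rewrite esum_fset // /area measure_fin_bigcup.
Qed.
End Area.

Section InteriorPoint.
Variables (R : realType) (s t : R).
Hypothesis st_Pi : Pi_triangle R (s, t).

Lemma continuous_udot m : continuous (@udot R m : (R * R)%type -> R).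
Proof.
move=> x; rewrite (_ : @udot R m =
    fun x => zv R (unorm m).1 * x.1 + zv R (unorm m).2 * x.2); last first.
  by apply/funext => y; rewrite udotE.
by apply: cvgD; apply: cvgMr; [exact: cvg_fst | exact: cvg_snd].
Qed.

Lemma interior_cset p T : strictly_in p T ->
  interior (cset s t T) (pointR s t p).
Proof.
move=> /(strictly_inP st_Pi); rewrite /interior /=.
elim: T => [|h T ih] H; first by apply: filterS filterT => x.
have {}ih : nbhs (pointR s t p) (cset s t T).
  by apply: ih => h' h'T; apply: H; rewrite inE h'T orbT.
have := H h (mem_head _ _).
have cu := @continuous_udot h.1 (pointR s t p).
case E : h.2.1 => hp.
  have lt := cvgr_lt _ cu _ hp.
  near=> x; apply/andP; split; last by near: x; exact: ih.
  by rewrite /hold E /=; near: x; exact: lt.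
have gt := cvgr_gt _ cu _ hp.
near=> x; apply/andP; split; last by near: x; exact: ih.
by rewrite /hold E /= ltW //; near: x; exact: gt.
Unshelve. all: by end_near.
Qed.

(* The segment from a point of the closed polygon to an interior point lies in
   the polygon, except possibly for its end. *)
Lemma closure_cset c p T : strictly_in c T -> weakly_in p T ->
  closure (cset s t T) (pointR s t p).
Proof.
move=> /(strictly_inP st_Pi) cT /(weakly_inP st_Pi) pT.
set q := pointR s t c in cT *; set z := pointR s t p in pT *.
pose f (e : R) : R * R := z + (e * (q - z).1, e * (q - z).2).
have fT e : 0 < e <= 1 -> cset s t T (f e).
  move=> /andP[e0 e1]; apply/allP => h hT; have := cT h hT; have := pT h hT.
  rewrite /hold udotD udotZ udotD udotN; move: (udot _ q) (udot _ z) => a b.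
  case: ifP => _ h1 h2; nra.
have cf : f e @[e --> (0 : R)^'+] --> z.
  rewrite -[X in _ --> X]addr0; apply: cvgD; first exact: cvg_cst.
  have -> : (0 : R * R) = (0 * (q - z).1, 0 * (q - z).2) by rewrite !mul0r.
  apply: (@cvg_pair _ _ _ _ (nbhs (0 * (q - z).1)) (nbhs (0 * (q - z).2)));
    by apply: cvgMl; apply: cvg_at_right_filter; exact: cvg_id.
move=> B Bz; have {}Bz := cf _ Bz.
near (0 : R)^'+ => e; exists (f e); split; last by near: e.
apply: fT; apply/andP; split; near: e; first exact: nbhs_right_gt.
exact: nbhs_right_le.
Unshelve. all: by end_near.
Qed.
End InteriorPoint.

(** * The tiling of the rhombus by orbits *)

Section OrbitsTile.
Variables (R : realType) (s t : R).
Hypothesis st_Pi : Pi_triangle R (s, t).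
Notation cs := (cset s t).
Notation rho := (rhombus_map s t).
Notation D := (rhombus s t).

Lemma imageE k (A : set (R * R)) : iter k (dmap D) @` A = iter k rho @` A.
Proof. by []. Qed.

Lemma cset_convex_polygon T : cs T `<=` cs rhombus_tile ->
  (exists p, strictly_in p T) -> convex_polygon (cs T).
Proof.
move=> TR [p pT]; split; last by exists (pointR s t p); apply: interior_cset.
- pose ineq (h : cstr) := if h.2.1
    then ((zv R (unorm h.1).1, zv R (unorm h.1).2), off s t h.2.2, true)
    else ((- zv R (unorm h.1).1, - zv R (unorm h.1).2), - off s t h.2.2, false).
  exists (map ineq T); apply/funext => x; rewrite /cset /= all_map.
  congr is_true; apply: eq_all => h; rewrite /hold udotE /ineq /=.
  by case: h.2.1 => //=; rewrite !mulNr -opprD lerN2.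
- exists (`|s| + `|t| + 1) => x /TR; rewrite /cset /= /hold /= !off_lit !zr_lits.
  rewrite !mul0r !addr0 !add0r andbT => /and4P[h1 h2 h3 h4].
  have := ler_norm s; have := ler_norm (- s); have := ler_norm t.
  have := ler_norm (- t); rewrite !normrN !ler_norml => *.
  by split; apply/andP; split; lra.
Qed.

Lemma orbit_sub o x k : o \in orbits -> cs o.1 x -> cs rhombus_tile (iter k rho x).
Proof.
move=> co ox; apply: (iter_rho_sub st_Pi).
move: co; rewrite mem_cat => /orP[cret|cper].
  by have [xC _ _] := return_orbitP st_Pi cret ox; apply: (triangle_sub st_Pi).
have [a5 ax _] := periodic_letter st_Pi 0 cper ox.
by apply: (atom_sub st_Pi a5) ax.
Qed.

Lemma periodic_orbit_tile o : o \in periodic_orbits ->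
  periodic_tile D (cs o.1) (size o.2).
Proof.
move=> cper; have co : o \in orbits by rewrite mem_cat cper orbT.
have /and5P[wo fo inc1 inc2 /andP[n0 _]] := allP periodic_orbits_ok _ cper.
have [p po] := orbit_center co.
have oR : cs o.1 `<=` cs rhombus_tile by move=> x; apply: (@orbit_sub _ _ 0).
split; rewrite ?domE //.
- by apply: cset_convex_polygon => //; exists p.
- move=> k kn; exists (cs (ratom (nth 0%N o.2 k))).
    apply/atomsE; exists (nth 0%N o.2 k) => //.
    by have [] := follows_iter st_Pi wo fo (strictly_in_cset st_Pi po) kn.
  by move=> _ [x ox <-]; have [] := follows_iter st_Pi wo fo ox kn.
split=> // [|k /andP[k0 kn]].
  rewrite imageE (image_trace st_Pi wo fo (leqnn _)) -last_levelE.
  by apply/seteqP; split; apply: (includedP st_Pi).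
(* If rho^k maps the tile onto itself, the centre and its k-th iterate both follow the periodic
   word, which would then equal its own shift by k. *)
move=> E; have px := strictly_in_cset st_Pi po.
have : cs o.1 (iter k rho (pointR s t p)) by rewrite -E; exists (pointR s t p).
move=> kx; have [i i_lt oi] := nthP ([::], [::]) cper.
have /allP/(_ i) := periodic_shifts_differ; rewrite mem_iota => /(_ i_lt).
move=> /allP/(_ i); rewrite mem_iota => /(_ i_lt) /allP/(_ k).
rewrite oi mem_iota kn => /(_ isT); rewrite eqxx /=.
rewrite (gtn_eqF k0) /=.
rewrite /words_differ lazy_hasE => /hasP[n _ /eqP]; apply.
have [a5 ax _] := periodic_letter st_Pi n cper kx.
have [b5 bx _] := periodic_letter st_Pi (k + n) cper px.
by apply: (atom_unique st_Pi a5 b5 ax); rewrite -iterD [(n + k)%N]addnC.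
Qed.

Definition ptile (j : 'I_13) : ctile * seq nat :=
  nth ([::], [::]) periodic_orbits j.

Lemma mem_ptile j : ptile j \in periodic_orbits.
Proof. by rewrite mem_nth. Qed.

Let P (j : 'I_13) : set (R * R) := cs (ptile j).1.
Let n (j : 'I_13) : nat := size (ptile j).2.
Let index := orbit_index D (triangleC s) n.
Let F := orbit_set D (triangleC s) P.

Lemma index_inl V k : index (inl (V, k)) -> exists o,
  [/\ o \in return_orbits, V = orbit_word s t o.2, (k < size o.2)%N
    & F (inl (V, k)) = iter k rho @` cs o.1].
Proof.
move=> [[x /(return_piece_word st_Pi)[c [cret _ VE]]] kV].
rewrite /= in VE kV.
exists c; split=> //; first by move: kV; rewrite VE size_map.
by rewrite /F /= VE (return_pieceE st_Pi).
Qed.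

Lemma index_return o k : o \in return_orbits -> (k < size o.2)%N ->
  index (inl (orbit_word s t o.2, k)) /\
  F (inl (orbit_word s t o.2, k)) = iter k rho @` cs o.1.
Proof.
move=> cret kw; rewrite /F /= (return_pieceE st_Pi) //; split=> //.
split; last by rewrite /= size_map.
rewrite /= ?(return_pieceE st_Pi) //.
have [p po] : exists p, strictly_in p o.1.
  by apply: orbit_center; rewrite mem_cat cret.
by exists (pointR s t p); apply: strictly_in_cset.
Qed.

(** As rho is injective, a common point of two levels at heights k <= k' can be pulled back k steps.
    Two return orbits: the pulled back point is in C at height k' - k, which forces k = k' and then
    the same piece. A return and a periodic orbit: running forward brings the former into C, where
    the latter never goes. Two periodic orbits: their words would agree up to a shift. *)
Lemma orbits_disjoint : trivIset index F.
Proof.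
have sep_rr o o' k k' x x' : o \in return_orbits -> o' \in return_orbits ->
    (k < size o.2)%N -> (k' < size o'.2)%N -> (k <= k')%N -> cs o.1 x ->
    cs o'.1 x' -> iter k rho x = iter k' rho x' -> o = o' /\ k = k'.
  move=> c c' kw kw' kk' ox ox'.
  rewrite -(subnKC kk') iterD => /(iter_rho_inj st_Pi) E.
  have {}E : x = iter (k' - k) rho x'.
    apply: E; first by apply: (@orbit_sub o x 0) => //; rewrite mem_cat c.
    by apply: (@orbit_sub o') => //; rewrite mem_cat c'.
  have [xC _ _] := return_orbitP st_Pi c ox.
  have [_ _ nC] := return_orbitP st_Pi c' ox'.
  have [d0|d0] := posnP (k' - k)%N; last first.
    by case: (nC (k' - k)%N); rewrite -?E // d0 (leq_ltn_trans (leq_subr _ _)).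
  rewrite d0 /= in E; rewrite -E in ox'.
  by split; [exact: return_orbit_unique ox ox' | rewrite d0 addn0].
have sep_rp o j k k' x x' : o \in return_orbits -> (k < size o.2)%N ->
    cs o.1 x -> P j x' -> iter k rho x <> iter k' rho x'.
  move=> c kw ox jx E; have [_ xC _] := return_orbitP st_Pi c ox.
  have [_ _] := periodic_letter st_Pi (size o.2 - k + k') (mem_ptile j) jx.
  by rewrite iterD -E -iterD subnK // ltnW.
have sep_pp j j' k k' x x' : (k < n j)%N -> (k' < n j')%N -> (k <= k')%N ->
    P j x -> P j' x' -> iter k rho x = iter k' rho x' -> j = j' /\ k = k'.
  move=> kn kn' kk' jx jx'.
  have mo j0 : ptile j0 \in orbits by rewrite mem_cat mem_ptile orbT.
  rewrite -(subnKC kk') iterD => /(iter_rho_inj st_Pi) E.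
  have {}E : x = iter (k' - k) rho x'.
    apply: E; first exact: (@orbit_sub (ptile j) x 0).
    exact: (@orbit_sub (ptile j')).
  have /allP/(_ (val j)) := periodic_shifts_differ; rewrite mem_iota => /(_ (ltn_ord j)).
  move=> /allP/(_ (val j')); rewrite mem_iota => /(_ (ltn_ord j')) /allP/(_ (k' - k)%N).
  rewrite mem_iota (leq_ltn_trans (leq_subr _ _) kn') => /(_ isT) /orP[/andP[]|].
    by move=> /eqP/val_inj -> /eqP ->; rewrite addn0.
  rewrite /words_differ lazy_hasE => /hasP[m _ /eqP []].
  have [a5 ax _] := periodic_letter st_Pi m (mem_ptile j) jx.
  have [b5 bx _] := periodic_letter st_Pi (k' - k + m) (mem_ptile j') jx'.
  apply: (atom_unique st_Pi a5 b5 ax).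
  by rewrite E -iterD [(m + _)%N]addnC.
move=> [[V k]|[j k]] [[V' k']|[j' k']] iD iD' [y [Fy Fy']].
- have [c [cr VE kw FE]] := index_inl iD; have [c' [cr' VE' kw' FE']] := index_inl iD'.
  move: Fy Fy'; rewrite FE FE' => -[x ox <-] [x' ox' E]; rewrite VE VE'.
  case/orP: (leq_total k k') => kk'.
    by have [-> ->] := sep_rr _ _ _ _ _ _ cr cr' kw kw' kk' ox ox' (esym E).
  by have [-> ->] := sep_rr _ _ _ _ _ _ cr' cr kw' kw kk' ox' ox E.
- have [c [cr VE kw FE]] := index_inl iD.
  move: Fy Fy'; rewrite FE => -[x ox <-] [x' ox' E].
  by case: (sep_rp _ _ _ _ _ _ cr kw ox ox' (esym E)).
- have [c [cr VE kw FE]] := index_inl iD'.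
  move: Fy Fy'; rewrite FE => -[x ox <-] [x' ox' E].
  by case: (sep_rp _ _ _ _ _ _ cr kw ox' ox E).
- move: Fy Fy' => -[x ox <-] [x' ox' E].
  case/orP: (leq_total k k') => kk'.
    have [jj kk] : j = j' /\ k = k'.
      exact: sep_pp iD iD' kk' ox ox' (esym E).
    by rewrite jj kk.
  have [jj kk] : j' = j /\ k' = k by exact: sep_pp iD' iD kk' ox' ox E.
  by rewrite jj kk.
Qed.

Lemma orbits_sub i : index i -> F i `<=` dom D.
Proof.
rewrite domE; case: i => [[V k]|[j k]] iD y.
  have [c [cr VE kw ->]] := index_inl iD => -[x ox <-].
  by apply: (@orbit_sub c) => //; rewrite mem_cat cr.
move=> [x ox <-]; apply: (@orbit_sub (ptile j)) => //.
by rewrite mem_cat mem_ptile orbT.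
Qed.

Lemma orbits_measurable i : index i ->
  measurable (F i : set (measurableTypeR R * measurableTypeR R)).
Proof.
case: i => [[V k]|[j k]] iD.
  have [c [cr VE kw ->]] := index_inl iD.
  have [wo fo] : wft c.1 /\ follows c.1 c.2 by apply: orbits_follow; rewrite mem_cat cr.
  by rewrite (image_trace st_Pi wo fo (ltnW kw)); apply: measurable_cset.
have [wo fo] : wft (ptile j).1 /\ follows (ptile j).1 (ptile j).2.
  by apply: orbits_follow; rewrite mem_cat mem_ptile orbT.
rewrite /F /= imageE (image_trace st_Pi wo fo (ltnW iD)).
exact: measurable_cset.
Qed.

Lemma orbits_cover : \bigcup_(i in index) F i = dom D.
Proof.
apply/seteqP; split=> [y [i /orbits_sub]|]; first exact.
rewrite domE => y /(cover_orbits st_Pi)[c [k [co kw]]].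
have [wo fo] := orbits_follow co.
rewrite -(image_trace st_Pi wo fo (ltnW kw)) => yk.
move: co; rewrite mem_cat => /orP[cr|cp].
  have [ci cF] := index_return cr kw.
  by exists (inl (orbit_word s t c.2, k)); rewrite ?cF.
have [j j_lt cj] := nthP ([::], [::]) cp.
exists (inr (Ordinal (j_lt : (j < 13)%N), k)); rewrite /index /F /n /P /ptile /= cj //.
Qed.

Lemma orbits_finite : finite_set index.
Proof.
pose l := [seq inl (orbit_word s t o.2, k) | o <- return_orbits,
    k <- iota 0 (size o.2)] ++ [seq inr (j, k) | j <- enum 'I_13, k <- iota 0 (n j)].
apply: (@sub_finite_set _ _ [set` l]); last exact: finite_seq.
move=> [[V k]|[j k]] iD; rewrite /= mem_cat; apply/orP; [left|right].
  have [c [cr -> kw _]] := index_inl iD.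
  by apply/allpairsPdep; exists c, k; split; rewrite ?mem_iota.
by apply/allpairsPdep; exists j, k; split; rewrite ?mem_enum ?mem_iota.
Qed.

Theorem rhombus_orbits_tile : orbits_tile D (triangleC s) 13.
Proof.
exists P, n; split; first by move=> j; apply: periodic_orbit_tile; exact: mem_ptile.
split; [exact: orbits_disjoint | exact: orbits_sub |].
apply: area_finite_partition.
- exact: orbits_finite.
- exact: orbits_disjoint.
- exact: orbits_measurable.
- exact: orbits_cover.
Qed.

End OrbitsTile.

(** * The similarity of C with the base triangle *)

Section RotationRigidity.
Variable R : realType.
Notation w := (omega R).
Implicit Types x y v d : R * R.

Lemma rot1_fixed v : rot1 v = v -> v = 0.
Proof.
case: v => a b [/= h ab]; have := omega_bounds R; move: h; rewrite betaE ab => h wb.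
have /eqP : b * (w - 3) = 0 by lra.
by rewrite mulf_eq0 => /orP[/eqP ->|/eqP w3] //; exfalso; lra.
Qed.

(** As 5 is prime, [rot1] is itself a power of any nontrivial power of it; the multipliers 1, 3, 2,
    4 are the inverses of 1, 2, 3, 4 modulo 5. *)
Lemma rot_fixed k v : (k %% 5 != 0)%N -> iter k (@rot1 R) v = v -> v = 0.
Proof.
move=> k5 kv; apply: rot1_fixed.
have mul j : iter (j * k) (@rot1 R) v = v.
  by elim: j => // j ih; rewrite mulSn iterD ih.
have one j : ((j * k) %% 5 = 1)%N -> rot1 v = v.
  by move=> jk; rewrite -[RHS](mul j) -iter_rot1_mod jk.
move: k5 one; have : (k %% 5 < 5)%N by rewrite ltn_mod.
case E : (k %% 5)%N => [|[|[|[|[|]]]]] // _ _ one.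
- by apply: (one 1%N); rewrite -modnMmr E.
- by apply: (one 3%N); rewrite -modnMmr E.
- by apply: (one 2%N); rewrite -modnMmr E.
- by apply: (one 4%N); rewrite -modnMmr E.
Qed.

Lemma rot_eq m n v : v != 0 -> iter m (@rot1 R) v = iter n (@rot1 R) v ->
  (m %% 5 = n %% 5)%N.
Proof.
move=> v0 E; apply/eqP; apply: contraNT v0 => mn; apply/eqP.
apply: (@rot_fixed (4 * n + m)).
  apply: contraNN mn => /eqP h; apply/eqP.
  have : (n + (4 * n + m) = n %[mod 5])%N by rewrite -modnDmr h addn0.
  by rewrite addnA -mulSn -modnDml modnMr add0n.
by rewrite iterD E -iterD -mulSnr iter_rot1_5.
Qed.

(** The rotation parts agree on the nonzero vector x - y, and a nontrivial rotation fixes no such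
    vector. Hence two points determine the code of an isometry. *)
Lemma TR_eq d m d' m' x y : x <> y -> TR d m x = TR d' m' x ->
  TR d m y = TR d' m' y -> (m %% 5 = m' %% 5)%N /\ d = d'.
Proof.
move=> xy Ex Ey.
have mm : (m %% 5 = m' %% 5)%N.
  apply: (@rot_eq m m' (x - y)); first by rewrite subr_eq0; apply/eqP.
  rewrite !iter_rot1D !iter_rot1N; have := congr2 (fun a b => a - b) Ex Ey.
  have sub (a b c : R * R) : a + c - (b + c) = a - b by rewrite opprD addrACA subrr addr0.
  by rewrite /TR !translE !sub.
split=> //; move: Ex; rewrite /TR !translE -(iter_rot1_mod m) mm iter_rot1_mod.
exact: addrI.
Qed.

End RotationRigidity.

(** The atoms B_1, B_2, B_3 of the base triangle, pulled back to C by the similarity [sim]. *)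
Definition similar_atoms : seq ctile :=
  [:: [:: upS 0 1 0; upS 2 (-1) 0; upS 3 12 (-8)];
      [:: loS 1 5 (-3); upS 4 (-11) 7; upS 0 1 0; loS 3 12 (-8); upS 2 (-1) 0];
      [:: loS 1 5 (-3); upS 0 1 0; loS 4 (-11) 7]].
Definition merged_isos : seq ciso :=
  [:: (((Zneg 11, Zpos 8), (Zpos 8, Zneg 5)), 2%N);
      (((Zpos 2, Z0), (Zneg 7, Zpos 5)), 3%N);
      (((Zneg 24, Zpos 16), (Zpos 16, Zneg 10)), 2%N)].
(** The eight return tiles merge as 1 + 3 + 4 into the three atoms of the base triangle. *)
Definition groups : seq nat := [:: 0; 1; 1; 1; 2; 2; 2; 2]%N.
Definition rtile i := nth ([::], [::]) return_orbits i.
Definition group i := nth 0%N groups i.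
Definition gatom g := nth [::] similar_atoms g.
Definition giso g := nth ((zg0, zg0), 0%N) merged_isos g.

Lemma return_isos : all (fun i => word_iso (rtile i).2 == giso (group i)) (iota 0 8).
Proof. by vm_compute. Qed.
Lemma return_groups :
  all (fun i => included (rtile i).1 (gatom (group i))) (iota 0 8).
Proof. by vm_compute. Qed.
Lemma similar_separated : pairwise_separated similar_atoms.
Proof. by vm_compute. Qed.
Lemma similar_included : all (fun T => included T triangle_tile) similar_atoms.
Proof. by vm_compute. Qed.

Definition distinct_points (p q : cpoint) : bool :=
  let v c := affadd (affscale (Zpos q.1, Z0) (c p.2))
                (affopp (affscale (Zpos p.1, Z0) (c q.2))) in
  let nz f := affpos f || affpos (affopp f) in nz (v fst) || nz (v snd).
Lemma adjacencies_ok : all (fun a : (nat * nat) * (cpoint * cpoint) =>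
  [&& distinct_points a.2.1 a.2.2,
    weakly_in a.2.1 (rtile a.1.1).1, weakly_in a.2.1 (rtile a.1.2).1,
    weakly_in a.2.2 (rtile a.1.1).1 & weakly_in a.2.2 (rtile a.1.2).1])
  adjacencies.
Proof. by vm_compute. Qed.
Lemma adjacencies_groups : all (fun a : (nat * nat) * (cpoint * cpoint) =>
  [&& a.1.1 < 8, a.1.2 < 8 & group a.1.1 == group a.1.2]%N) adjacencies.
Proof. by vm_compute. Qed.
Definition adjacent i j := ((i, j) \in [seq a.1 | a <- adjacencies])
  || ((j, i) \in [seq a.1 | a <- adjacencies]).
(** Chains of at most two adjacencies join the tiles of a group, so merging reaches the whole
    group. *)
Lemma groups_connected : all (fun i => all (fun j => (group i == group j) ==>
    [|| i == j, adjacent i j | has (fun k => adjacent i k && adjacent k j) (iota 0 8)])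
  (iota 0 8)) (iota 0 8).
Proof. by vm_compute. Qed.

Section Similarity.
Variables (R : realType) (s t : R).
Hypothesis st_Pi : Pi_triangle R (s, t).
Notation cs := (cset s t).
Notation rho := (rhombus_map s t).
Notation D := (rhombus s t).
Notation C := (triangleC s).
Notation w := (omega R).
Notation tau := (tauC s).

(** Takes the vertex (1 - s, - 2 omega s) of C, where u_0 . x = 1 - s and u_2 . x = - 1 - s, to the
    origin, which is the corresponding vertex of the base triangle. *)
Definition sim_shift : R * R := (s - 1, 2 * w * s).
Definition sim (x : R * R) : R * R := homoth (w ^+ 7) (transl sim_shift x).

Lemma omega2E : w ^+ 2 = w + 1.
Proof. by rewrite expr2 omega_sqr. Qed.

Lemma omega7E : w ^+ 7 = 13 * w + 8.
Proof.
rewrite (_ : w ^+ 7 = w * (w ^+ 2 * w ^+ 2 * w ^+ 2)); last by ring.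
by rewrite omega2E; have ww := omega_sqr R; ring: ww.
Qed.

Lemma omega7_gt0 : 0 < w ^+ 7.
Proof. by rewrite exprn_gt0 //; have := omega_bounds R; lra. Qed.

Lemma tauCE : tau = (29 * w + 18) * s + 3 * w + 2.
Proof.
by rewrite /tauC alphaE betaE omega7E; have ww := omega_sqr R; ring: ww.
Qed.

Lemma udot_sim m x : udot m (sim x) = w ^+ 7 * (udot m x + udot m sim_shift).
Proof. by rewrite /sim /homoth udotZ translE udotD. Qed.

Lemma tile_sim ms es bs T x :
  [seq h.1 | h : cstr <- T] = ms ->
  [seq (if h.2.1 then 1 else -1) | h : cstr <- T] = es ->
  [seq w ^+ 7 * (off s t h.2.2 + udot h.1 sim_shift) | h : cstr <- T] = bs ->
  tile ms es bs (sim x) <-> cs T x.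
Proof.
move=> <- <- <-; rewrite /tile /cset /=.
suff -> : all (fun h => halfplane h.1 h.2.1 h.2.2 (sim x))
  (zip [seq h.1 | h <- T] (zip [seq (if h.2.1 then 1 else -1) | h <- T]
   [seq w ^+ 7 * (off s t h.2.2 + udot h.1 sim_shift) | h : cstr <- T])) =
  all (hold s t ^~ x) T by [].
elim: T => //= h T ->; congr (_ && _); rewrite /halfplane /hold udot_sim.
by have := omega7_gt0 => w7; case: h.2.1 => /=;
  rewrite ?(ltr_pM2l w7) ?(ler_pM2l w7) ?ltrD2r ?lerD2r.
Qed.

(** The first identity, for the side u_1 . x = beta^4 - s of C, is the origin of the formula for
    tau: the shift adds 2 omega s to - s, which leaves alpha s. The last two match the lines that
    cut the triangle into atoms. *)
Lemma sim_offsets :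
  [/\ w ^+ 7 * (off s t (false, (Zpos 5, Zneg 3)) + udot 1 sim_shift) = tau - w ^+ 2,
      w ^+ 7 * (off s t (false, (Zpos 1, Z0)) + udot 0 sim_shift) = 0,
      w ^+ 7 * (off s t (false, (Zneg 1, Z0)) + udot 2 sim_shift) = 0,
      w ^+ 7 * (off s t (false, (Zpos 12, Zneg 8)) + udot 3 sim_shift) = w - w * tau
    & w ^+ 7 * (off s t (false, (Zneg 11, Zpos 7)) + udot 4 sim_shift) =
      w ^+ 2 - w * tau].
Proof.
have ww := omega_sqr R.
have z5 : zr R (Zpos 5) = 5 by []. have z3 : zr R (Zneg 3) = - 3 by [].
have z12 : zr R (Zpos 12) = 12 by []. have z8 : zr R (Zneg 8) = - 8 by [].
have z11 : zr R (Zneg 11) = - 11 by []. have z7 : zr R (Zpos 7) = 7 by [].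
rewrite tauCE omega7E omega2E !off_lit !zr_lits z5 z3 z12 z8 z11 z7 /= betaE.
by split; ring: ww.
Qed.

Notation BT := (base_triangle tau).

Lemma sim_dom x : dom BT (sim x) <-> cs triangle_tile x.
Proof.
have [e1 e0 e2 _ _] := sim_offsets.
have -> : cs triangle_tile x <-> cs [:: loS 1 5 (-3); upS 0 1 0; upS 2 (-1) 0] x.
  by split; apply: (includedP st_Pi); vm_compute.
by apply: tile_sim => //=; rewrite e1 e0 e2.
Qed.

End Similarity.

Section SimilarityProof.
Variables (R : realType) (s t : R).
Hypothesis st_Pi : Pi_triangle R (s, t).
Notation cs := (cset s t).
Notation rho := (rhombus_map s t).
Notation D := (rhombus s t).
Notation C := (triangleC s).
Notation w := (omega R).
Notation tau := (tauC s).
Notation BT := (base_triangle tau).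
Notation sim := (sim s).
Notation sub := (subdomain D C).

Definition base_atoms : seq (set (R * R) * ((R * R) * nat)) :=
  [:: (tile [:: 0; 2; 3]%N [:: 1; 1; 1] [:: 0; 0; w - w * tau],
        ((w * tau - w, - w ^+ 2 + w ^+ 2 * tau), 2%N));
      (tile [:: 1; 4; 0; 3; 2]%N [:: -1; 1; 1; -1; 1]
         [:: tau - w ^+ 2; w ^+ 2 - w * tau; 0; w - w * tau; 0],
        ((0, w ^+ 2 * tau - w ^+ 3), 3%N));
      (tile [:: 1; 0; 4]%N [:: -1; 1; -1] [:: tau - w ^+ 2; 0; w ^+ 2 - w * tau],
        ((w * tau - 2 * w, w ^+ 2 * tau - 2 * w ^+ 2), 2%N))].
Definition batom g := nth (set0, (0, 0%N)) base_atoms g.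

Lemma sim_atom g x : (g < 3)%N -> (batom g).1 (sim x) <-> cs (gatom g) x.
Proof.
have [e1 e0 e2 e3 e4] := sim_offsets s t.
case: g => [|[|[|]]] // _; apply: tile_sim => //=; by rewrite ?e0 ?e1 ?e2 ?e3 ?e4.
Qed.

Lemma gatom_unique g h x : (g < 3)%N -> (h < 3)%N -> cs (gatom g) x ->
  cs (gatom h) x -> g = h.
Proof. by move=> g3 h3; apply: (pairwise_separatedP st_Pi similar_separated). Qed.

Lemma sim_map g x : (g < 3)%N -> cs (gatom g) x ->
  dmap BT (sim x) = TR (batom g).2.1 (batom g).2.2 (sim x).
Proof.
move=> g3 gx.
have -> : dmap BT (sim x) = piecewise base_atoms (sim x) by [].
have other h : (h < 3)%N -> h != g -> (sim x \in (batom h).1) = false.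
  move=> h3 hg; apply/negbTE/negP => /set_mem/(sim_atom _ h3) hx.
  by rewrite (gatom_unique h3 g3 hx gx) eqxx in hg.
have same : (sim x \in (batom g).1) = true by apply/mem_set/sim_atom.
have E : piecewise base_atoms (sim x) =
  if sim x \in (batom 0).1 then TR (batom 0).2.1 (batom 0).2.2 (sim x)
  else if sim x \in (batom 1).1 then TR (batom 1).2.1 (batom 1).2.2 (sim x)
  else if sim x \in (batom 2).1 then TR (batom 2).2.1 (batom 2).2.2 (sim x)
  else sim x by [].
rewrite {}E; case: g g3 {gx} other same => [|[|[|]]] // _ other same.
- by rewrite same.
- by rewrite (other 0%N) // same.
- by rewrite (other 0%N) // (other 1%N) // same.
Qed.

Lemma sim_iso g x : (g < 3)%N ->
  TR (batom g).2.1 (batom g).2.2 (sim x) = sim (isoR (giso g) x).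
Proof.
have ww := omega_sqr R.
have zE a b : zv R (a, b) = zr R a + zr R b * w by [].
have lits : (zr R (Zneg 11) = - 11) * (zr R (Zpos 8) = 8) * (zr R (Zneg 5) = - 5) *
  (zr R (Zneg 7) = - 7) * (zr R (Zpos 5) = 5) * (zr R (Zneg 24) = - 24) *
  (zr R (Zpos 16) = 16) * (zr R (Zneg 10) = - 10) by [].
have w3 : w ^+ 3 = 2 * w + 1 by rewrite exprS omega2E; ring: ww.
case: x => a b; case: g => [|[|[|]]] // _;
  rewrite /sim /homoth /isoR /TR /transl /zvp /= !zE !lits ?zr_lits;
  rewrite omega7E omega2E ?w3 betaE tauCE; congr pair; ring: ww.
Qed.

Lemma first_return_piece i x : (i < 8)%N -> cs (rtile i).1 x ->
  first_return D C x = isoR (giso (group i)) x.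
Proof.
move=> i8 ix; have cret : rtile i \in return_orbits by rewrite mem_nth.
have tx := return_orbit_time st_Pi cret ix.
rewrite (first_returnE tx).
have /and5P[wo fo _ _ _] := allP return_orbits_ok _ cret.
have [-> _] := follows_iso st_Pi wo fo ix.
by have /allP/(_ i) := return_isos; rewrite mem_iota => /(_ i8) /eqP ->.
Qed.

Lemma sub_atomP A : atoms sub A <-> exists2 i, (i < 8)%N & A = cs (rtile i).1.
Proof.
split=> [[[x Ax] [V VE]]|[i i8 ->]].
  rewrite VE in Ax; have [c [cret cx E]] := return_piece_word st_Pi Ax.
  have [i i_lt ci] := nthP ([::], [::]) cret.
  by exists i => //; rewrite VE E (return_pieceE st_Pi) // -ci.
have cret : rtile i \in return_orbits by rewrite mem_nth.
split; last by exists (orbit_word s t (rtile i).2); rewrite (return_pieceE st_Pi).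
have [p po] : exists p, strictly_in p (rtile i).1.
  by apply: orbit_center; rewrite mem_cat cret.
by exists (pointR s t p); apply: strictly_in_cset.
Qed.

Lemma two_points T : (exists p, strictly_in p T) ->
  exists x y, [/\ x <> y, cs T x & cs T y].
Proof.
move=> [p pT]; have := interior_cset st_Pi pT; set z := pointR s t p => zT.
have cf : (z + (e, 0 : R)) @[e --> (0 : R)^'+] --> z.
  rewrite -[X in _ --> X]addr0; apply: cvgD; first exact: cvg_cst.
  apply: (@cvg_pair _ _ _ _ (nbhs (0 : R)) (nbhs (0 : R))).
    by apply: cvg_at_right_filter; exact: cvg_id.
  exact: cvg_cst.
have {}zT := cf _ zT.
near (0 : R)^'+ => e; exists (z + (e, 0)), z; split.
- move=> /eqP; rewrite -subr_eq0 addrAC subrr add0r => /eqP[e0].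
  have : 0 < e by near: e; exact: nbhs_right_gt.
  by rewrite e0 ltxx.
- by near: e.
- exact: strictly_in_cset.
Unshelve. all: by end_near.
Qed.

Lemma rtile_center i : (i < 8)%N -> exists p, strictly_in p (rtile i).1.
Proof.
by move=> i8; apply: orbit_center; rewrite mem_cat (_ : rtile i \in _) // mem_nth.
Qed.

(** Groups 0 and 2 share the rotation by 2 and differ in the first coordinate of the translation;
    group 1 rotates by 3. *)
Lemma giso_rigid g h d m d' m' : (g < 3)%N -> (h < 3)%N ->
  zvp R (giso g).1 = d -> ((giso g).2 %% 5 = m)%N ->
  zvp R (giso h).1 = d' -> ((giso h).2 %% 5 = m')%N -> d = d' -> m = m' -> g = h.
Proof.
have lt : zv R (Zneg 24, Zpos 16) < zv R (Zneg 11, Zpos 8).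
  by rewrite -subr_gt0 -zvB; apply: zgposP; vm_compute.
case: g h => [|[|[|]]] // [|[|[|]]] // _ _ <- <- <- <- //.
- by move=> [E]; rewrite -[Zneg 11]/(Zneg 11) E ltxx in lt.
- by move=> [E]; rewrite E ltxx in lt.
Qed.

(** Merging does not go beyond a group: two points of each tile determine its isometry, and the
    three groups have different isometries. *)
Lemma same_isometry_group i j : (i < 8)%N -> (j < 8)%N ->
  same_isometry sub (cs (rtile i).1) (cs (rtile j).1) -> group i = group j.
Proof.
move=> i8 j8 [d [m H]].
have rigid k : (k < 8)%N -> (forall x, cs (rtile k).1 x -> dmap sub x = TR d m x) ->
    ((giso (group k)).2 %% 5 = m %% 5)%N /\ zvp R (giso (group k)).1 = d.
  move=> k8 kH; have [x [y [xy kx ky]]] := two_points (rtile_center k8).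
  apply: (TR_eq xy); [rewrite -(kH x kx) | rewrite -(kH y ky)];
    exact/esym/(first_return_piece k8).
have [mi di] := rigid i i8 (fun x ix => H x (or_introl ix)).
have [mj dj] := rigid j j8 (fun x ix => H x (or_intror ix)).
have g3 k : (k < 8)%N -> (group k < 3)%N by move: k; do 8?case=> //.
exact: (giso_rigid (g3 i i8) (g3 j j8) di mi dj mj).
Qed.

Lemma distinct_pointsP p q : distinct_points p q -> pointR s t p <> pointR s t q.
Proof.
have nz f : affpos f || affpos (affopp f) -> av s t f != 0.
  by case/orP => /(affposP st_Pi); rewrite ?avN => h; apply/eqP => E;
     rewrite E ?oppr0 ltxx in h.
have zE c : zv R (Zpos c, Z0) = zr R (Zpos c) by rewrite /zv /= zr_lits mul0r addr0.
have c0 c : zr R (Zpos c) != 0 by rewrite gt_eqF // zr_pos_gt0.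
move=> /orP[] /nz h [E1 E2]; move/negP: h; apply; apply/eqP;
  rewrite avD avN !avZ !zE.
- by move/eqP: E1; rewrite eqr_div // => /eqP E; rewrite mulrC E mulrC subrr.
- by move/eqP: E2; rewrite eqr_div // => /eqP E; rewrite mulrC E mulrC subrr.
Qed.

Lemma adjacent_mergeable i j : adjacent i j ->
  [/\ (i < 8)%N, (j < 8)%N, group i = group j
    & mergeable sub (cs (rtile i).1) (cs (rtile j).1)].
Proof.
have H b : b \in [seq a.1 | a <- adjacencies] -> [/\ (b.1 < 8)%N, (b.2 < 8)%N,
    group b.1 = group b.2 & edge_adjacent (cs (rtile b.1).1) (cs (rtile b.2).1)].
  pose p0 : cpoint := (xH, ((zg0, (zg0, zg0)), (zg0, (zg0, zg0)))).  
  pose a0 := ((0, 0)%N, (p0, p0)).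
  move=> /(nthP (0, 0)%N)[k]; rewrite size_map => ka; rewrite (nth_map a0) // => <-.
  move: (nth a0 _ _) (all_nthP a0 adjacencies_ok k ka) (all_nthP a0 adjacencies_groups k ka).
  move=> a /and5P[dp p1 p2 q1 q2] /and3P[i8 j8 /eqP g].
  split=> //; exists (pointR s t a.2.1), (pointR s t a.2.2).
  have [ci pci] := rtile_center i8; have [cj pcj] := rtile_center j8.
  split; first exact: distinct_pointsP.
    by split; [exact: closure_cset pci p1 | exact: closure_cset pcj p2].
  by split; [exact: closure_cset pci q1 | exact: closure_cset pcj q2].
have iso k : (k < 8)%N -> forall x, cs (rtile k).1 x ->
    dmap sub x = TR (zvp R (giso (group k)).1) (giso (group k)).2 x.
  by move=> k8 x /(first_return_piece k8).
have sub_in k : (k < 8)%N -> atoms sub (cs (rtile k).1).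
  by move=> k8; apply/sub_atomP; exists k.
case/orP => [/H[/= i8 j8 g ea]|/H[/= j8 i8 g ea]].
  split=> //; apply: rt_step; split=> //; try exact: sub_in.
  exists (zvp R (giso (group i)).1), (giso (group i)).2.
  by move=> x [/(iso _ i8 x)|/(iso _ j8 x)] //; rewrite g.
split=> //; apply: rt_step; split=> //; try exact: sub_in.
  by case: ea => p [q [pq [pj pi] [qj qi]]]; exists p, q.
exists (zvp R (giso (group i)).1), (giso (group i)).2.
by move=> x [/(iso _ i8 x)|/(iso _ j8 x)] //; rewrite g.
Qed.

End SimilarityProof.

Section MergedSimilarity.
Variables (R : realType) (s t : R).
Hypothesis st_Pi : Pi_triangle R (s, t).
Notation cs := (cset s t).
Notation D := (rhombus s t).
Notation C := (triangleC s).
Notation w := (omega R).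
Notation tau := (tauC s).
Notation BT := (base_triangle tau).
Notation sim := (sim s).
Notation sub := (subdomain D C).

Lemma group_lt3 i : (i < 8)%N -> (group i < 3)%N.
Proof. by do 8?case: i => [|i] //. Qed.

Lemma group_mergeable i j : (i < 8)%N -> (j < 8)%N -> group i = group j ->
  mergeable sub (cs (rtile i).1) (cs (rtile j).1).
Proof.
move=> i8 j8 /eqP ij.
have mem k : (k < 8)%N -> k \in iota 0 8 by rewrite mem_iota.
have := allP (allP groups_connected _ (mem _ i8)) _ (mem _ j8).
rewrite ij => /or3P[/eqP ->|/(adjacent_mergeable st_Pi)[]//|]; first exact: rt_refl.
case/hasP => k _ /andP[/(adjacent_mergeable st_Pi)[_ _ _ ik]].
move=> /(adjacent_mergeable st_Pi)[_ _ _ kj]; exact: rt_trans ik kj.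
Qed.

Lemma mergeable_group A B : mergeable sub A B ->
  forall i, (i < 8)%N -> A = cs (rtile i).1 ->
  exists j, [/\ (j < 8)%N, group i = group j & B = cs (rtile j).1].
Proof.
elim=> {A B} [A B [_ /(sub_atomP st_Pi)[j j8 BE] _ si] i i8 AE|A i i8 AE|A B C' _ ihA _ ihB i i8].
- by exists j; split=> //; apply: (same_isometry_group st_Pi) => //; rewrite -AE -BE.
- by exists i.
- move=> /(ihA _ i8)[j [j8 -> BE]]; exact: ihB.
Qed.

Lemma rtile_sub_gatom i x : (i < 8)%N -> cs (rtile i).1 x -> cs (gatom (group i)) x.
Proof.
move=> i8; apply: (includedP st_Pi); apply: (allP return_groups).
by rewrite mem_iota.
Qed.

Lemma gatom_rtile g x : (g < 3)%N -> cs (gatom g) x ->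
  exists2 i, (i < 8)%N & group i = g /\ cs (rtile i).1 x.
Proof.
move=> g3 gx; have xC : cs triangle_tile x.
  by apply: (includedP st_Pi _ gx); apply: (allP similar_included); rewrite mem_nth.
have [c /(nthP ([::], [::]))[i i8 <-] ix] := triangle_cover st_Pi xC.
exists i => //; split=> //.
by apply: (gatom_unique st_Pi (group_lt3 i8) g3 _ gx); apply: rtile_sub_gatom.
Qed.

Lemma mergeable_class i : (i < 8)%N ->
  \bigcup_(B in mergeable sub (cs (rtile i).1)) B = cs (gatom (group i)).
Proof.
move=> i8; apply/seteqP; split=> x.
  move=> [B /mergeable_group/(_ _ i8 erefl)[j [j8 -> ->]]]; exact: rtile_sub_gatom.
move=> /(gatom_rtile (group_lt3 i8))[j j8 [ji jx]].
by exists (cs (rtile j).1) => //; exact: group_mergeable.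
Qed.

Lemma group_onto g : (g < 3)%N -> exists2 i, (i < 8)%N & group i = g.
Proof. by case: g => [|[|[|]]] // _; [exists 0%N | exists 1%N | exists 4%N]. Qed.

Lemma sim_surj x : exists y, sim y = x.
Proof.
exists (transl (- sim_shift s) (homoth (w ^+ 7)^-1 x)).
have w7 : w ^+ 7 != 0 by rewrite gt_eqF // omega7_gt0.
case: x => a b; rewrite /sim /homoth /transl /sim_shift /=.
by congr pair; rewrite subrK mulVKf.
Qed.

Lemma rhombus_similar : dressed_similar (merge_atoms (subdomain D C)) (base_triangle tau).
Proof.
exists sim; split.
- apply: simgroup_comp; first exact/simgroup_homoth/omega7_gt0.
  exact: simgroup_transl.
- rewrite /= (triangleCE s t); apply/seteqP; split=> [_ [x xC <-]|x].
    exact/(sim_dom st_Pi).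
  by have [y <-] := sim_surj x => /(sim_dom st_Pi) yC; exists y.
- have imE g : (g < 3)%N -> sim @` cs (gatom g) = (batom s g).1.
    move=> g3; apply/seteqP; split=> [_ [x gx <-]|x]; first exact/(sim_atom s t _ g3).
    by have [y <-] := sim_surj x => /(sim_atom s t _ g3) gy; exists y.
  have -> : atoms BT = [set` [seq A.1 | A <- base_atoms s]] by [].
  apply/seteqP; split=> [_ [_ [A /(sub_atomP st_Pi)[i i8 ->] ->] <-]|A].
    rewrite mergeable_class // imE ?group_lt3 //=.
    by rewrite /batom -(nth_map _ set0) ?mem_nth ?size_map ?group_lt3.
  move=> /(nthP set0)[g]; rewrite size_map => g3; rewrite (nth_map (set0, (0, 0%N))) // => <-.
  have [i i8 ig] := group_onto g3.
  exists (cs (gatom g)); last by rewrite imE.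
  by exists (cs (rtile i).1); [apply/(sub_atomP st_Pi); exists i | rewrite mergeable_class // ig].
- move=> x xC; have {xC} : cs triangle_tile x by rewrite -(triangleCE s t).
  move=> /(triangle_cover st_Pi)[c /(nthP ([::], [::]))[i i8 <-] ix].
  rewrite -[dmap (merge_atoms _) x]/(first_return D C x) (first_return_piece st_Pi i8 ix).
  have gx := rtile_sub_gatom i8 ix.
  by rewrite (sim_map st_Pi (group_lt3 i8) gx) sim_iso // group_lt3.
Qed.

Lemma tauC_bounds : 0 < tau < 1.
Proof.
have zE a b : zv R (a, b) = zr R a + zr R b * w by [].
have lits : (zr R (Zneg 1) = - 1) * (zr R (Zneg 18) = - 18) * (zr R (Zneg 29) = - 29) *
  (zr R (Zpos 2) = 2) * (zr R (Zpos 3) = 3) * (zr R (Zneg 3) = - 3) *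
  (zr R (Zpos 18) = 18) * (zr R (Zpos 29) = 29) * (zr R Z0 = 0) by [].
(* tau and 1 - tau are affine in s with coefficients in Z[omega], so the bounds are again sign tests
   at the vertices of Pi. *)
have p1 := affposP st_Pi (f := ((Zpos 2, Zpos 3), ((Zpos 18, Zpos 29), zg0))) (erefl _).
have p2 := affposP st_Pi (f := ((Zneg 1, Zneg 3), ((Zneg 18, Zneg 29), zg0))) (erefl _).
rewrite /av /= /zg0 !zE !lits in p1 p2.
by rewrite tauCE; apply/andP; split; nra.
Qed.

End MergedSimilarity.

(** * Self-similar base triangles *)

Section QuadraticField.
Variable R : realType.
Notation K := (Qsqrt5 R).
Notation w := (omega R).
Implicit Types x y : R.

Lemma Qsqrt5_rat (q : rat) : K (ratr q).
Proof. by exists q, 0; rewrite rmorph0 mul0r addr0. Qed.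

Lemma Qsqrt5_nat n : K n%:R.
Proof. by rewrite -(ratr_nat R n); exact: Qsqrt5_rat. Qed.

Lemma Qsqrt5_int (z : int) : K z%:~R.
Proof. by rewrite -(ratr_int R z); exact: Qsqrt5_rat. Qed.

Lemma Qsqrt5D x y : K x -> K y -> K (x + y).
Proof.
by move=> [a [b ->]] [c [d ->]]; exists (a + c), (b + d); rewrite !rmorphD /=; ring.
Qed.

Lemma Qsqrt5N x : K x -> K (- x).
Proof. by move=> [a [b ->]]; exists (- a), (- b); rewrite !rmorphN /=; ring. Qed.

Lemma Qsqrt5B x y : K x -> K y -> K (x - y).
Proof. by move=> Kx Ky; apply: Qsqrt5D => //; exact: Qsqrt5N. Qed.

Lemma Qsqrt5M x y : K x -> K y -> K (x * y).
Proof.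
move=> [a [b ->]] [c [d ->]]; exists (a * c + 5 * (b * d)), (a * d + b * c).
have aa := alpha_sqr R; rewrite !rmorphD !rmorphM /= ratr_nat; ring: aa.
Qed.

(* The degenerate case [a = b * alpha] avoids the irrationality of [alpha]. *)
Lemma Qsqrt5V x : K x -> K x^-1.
Proof.
move=> [a [b xE]]; have aa := alpha_sqr R.
have [ab|/eqP ab] := eqVneq (ratr a - ratr b * alpha R) 0.
  have -> : x = ratr (2 * a) by rewrite xE rmorphM /= ratr_nat; lra.
  by rewrite -fmorphV; exact: Qsqrt5_rat.
have nE : ratr (a * a - 5 * (b * b)) = x * (ratr a - ratr b * alpha R).
  by rewrite xE rmorphB !rmorphM /= ratr_nat; ring: aa.
have [->|x0] := eqVneq x 0; first by rewrite invr0; exact: (Qsqrt5_nat 0).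
have -> : x^-1 = (ratr a - ratr b * alpha R) * ratr (a * a - 5 * (b * b))^-1.
  rewrite fmorphV /= nE; field.
  by rewrite x0 andbT; apply/eqP.
apply: Qsqrt5M; last exact: Qsqrt5_rat.
by exists a, (- b); rewrite rmorphN mulNr.
Qed.

Lemma Qsqrt5_omega : K w.
Proof.
exists (2^-1), (2^-1); rewrite fmorphV /= ratr_nat /omega; by field.
Qed.

Lemma Qsqrt5_beta : K (beta R).
Proof. by rewrite betaE; apply: Qsqrt5B; [exact: Qsqrt5_omega | exact: (Qsqrt5_nat 1)]. Qed.

Lemma Qsqrt5X x n : K x -> K (x ^+ n).
Proof.
move=> Kx; elim: n => [|n ih]; first exact: (Qsqrt5_nat 1).
by rewrite exprS; exact: Qsqrt5M.
Qed.

Lemma Qsqrt5_affine_inv a b x : K a -> K b -> b != 0 -> K (a + b * x) -> K x.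
Proof.
move=> Ka Kb b0 Kx; have -> : x = (a + b * x - a) * b^-1 by field.
by apply: Qsqrt5M; [exact: Qsqrt5B | exact: Qsqrt5V].
Qed.

Lemma Qsqrt5_tauC s : K (tauC s) <-> K s.
Proof.
have w0 := omega7_gt0 R; have a0 := alpha_gt2 R.
have Kw7 := Qsqrt5X 7 Qsqrt5_omega.
have Ka : K (alpha R) by exists 0, 1; rewrite rmorph0 rmorph1 mul1r add0r.
have Kb : K (w ^+ 7 * beta R ^+ 3).
  by apply: Qsqrt5M => //; apply/Qsqrt5X/Qsqrt5_beta.
have -> : tauC s = w ^+ 7 * beta R ^+ 3 + w ^+ 7 * alpha R * s by rewrite /tauC; ring.
split=> [|Ks]; last by apply: Qsqrt5D => //; apply: (Qsqrt5M _ Ks); exact: Qsqrt5M.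
apply: Qsqrt5_affine_inv => //; first exact: Qsqrt5M.
by rewrite mulf_neq0 // gt_eqF // (lt_trans _ a0).
Qed.

End QuadraticField.

(** * Eventual periodicity of the renormalization function *)

Section Renormalization.
Variable R : realType.
Notation K := (Qsqrt5 R).
Notation w := (omega R).
Notation b := (beta R).
Notation r := (@renorm R).
Implicit Types x : R.

(** The last case stands for the four points 0, beta^2, beta and 1 of the unit interval; of these
    only membership in K is retained. *)
Variant renorm_spec x : R -> Prop :=
| RenormLow of 0 < x < b ^+ 2 : renorm_spec x (w ^+ 2 * x)
| RenormMid of b ^+ 2 < x < b : renorm_spec x (w ^+ 3 * (b - x))
| RenormHigh of b < x < 1 : renorm_spec x (w ^+ 2 * (1 - x))
| RenormEnd of K x : renorm_spec x 0.

Lemma renormP x : 0 <= x <= 1 -> renorm_spec x (r x).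
Proof.
move=> /andP[x0 x1]; rewrite /renorm.
case: ifP => [h|/negbT h1]; first by constructor.
case: ifP => [h|/negbT h2]; first by constructor.
case: ifP => [h|/negbT h3]; first by constructor.
constructor; move: h1 h2 h3; rewrite !negb_and -!leNgt.
have Kb := Qsqrt5_beta R; have K0 := Qsqrt5_nat R 0; have K1 := Qsqrt5_nat R 1.
have := omega_bounds R; have bE := betaE R.
have b2E : b ^+ 2 = 2 - w.
  by rewrite bE expr2; have ww := omega_sqr R; ring: ww.
move=> wb h1 h2 h3.
have [e|/eqP n0] := eqVneq x 0; first by rewrite e.
have [e|/eqP n1] := eqVneq x 1; first by rewrite e.
have [e|/eqP nb] := eqVneq x b; first by rewrite e.
have [e|/eqP nb2] := eqVneq x (b ^+ 2); first by rewrite e; exact: Qsqrt5X.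
exfalso; case/orP: h1; case/orP: h2; case/orP: h3; lra.
Qed.

Lemma omega_powers : [/\ w ^+ 2 = w + 1, w ^+ 3 = 2 * w + 1 & b ^+ 2 = 2 - w].
Proof.
have ww := omega_sqr R; have w2 := omega2E R; split=> //.
- by rewrite exprS w2; ring: ww.
- by rewrite betaE expr2; ring: ww.
Qed.

Lemma renorm_unit x : 0 <= x <= 1 -> 0 <= r x <= 1.
Proof.
have [w2 w3 b2] := omega_powers; have := omega_bounds R; have bE := betaE R.
have ww := omega_sqr R => wb.
by case/renormP => [||| _] /=; rewrite ?w2 ?w3 ?b2 ?bE ?lexx ?ler01 // => /andP[h1 h2];
  apply/andP; split; nra.
Qed.

Lemma iter_renorm_unit n x : 0 <= x <= 1 -> 0 <= iter n r x <= 1.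
Proof. by move=> h; elim: n => //= n; exact: renorm_unit. Qed.

Lemma renorm_affine x : 0 <= x <= 1 -> K x \/
  exists p q, [/\ K p, K q, 2 <= `|q| & r x = p + q * x].
Proof.
have [w2 w3 b2] := omega_powers; have := omega_bounds R => wb.
have Kw := Qsqrt5_omega R; have K0 := Qsqrt5_nat R 0; have Kb := Qsqrt5_beta R.
have Kw2 := Qsqrt5X 2 Kw; have Kw3 := Qsqrt5X 3 Kw.
have n2 : 2 <= `|w ^+ 2| by rewrite ger0_norm w2; lra.
have n3 : 2 <= `|w ^+ 3| by rewrite ger0_norm w3; lra.
case/renormP => [_|_|_|]; last by left.
- by right; exists 0, (w ^+ 2); rewrite add0r.
- right; exists (w ^+ 3 * b), (- w ^+ 3); rewrite normrN; split=> //; last by ring.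
    exact: Qsqrt5M.
  exact: Qsqrt5N.
- right; exists (w ^+ 2), (- w ^+ 2); rewrite normrN; split=> //; last by ring.
  exact: Qsqrt5N.
Qed.

Lemma renorm_inv x : 0 <= x <= 1 -> K (r x) -> K x.
Proof.
case/renorm_affine => // -[p [q [Kp Kq q2 ->]]]; apply: Qsqrt5_affine_inv => //.
by rewrite -normr_gt0 (lt_le_trans _ q2).
Qed.

Lemma iter_renorm_inv n x : 0 <= x <= 1 -> K (iter n r x) -> K x.
Proof.
move=> x01; elim: n => //= n ih /renorm_inv h; apply: ih; apply: h.
exact: iter_renorm_unit.
Qed.

(** The first alternative absorbs orbits that meet an endpoint of a branch: an iterate in K pulls
    back to x in K, each branch being invertible over K. *)
Lemma iter_renorm_affine n x : 0 <= x <= 1 -> K x \/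
  exists p q, [/\ K p, K q, 2 ^+ n <= `|q| & iter n r x = p + q * x].
Proof.
move=> x01; elim: n => [|n [|[p [q [Kp Kq qn E]]]]]; last 2 [by left].
  right; exists 0, 1; rewrite normr1 add0r mul1r; split=> //; [exact: (Qsqrt5_nat _ 0)|exact: (Qsqrt5_nat _ 1)].
have y01 := iter_renorm_unit n x01.
case: (renorm_affine y01) => [Ky|[p' [q' [Kp' Kq' q2 E']]]].
  by left; exact: iter_renorm_inv Ky.
right; exists (p' + q' * p), (q' * q); split; last by rewrite /= E' E; ring.
- by apply: Qsqrt5D => //; exact: Qsqrt5M.
- exact: Qsqrt5M.
- by rewrite normrM exprS ler_pM // exprn_ge0.
Qed.

Lemma self_similar_Qsqrt5 x : 0 <= x <= 1 -> base_self_similar x -> K x.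
Proof.
move=> x01 [m [n [n0 E]]]; apply: (@iter_renorm_inv m) => //.
have y01 := iter_renorm_unit m x01.
rewrite addnC iterD in E; case: (iter_renorm_affine n y01) => // -[p [q [Kp Kq qn]]].
rewrite E => yE.
have q2 : 1 < `|q|.
  apply: lt_le_trans qn; rewrite exprn_egt1 ?ltr1n //; by rewrite -lt0n.
have q1 : 1 - q != 0.
  by rewrite subr_eq0; apply: contraTN q2 => /eqP <-; rewrite normr1 ltxx.
have -> : iter m r x = p * (1 - q)^-1.
  apply: (mulIf q1); rewrite divfK //; lra.
apply: Qsqrt5M => //; apply: Qsqrt5V; apply: Qsqrt5B => //; exact: (Qsqrt5_nat _ 1).
Qed.

(* On K the maps act on lattice points; the Galois conjugate is contracted. *)
Definition lattice_point (N M : R) x := exists p q : int,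
  N * x = p%:~R + q%:~R * w /\ `|p%:~R + q%:~R * (1 - w)| <= M.

(** Conjugation takes omega to 1 - omega and the slopes to numbers of absolute value beta^2 = 2 -
    omega or beta^3, at most 2 / 5. The conjugate of the constant term is 0 or (2 - omega) n, at
    most 2 / 5 M, so the bound M is preserved. *)
Lemma renorm_lattice (n : nat) M x : n%:R <= M -> 0 <= x <= 1 ->
  lattice_point n%:R M x -> lattice_point n%:R M (r x).
Proof.
have [w2 w3 b2] := omega_powers; have := omega_bounds R => wb.
have ww := omega_sqr R; have bE := betaE R.
move=> nM x01 [p [q [E cM]]]; have n0 : (0 : R) <= n%:R by [].
have w8 : 8 / 5 < w by nra.
have c2 (u : R) : `|u| <= M -> `|(2 - w) * u| <= 2 / 5 * M.
  move=> uM; rewrite normrM ger0_norm; last lra.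
  by apply: ler_pM => //; lra.
case: (renormP x01) => [_|_|_|_].
- exists (p + q), (p + 2 * q); split.
    by rewrite mulrCA E w2 !rmorphD rmorphM /=; ring: ww.
  have -> : (p + q)%:~R + (p + 2 * q)%:~R * (1 - w) = (2 - w) * (p%:~R + q%:~R * (1 - w)) :> R.
    by rewrite !rmorphD rmorphM /=; ring: ww.
  by apply: le_trans (c2 _ cM) _; lra.
- exists (n%:Z - (p + 2 * q)), (n%:Z - (2 * p + 3 * q)); split.
    rewrite mulrCA mulrBr E w3 bE !(rmorphB, rmorphD, rmorphM) /=.
    by rewrite -pmulrn; ring: ww.
  have -> : (n%:Z - (p + 2 * q))%:~R + (n%:Z - (2 * p + 3 * q))%:~R * (1 - w) =
     (2 - w) * n%:R + (w - 1) * ((2 - w) * (p%:~R + q%:~R * (1 - w))) :> R.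
    by rewrite !(rmorphB, rmorphD, rmorphM) /= -pmulrn; ring: ww.
  apply: le_trans (ler_normD _ _) _.
  have h1 : `|(2 - w) * n%:R| <= 2 / 5 * M by apply: c2; rewrite ger0_norm.
  have h2 := c2 _ cM.
  have h3 : `|(w - 1) * ((2 - w) * (p%:~R + q%:~R * (1 - w)))| <= 1 * (2 / 5 * M).
    by rewrite normrM; apply: ler_pM => //; rewrite ger0_norm; lra.
  lra.
- exists (n%:Z - (p + q)), (n%:Z - (p + 2 * q)); split.
    rewrite mulrCA mulrBr E w2 !(rmorphB, rmorphD, rmorphM) /=.
    by rewrite -pmulrn; ring: ww.
  have -> : (n%:Z - (p + q))%:~R + (n%:Z - (p + 2 * q))%:~R * (1 - w) =
     (2 - w) * n%:R - ((2 - w) * (p%:~R + q%:~R * (1 - w))) :> R.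
    by rewrite !(rmorphB, rmorphD, rmorphM) /= -pmulrn; ring: ww.
  apply: le_trans (ler_normB _ _) _.
  have h1 : `|(2 - w) * n%:R| <= 2 / 5 * M by apply: c2; rewrite ger0_norm.
  have h2 := c2 _ cM.
  lra.
- exists 0, 0; rewrite mulr0 mulr0z !mul0r addr0 normr0; split=> //; lra.
Qed.

(** The number p + q omega and its conjugate determine p and q linearly. Both are bounded, which
    leaves finitely many pairs; 3 (n + M) is a crude bound for their entries. *)
Lemma lattice_point_list (n : nat) M : (0 < n)%N -> exists l : seq R,
  forall x, 0 <= x <= 1 -> lattice_point n%:R M x -> x \in l.
Proof.
move=> n0; have := omega_bounds R => wb.
pose L := Num.bound (3 * (n%:R + M)).
pose I := [seq (i%:Z - L%:Z) | i <- iota 0 (L + L).+1].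
have inI (z : int) : `|z%:~R : R| <= L%:R -> z \in I.
  rewrite -intr_norm -[L%:R]/(L%:Z%:~R) ler_int => zL.
  apply/mapP; exists (absz (z + L%:Z)); first by rewrite mem_iota; lia.
  by rewrite gez0_abs; lia.
exists [seq (p%:~R + q%:~R * w) / n%:R | p <- I, q <- I] => x /andP[x0 x1] [p [q [E cM]]].
have nR : 0 < n%:R :> R by rewrite ltr0n.
have M0 : 0 <= M by apply: le_trans cM.
have bnd : 3 * (n%:R + M) <= L%:R.
  by apply/ltW; apply: archi_boundP; lra.
have [y0 yn] : 0 <= p%:~R + q%:~R * w :> R /\ p%:~R + q%:~R * w <= n%:R :> R.
  by rewrite -E; split; nra.
rewrite ler_norml in cM; case/andP: cM => c1 c2.
apply/allpairsP; exists (p, q); split=> /=; last by rewrite -E (mulrC _ x) mulfK // gt_eqF.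
  by apply: inI; rewrite ler_norml; apply/andP; split; nra.
by apply: inI; rewrite ler_norml; apply/andP; split; nra.
Qed.

Lemma Qsqrt5_lattice x : K x -> exists2 n : nat, (0 < n)%N & exists M, lattice_point n%:R M x.
Proof.
move=> [p [q xE]].
exists (`|denq p| * `|denq q|)%N; first by rewrite muln_gt0 !absz_gt0 !denq_neq0.
(* From alpha = 2 omega - 1, x = p + q alpha equals (p - q) + 2 q omega; the denominators are then
   cleared. *)
eexists; exists (numq p * denq q - numq q * denq p), (2 * (numq q * denq p)).
split; last exact: lexx.
have h (u : rat) : ratr u * (denq u)%:~R = (numq u)%:~R :> R.
  by rewrite -ratr_int -rmorphM /= -numqE ratr_int.
have d (u : rat) : `|denq u|%N%:R = (denq u)%:~R :> R.
  by rewrite -[X in _ = X%:~R]absz_denq.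
rewrite natrM !d rmorphB !rmorphM /= -!h xE alphaE; ring.
Qed.

Lemma Qsqrt5_self_similar x : 0 <= x <= 1 -> K x -> base_self_similar x.
Proof.
move=> x01 /Qsqrt5_lattice[n n0 [M xM]].
(* The bound is enlarged to dominate the denominator n, as [renorm_lattice] requires. *)
have {}xM : lattice_point n%:R (`|M| + n%:R) x.
  have [p [q [E cM]]] := xM; exists p, q; split=> //.
  by rewrite (le_trans cM) // (le_trans (ler_norm _)) // lerDl.
have orb k : lattice_point n%:R (`|M| + n%:R) (iter k r x).
  elim: k => //= k; apply: renorm_lattice; first by rewrite lerDr.
  exact: iter_renorm_unit.
have [l inl] := lattice_point_list (`|M| + n%:R) n0.
pose u := [seq iter k r x | k <- iota 0 (size l).+1].
have : ~~ uniq u.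
  apply/negP => uu; have : (size u <= size l)%N.
    apply: uniq_leq_size => // _ /mapP[k _ ->].
    by apply: inl (orb k); exact: iter_renorm_unit.
  by rewrite size_map size_iota ltnn.
case/(uniqPn 0) => i [j []]; rewrite size_map size_iota => ij js.
rewrite !(nth_map 0%N) ?size_iota ?(ltn_trans ij) // !nth_iota ?(ltn_trans ij) // => E.
by exists i, (j - i)%N; rewrite subn_gt0 ij subnKC // ltnW.
Qed.

Lemma base_self_similarP x : 0 < x < 1 -> base_self_similar x <-> K x.
Proof.
move=> /andP[x0 x1]; have x01 : 0 <= x <= 1 by rewrite !ltW.
by split; [exact: self_similar_Qsqrt5 | exact: Qsqrt5_self_similar].
Qed.

End Renormalization.

(** * Induced base triangles with parameter in Q(sqrt 5) *)

Section SimilarityGroup.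
Variable R : realType.
Notation rot := (@rot1 R).
Implicit Types (x y c d : R * R) (b : bool).

Definition lin i b x : R * R := iter i rot (if b then refl0 x else x).
(** Normal form of the elements of [simgroup]. The parameters are kept explicit because the
    arithmetic of eta and c is what the later argument is about. *)
Definition similitude eta i b c x : R * R := homoth eta (lin i b x) + c.

Lemma refl0D x y : refl0 (x + y) = refl0 x + refl0 y.
Proof. by congr pair; rewrite /=; ring. Qed.

Lemma refl0K : involutive (@refl0 R).
Proof. by case=> a b; congr pair; rewrite /=; ring. Qed.

(** The dihedral relation: the reflection inverts the rotation, and 4m stands for - m modulo 5. *)
Lemma refl0_rot m x : refl0 (iter m rot x) = iter (4 * m) rot (refl0 x).
Proof.
have one y : refl0 y = rot (refl0 (rot y)).
  case: y => a b; rewrite /refl0 /= betaE.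
  by have ww := omega_sqr R; congr pair; rewrite /= betaE; ring: ww.
elim: m x => // m ih x; rewrite mulnS iterD -ih iterS.
by rewrite [in RHS]one -iterSr rot1_5.
Qed.

Lemma homothD (a : R) x y : homoth a (x + y) = homoth a x + homoth a y.
Proof. by congr pair; rewrite /=; ring. Qed.

Lemma homothK (a : R) : a != 0 -> cancel (homoth a) (homoth a^-1).
Proof. by move=> a0 [x y]; rewrite /homoth /= !mulKf. Qed.

Lemma rot_homoth m (a : R) x : iter m rot (homoth a x) = homoth a (iter m rot x).
Proof.
elim: m => //= m ->; move: (iter m _ x) => [p q].
by congr pair; rewrite /=; ring.
Qed.

Lemma linD i b x y : lin i b (x + y) = lin i b x + lin i b y.
Proof. by rewrite /lin; case: b; rewrite ?refl0D iter_rot1D. Qed.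

Lemma lin_homoth i b (a : R) x : lin i b (homoth a x) = homoth a (lin i b x).
Proof.
rewrite /lin -rot_homoth; case: b => //; congr (iter i rot _).
by case: x => p q; congr pair; rewrite /=; ring.
Qed.

Lemma lin_rot i b m x : lin i b (iter m rot x) =
  iter (if b then 4 * m else m) rot (lin i b x).
Proof. by rewrite /lin; case: b; rewrite ?refl0_rot -!iterD addnC. Qed.

Lemma lin_comp i b j b' x :
  lin i b (lin j b' x) = lin ((if b then 4 * j else j) + i) (b (+) b') x.
Proof.
rewrite /lin; case: b => /=; last by rewrite addnC iterD.
by rewrite refl0_rot addnC iterD; case: b' => //=; rewrite refl0K.
Qed.

Definition lin_inv i b := lin (if b then i else 4 * i)%N b.

Lemma linK i b : cancel (lin i b) (lin_inv i b).
Proof.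
move=> x; rewrite /lin_inv lin_comp addbb; case: b.
  by rewrite -mulSnr /lin iter_rot1_5.
by rewrite -mulSn /lin iter_rot1_5.
Qed.

Lemma lin_invK i b : cancel (lin_inv i b) (lin i b).
Proof.
move=> x; rewrite /lin_inv lin_comp addbb; case: b.
  by rewrite -mulSnr /lin iter_rot1_5.
by rewrite -mulSnr /lin iter_rot1_5.
Qed.

Lemma similitude_comp eta i b c eta' i' b' c' x :
  similitude eta i b c (similitude eta' i' b' c' x) =
  similitude (eta * eta') ((if b then 4 * i' else i') + i) (b (+) b')
    (similitude eta i b c c') x.
Proof.
rewrite /similitude linD lin_homoth lin_comp homothD addrA; congr (_ + _ + _).
by move: (lin _ _ x) => [p q]; rewrite /homoth /= !mulrA.
Qed.

Definition similitude_inv eta i b c :=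
  similitude eta^-1 (if b then i else 4 * i)%N b
    (homoth eta^-1 (lin_inv i b (- c))).

Lemma similitude_invE eta i b c x :
  similitude_inv eta i b c x = homoth eta^-1 (lin_inv i b (x - c)).
Proof. by rewrite /similitude_inv /similitude /lin_inv linD homothD. Qed.

Lemma similitudeK eta i b c : eta != 0 ->
  cancel (similitude eta i b c) (similitude_inv eta i b c).
Proof.
by move=> e0 x; rewrite similitude_invE addrK -(lin_homoth i) linK homothK.
Qed.

Lemma similitude_invK eta i b c : eta != 0 ->
  cancel (similitude_inv eta i b c) (similitude eta i b c).
Proof.
move=> e0 x; rewrite similitude_invE /similitude lin_homoth lin_invK.
have /homothK ee : eta^-1 != 0 by rewrite invr_eq0.
by rewrite invrK in ee; rewrite ee subrK.
Qed.

Lemma simgroup_similitude f : simgroup f ->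
  exists eta i b c, 0 < eta /\ f =1 similitude eta i b c.
Proof.
have h1 x : homoth 1 x = x by case: x => p q; rewrite /homoth /= !mul1r.
elim=> {f}.
- by exists 1, 1%N, false, 0; split=> // x; rewrite /similitude h1 addr0.
- by exists 1, 0%N, true, 0; split=> // x; rewrite /similitude h1 addr0.
- by move=> d; exists 1, 0%N, false, d; split=> // x; rewrite /similitude h1.
- by move=> eta e0; exists eta, 0%N, false, 0; split=> // x; rewrite /similitude addr0.
- by exists 1, 0%N, false, 0; split=> // x; rewrite /similitude h1 addr0.
- move=> f g _ [eta [i [b [c [e0 fE]]]]] _ [eta' [i' [b' [c' [e0' gE]]]]].
  do 4 eexists; split; last by move=> x; rewrite /= fE gE similitude_comp.
  exact: mulr_gt0.
- move=> f g _ [eta [i [b [c [e0 fE]]]]] fK gK.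
  exists eta^-1, (if b then i else 4 * i)%N, b, (homoth eta^-1 (lin_inv i b (- c))).
  split=> [|x]; first by rewrite invr_gt0.
  rewrite -/(similitude_inv eta i b c x) -[x in RHS]gK fE similitudeK //.
  by rewrite gt_eqF.
Qed.

(** A similitude conjugates T_d R_m into an isometry of the same form. When such a conjugate is
    known to have a translation over K, this expression turns into equations for eta and c. *)
Lemma similitude_TR eta i b c d m x : similitude eta i b c (TR d m x) =
  TR (homoth eta (lin i b d) + c - iter (if b then 4 * m else m) rot c)
    (if b then 4 * m else m) (similitude eta i b c x).
Proof.
rewrite /TR !translE /similitude linD lin_rot homothD iter_rot1D rot_homoth.
by rewrite -!addrA; congr (_ + _); rewrite [RHS]addrC -!addrA addNr addr0.
Qed.

End SimilarityGroup.

(** * Vector spaces over Q(sqrt 5) inside the reals *)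

Section Modules.
Variable R : realType.
Notation K := (Qsqrt5 R).
Notation w := (omega R).
Implicit Types (P : set R) (x y c d : R * R).

(** Vector subspaces of the reals over K. Those used are K itself, which controls eta and c, and K +
    K X, which contains the coordinates of a generic orbit. *)
Definition Kmodule P := [/\ P 0, forall x y : R, P x -> P y -> P (x + y)
  & forall a x : R, K a -> P x -> P (a * x)].

Lemma KmoduleB P (x y : R) : Kmodule P -> P x -> P y -> P (x - y).
Proof.
move=> [_ PD PM] Px Py; apply: PD => //; rewrite -mulN1r; apply: PM => //.
by apply: Qsqrt5N; exact: (Qsqrt5_nat _ 1).
Qed.

Lemma Kmodule_Qsqrt5 : Kmodule K.
Proof. split; [exact: (Qsqrt5_nat _ 0) | exact: Qsqrt5D | exact: Qsqrt5M]. Qed.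

Definition Kspan1 (v : R) : set R := [set x | exists a b, [/\ K a, K b & x = a + b * v]].

Lemma Kmodule_span1 v : Kmodule (Kspan1 v).
Proof.
have K0 := Qsqrt5_nat R 0; split.
- by exists 0, 0; rewrite mul0r addr0.
- move=> _ _ [a [b [Ka Kb ->]]] [c [d [Kc Kd ->]]].
  by exists (a + c), (b + d); split; [exact: Qsqrt5D | exact: Qsqrt5D | ring].
- move=> e _ Ke [a [b [Ka Kb ->]]].
  by exists (e * a), (e * b); split; [exact: Qsqrt5M | exact: Qsqrt5M | ring].
Qed.

Lemma Kspan1_base v (x : R) : K x -> Kspan1 v x.
Proof. by move=> Kx; exists x, 0; rewrite mul0r addr0; split=> //; exact: (Qsqrt5_nat R 0). Qed.

Section Stable.
Variable P : set R.
Hypothesis mP : Kmodule P.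

Lemma Kmodule_rot m x : (P `*` P) x -> (P `*` P) (iter m (@rot1 R) x).
Proof.
have [_ _ PM] := mP; move=> Px; elim: m => //= m [/= P1 P2]; split=> //=.
by apply: KmoduleB => //; apply: PM => //; exact: Qsqrt5_beta.
Qed.

Lemma Kmodule_lin i b x : (P `*` P) x -> (P `*` P) (lin i b x).
Proof.
have [_ _ PM] := mP; move=> [P1 P2]; apply: Kmodule_rot; case: b => //; split=> //=.
by apply: KmoduleB => //; apply: PM => //; exact: Qsqrt5_beta.
Qed.

Lemma Kmodule_pairD x y : (P `*` P) x -> (P `*` P) y -> (P `*` P) (x + y).
Proof. by have [_ PD _] := mP; move=> [? ?] [? ?]; split; apply: PD. Qed.

Lemma Kmodule_homoth a x : K a -> (P `*` P) x -> (P `*` P) (homoth a x).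
Proof. by have [_ _ PM] := mP; move=> Ka [? ?]; split; apply: PM. Qed.

End Stable.

(** The map 1 - R_2 has determinant omega + 2, and so has 1 - R_3, where 8 = 3 modulo 5. The
    combinations of u1 and u2 are Cramer's rule. *)
Lemma Qsqrt5_rot_fixpoint m c : m = 2%N \/ m = 8%N ->
  (K `*` K) (c - iter m (@rot1 R) c) -> (K `*` K) c.
Proof.
case: c => p q; have ww := omega_sqr R; have := omega_bounds R => wb.
have Kb := Qsqrt5_beta R; have Kw := Qsqrt5_omega R; have bE := betaE R.
have K2 := Qsqrt5_nat R 2; have K3 := Qsqrt5_nat R 3; have K0 := Qsqrt5_nat R 0.
have n0 : w + 2 != 0 by rewrite gt_eqF //; lra.
have Kn : K (w + 2) by exact: Qsqrt5D.
case=> ->; move=> [/= h1 h2]; split=> /=; apply: (Qsqrt5_affine_inv K0 Kn n0).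
- set u1 := _ - _ in h1; set u2 := _ - _ in h2.
  have -> : 0 + (w + 2) * p = 2 * u1 - beta R * u2 by rewrite /u1 /u2 bE; ring: ww.
  by apply: Qsqrt5B; exact: Qsqrt5M.
- set u1 := _ - _ in h1; set u2 := _ - _ in h2.
  have -> : 0 + (w + 2) * q = w * u2 + beta R * u1 by rewrite /u1 /u2 bE; ring: ww.
  by apply: Qsqrt5D; exact: Qsqrt5M.
- set u1 := _ - _ in h1; set u2 := _ - _ in h2.
  have -> : 0 + (w + 2) * p = w * u1 + beta R * u2 by rewrite /u1 /u2 bE; ring: ww.
  by apply: Qsqrt5D; exact: Qsqrt5M.
- set u1 := _ - _ in h1; set u2 := _ - _ in h2.
  have -> : 0 + (w + 2) * q = 2 * u2 - beta R * u1 by rewrite /u1 /u2 bE; ring: ww.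
  by apply: Qsqrt5B; exact: Qsqrt5M.
Qed.

End Modules.

(** * Collisions and generic points in intervals *)

Section Countability.
Variable R : realType.
Notation K := (Qsqrt5 R).

Lemma interval_uncountable (a b : R) : a < b -> ~ countable `]a, b[%classic.
Proof.
move=> ab /countable_lebesgue_measure0; rewrite lebesgue_measure_itv /= lte_fin ab.
by move=> /eqP; rewrite -EFinB eqe subr_eq0 gt_eqF.
Qed.

Lemma interval_collision (T : countType) (f : R -> T) a b : a < b ->
  exists x y, [/\ a < x < b, a < y < b, x <> y & f x = f y].
Proof.
move=> ab; apply: contrapT => h; apply: (interval_uncountable ab).
apply/countable_injP; exists (fun x => pickle (f x)) => x y.
rewrite !inE /= !in_itv /= => xab yab /(pcan_inj pickleK) fxy.
by apply: contrapT => xy; apply: h; exists x, y.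
Qed.

Lemma countable_Kspan1 (s : R) : countable (Kspan1 s).
Proof.
pose f (p : (rat * rat) * (rat * rat)) : R :=
  ratr p.1.1 + ratr p.1.2 * alpha R + (ratr p.2.1 + ratr p.2.2 * alpha R) * s.
apply: (@sub_countable _ _ _ (f @` setT)); last first.
  exact: sub_countable (card_image_le _ _) (countableP _).
apply: subset_card_le => _ [_ [_ [[a [b ->]] [c [d ->]] ->]]].
by exists ((a, b), (c, d)).
Qed.

Lemma interval_generic (s a b : R) : a < b -> exists2 x, a < x < b & ~ Kspan1 s x.
Proof.
move=> ab; apply: contrapT => h; apply: (interval_uncountable ab).
apply: sub_countable (countable_Kspan1 s); apply: subset_card_le => x.
by rewrite /= in_itv /= => xab; apply: contrapT => hx; apply: h; exists x.
Qed.

End Countability.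

(** * The base triangle in explicit inequalities *)

Section BaseTriangleMap.
Variables (R : realType) (tau : R).
Notation w := (omega R).
Notation beta := (beta R).
Notation BT := (base_triangle tau).
Notation f := (dmap BT).
Hypothesis tau01 : 0 < tau < 1.
Implicit Types y : R * R.

Definition btile1 := tile [:: 0; 2; 3]%N [:: 1; 1; 1] [:: 0; 0; w - w * tau].
Definition btile2 := tile [:: 1; 4; 0; 3; 2]%N [:: -1; 1; 1; -1; 1]
  [:: tau - w ^+ 2; w ^+ 2 - w * tau; 0; w - w * tau; 0].
Definition btile3 := tile [:: 1; 0; 4]%N [:: -1; 1; -1]
  [:: tau - w ^+ 2; 0; w ^+ 2 - w * tau].

Lemma base_domP y : dom BT y <-> [/\ tau - w ^+ 2 <= y.2, y.1 < 0 & - y.1 + beta * y.2 < 0].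
Proof.
rewrite /base_triangle /dress /tile /halfplane /= andbT.
by split=> [/and3P[]|[-> -> ->]].
Qed.

Lemma btile1P y : btile1 y <->
  [/\ y.1 < 0, - y.1 + beta * y.2 < 0 & - beta * y.1 - beta * y.2 < w - w * tau].
Proof.
rewrite /btile1 /tile /halfplane /= andbT.
by split=> [/and3P[]|[-> -> ->]].
Qed.

Lemma btile2P y : btile2 y <->
  [/\ tau - w ^+ 2 <= y.2, beta * y.1 - y.2 < w ^+ 2 - w * tau, y.1 < 0,
      w - w * tau <= - beta * y.1 - beta * y.2 & - y.1 + beta * y.2 < 0].
Proof.
rewrite /btile2 /tile /halfplane /= andbT.
by split=> [/and5P[]|[-> -> -> -> ->]].
Qed.

Lemma btile3P y : btile3 y <->
  [/\ tau - w ^+ 2 <= y.2, y.1 < 0 & w ^+ 2 - w * tau <= beta * y.1 - y.2].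
Proof.
rewrite /btile3 /tile /halfplane /= andbT.
by split=> [/and3P[]|[-> -> ->]].
Qed.

Definition bmap1 := TR (w * tau - w, - w ^+ 2 + w ^+ 2 * tau) 2.
Definition bmap2 := TR (0, w ^+ 2 * tau - w ^+ 3) 3.
Definition bmap3 := TR (w * tau - 2 * w, w ^+ 2 * tau - 2 * w ^+ 2) 2.

Lemma base_mapE y : f y = if y \in btile1 then bmap1 y
  else if y \in btile2 then bmap2 y else if y \in btile3 then bmap3 y else y.
Proof. by []. Qed.

Lemma base_map1 y : btile1 y -> f y = bmap1 y.
Proof. by move=> y1; rewrite base_mapE mem_set. Qed.

Lemma base_map2 y : btile2 y -> f y = bmap2 y.
Proof.
move=> y2; rewrite base_mapE (mem_set y2) memNset // => /btile1P[_ _ h].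
by move/btile2P: y2 => [_ _ _]; rewrite leNgt h.
Qed.

Lemma base_map3 y : btile3 y -> f y = bmap3 y.
Proof.
move=> y3; have /btile3P[h1 h2 h3] := y3.
have [w2 w3 b2] := omega_powers R; have := omega_bounds R => wb.
have ww := omega_sqr R; have bE := betaE R; rewrite w2 in h1 h3.
rewrite base_mapE (mem_set y3) !memNset //.
  by move=> /btile2P[_]; rewrite w2 => h4; exfalso; lra.
move=> /btile1P[_ h4 h5]; rewrite bE in h3 h4 h5.
(* This supplies beta * omega = 1 to [nra]. *)
have : (w - 1) * (w * y.1) = y.1 by ring: ww.
nra.
Qed.

Lemma base_cover y : dom BT y -> [\/ btile1 y, btile2 y | btile3 y].
Proof.
move=> /base_domP[h1 h2 h3].
have [h4|h4] := ltP (- beta * y.1 - beta * y.2) (w - w * tau).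
  by constructor 1; apply/btile1P.
have [h5|h5] := ltP (beta * y.1 - y.2) (w ^+ 2 - w * tau).
  by constructor 2; apply/btile2P.
by constructor 3; apply/btile3P.
Qed.

End BaseTriangleMap.

(** * Orbits of the rhombus map modulo integer shifts *)

Section Gauge.
Variables (R : realType) (s t : R).
Hypothesis st_Pi : Pi_triangle R (s, t).
Notation cs := (cset s t).
Notation rho := (rhombus_map s t).
Notation K := (Qsqrt5 R).
Notation w := (omega R).
Notation beta := (beta R).
Notation rot := (@rot1 R).
Implicit Types x p q : R * R.

(** The code [g] has integer entries, so it ranges over a countable type and its translation has
    coordinates in K, whatever x and k are. *)
Lemma iter_rho_iso k x : cs rhombus_tile x -> exists g, iter k rho x = isoR g x.
Proof.
move=> Rx; elim: k => [|k [g E]]; first by exists ((zg0, zg0), 0%N); rewrite isoR_id.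
have [a a5 ax] := in_atom st_Pi (iter_rho_sub st_Pi k Rx).
by exists (ccomp (riso a) g); rewrite iterS (rhoE st_Pi a5 ax) isoR_comp E.
Qed.

Lemma Qsqrt5_zv z : K (zv R z).
Proof.
by apply: Qsqrt5D; [|apply: Qsqrt5M; last exact: Qsqrt5_omega]; exact: Qsqrt5_int.
Qed.

Lemma iter_rho_module P k x : Kmodule P -> (forall a, K a -> P a) ->
  cs rhombus_tile x -> (P `*` P) x -> (P `*` P) (iter k rho x).
Proof.
move=> mP KP /(iter_rho_iso k)[g ->] Px; apply: Kmodule_pairD => //.
  exact: Kmodule_rot.
by split; apply/KP/Qsqrt5_zv.
Qed.

Lemma rot4E x : iter 4 rot x = (x.2, beta * x.2 - x.1).
Proof.
have E : x = rot (iter 4 rot x) by rewrite -iterS rot1_5.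
move: (iter 4 rot x) E => [a b] -> /=; by congr pair; ring.
Qed.

Lemma rhombus_window x : cs rhombus_tile x ->
  [/\ - t <= x.1, x.1 < 1 - t, - s <= x.2 & x.2 < 1 - s].
Proof.
rewrite -rhombus_tileE /tile /halfplane /= andbT.
by case/and4P.
Qed.

(* Modulo 1, the first coordinate of [rho x] is the second one of [x]. *)
Lemma rho_gauge x : cs rhombus_tile x -> exists a b : int,
  rho x = (x.2 + a%:~R, beta * x.2 - x.1 + b%:~R).
Proof.
move=> /(in_atom st_Pi)[a a5 ax]; rewrite (rhoE st_Pi a5 ax) /isoR /TR translE.
have zvE z : zv R (z, Z0) = (int_of_Z z)%:~R by rewrite /zv /= zr0 mul0r addr0.
case: a a5 {ax} => [|[|[|[|[|]]]]] // _; rewrite rot4E /=;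
  do 2 eexists; rewrite /zvp /= !zvE; reflexivity.
Qed.

(** The products of (e, 0) with the u_m are e, 0, - e, - beta e and beta e. Rotations permute them,
    and the coordinates are two of them. *)
Lemma rot_bound m (e : R) :
  [/\ - `|e| <= (iter m rot (e, 0)).1, (iter m rot (e, 0)).1 <= `|e|,
      - `|e| <= (iter m rot (e, 0)).2 & (iter m rot (e, 0)).2 <= `|e|].
Proof.
have [a0 a1 a2] : [/\ 0 <= `|e|, - `|e| <= e & e <= `|e|].
  by rewrite normr_ge0 ler_norm lerNl -normrN ler_norm.
have ww := omega_sqr R; have := omega_bounds R => wb.
rewrite -iter_rot1_mod; have : (m %% 5 < 5)%N by rewrite ltn_mod.
have E2 : iter 2 rot (e, 0) = (- beta * e, beta * e).
  by congr pair; rewrite /= betaE; ring: ww.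
have E3 : iter 3 rot (e, 0) = (- e, - beta * e).
  by rewrite iterS E2; congr pair; rewrite /= betaE; ring: ww.
case: (m %% 5)%N => [|[|[|[|[|]]]]] // _.
- by split=> /=; lra.
- by rewrite /= betaE; split; nra.
- by rewrite E2 /= betaE; split; nra.
- by rewrite E3 /= betaE; split; nra.
- by rewrite rot4E /=; split; nra.
Qed.

Lemma small_int (j : int) : -1 < j%:~R :> R -> j%:~R < 1 :> R -> j = 0.
Proof. by rewrite -[-1]/((-1)%:~R) -[1]/(1%:~R) !ltr_int => h1 h2; lia. Qed.

(** Both orbits undergo the same rotation, up to integers. The integer j in the first coordinate
    enters the next second coordinate, where the window of length 1 decides: p stays away from its
    ends by more than the offset, so the integers cancel there and the offset is merely rotated. *)
Lemma tracking p q (e eta : R) n m0 :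
  cs rhombus_tile p -> cs rhombus_tile q -> 0 <= eta ->
  q = p + homoth eta (iter m0 rot (e, 0)) ->
  (forall k, (0 < k <= n)%N ->
     - s + eta * `|e| < (iter k rho p).2 /\ (iter k rho p).2 < 1 - s - eta * `|e|) ->
  forall k, (k <= n)%N -> exists m (j : int),
    iter k rho q = iter k rho p + homoth eta (iter m rot (e, 0)) + (j%:~R, 0).
Proof.
move=> Rp Rq eta0 qE win; elim=> [|k ih] kn.
  by exists m0, 0; rewrite qE; congr pair; rewrite /= addr0.
have [m [j E]] := ih (ltnW kn).
have [a [b pE]] := rho_gauge (iter_rho_sub st_Pi k Rp).
have [a' [b' qE']] := rho_gauge (iter_rho_sub st_Pi k Rq).
have [_ _ q2 q2'] := rhombus_window (iter_rho_sub st_Pi k.+1 Rq).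
have [p2 p2'] := win k.+1 kn; have [_ _ r2 r2'] := rot_bound (m + 4) e.
exists (m + 4)%N, (a' - a).
have rE : iter (m + 4) rot (e, 0) =
    ((iter m rot (e, 0)).2, beta * (iter m rot (e, 0)).2 - (iter m rot (e, 0)).1).
  by rewrite addnC iterD rot4E.
rewrite rE /= in r2 r2'; rewrite rE !iterS /= in q2 q2' p2 p2' *.
rewrite pE qE' E /homoth /= in q2 q2' p2 p2' *.
move: (iter m rot (e, 0)) (iter k rho p) => [v1 v2] [x1 x2] /= in r2 r2' q2 q2' p2 p2' *.
have k1 : - (eta * `|e|) <= eta * (beta * v2 - v1) by nra.
have k2 : eta * (beta * v2 - v1) <= eta * `|e| by nra.
(* This is the integer part of the difference of the next second coordinates. It has absolute value
   below 1, because q is in the window and p is well inside it. *)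
have j0 : b' - j - b = 0.
  by apply: small_int; rewrite !rmorphB /=; lra.
congr pair; first by rewrite rmorphB /=; ring.
have -> : b' = b + j by lia.
by rewrite rmorphD /=; ring.
Qed.

End Gauge.

(** * Any induced base triangle over K forces s to be in K *)

Section InducedBaseTriangle.
Variables (R : realType) (s t : R).
Hypothesis st_Pi : Pi_triangle R (s, t).
Variables (Y : set (R * R)) (tau eta : R) (i : nat) (b : bool) (c : R * R).
Notation cs := (cset s t).
Notation rho := (rhombus_map s t).
Notation D := (rhombus s t).
Notation K := (Qsqrt5 R).
Notation w := (omega R).
Notation beta := (beta R).
Notation rot := (@rot1 R).
Notation BT := (base_triangle tau).
Notation f := (dmap BT).
Notation H := (similitude eta i b c).
Hypothesis tau01 : 0 < tau < 1.
Hypothesis K_tau : K tau.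
Hypothesis eta0 : 0 < eta.
Hypothesis H_sub : forall y, dom BT y -> cs rhombus_tile (H y).
Hypothesis H_dom : forall y, Y (H y) <-> dom BT y.
Hypothesis H_return : forall y, dom BT y -> exists n,
  is_return_time D Y (H y) n /\ iter n rho (H y) = H (f y).

Lemma H_inj : injective H.
Proof. by apply: can_inj (similitudeK _ _ _ _); rewrite gt_eqF. Qed.

Lemma H_add y v : H (y + v) = H y + homoth eta (lin i b v).
Proof. by rewrite /similitude linD homothD addrAC. Qed.

Notation twist := (if b then 4 * 2 else 2)%N.

(* Uncountably many points of the segment share one of the countably many
   return isometries, whose translation part is in Z[omega]^2. *)
Lemma translation_Qsqrt5 (seg : R -> R * R) u v d : u < v -> injective seg ->
  (forall x, u < x < v -> dom BT (seg x) /\ f (seg x) = TR d 2 (seg x)) ->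
  (K `*` K) (homoth eta (lin i b d) + c - iter twist rot c).
Proof.
move=> uv seg_inj Hseg.
have [g Hg] : {g : R -> ciso & forall x, u < x < v -> H (f (seg x)) = isoR (g x) (H (seg x))}.
  apply: (@choice R ciso (fun x h => u < x < v -> H (f (seg x)) = isoR h (H (seg x)))) => x.
  case: (pselect (u < x < v)) => [h|h]; last by exists ((zg0, zg0), 0%N).
  have [dx _] := Hseg x h; have [n [_ <-]] := H_return dx.
  by have [j E] := iter_rho_iso st_Pi n (H_sub dx); exists j.
have [x [y [ux uy xy gxy]]] := interval_collision (g : R -> ((Z * Z) * (Z * Z) * nat)%type) uv.
have E z : u < z < v -> TR (homoth eta (lin i b d) + c - iter twist rot c) twist
    (H (seg z)) = isoR (g z) (H (seg z)).
  by move=> uz; rewrite -Hg // (Hseg z uz).2 similitude_TR.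
have [_ ->] : (twist %% 5 = (g x).2 %% 5)%N /\
    homoth eta (lin i b d) + c - iter twist rot c = zvp R (g x).1.
  apply: (TR_eq (x := H (seg x)) (y := H (seg y))); first by move=> /H_inj/seg_inj.
    exact: E.
  by rewrite [g x]gxy; exact: E.
by split; exact: Qsqrt5_zv.
Qed.

(** B_1 and B_3 are both rotated by R_2, and their translations differ by (omega, omega^2).
    Subtracting the conjugated translations thus cancels c and shows that eta is in K; then the one
    of B_1 gives c minus its rotated image, hence c. The segments start at the vertex 0 inside B_1,
    and run along the side u_1 . y = tau - omega^2 in B_3. *)
Lemma scale_Qsqrt5 : K eta /\ (K `*` K) c.
Proof.
have /andP[t0 t1] := tau01; have mK := Kmodule_Qsqrt5 R; have Kw := Qsqrt5_omega R.
have [w2 w3 b2] := omega_powers R; have := omega_bounds R => wb.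
have ww := omega_sqr R; have bE := betaE R.
have K1 := Qsqrt5_nat R 1; have K2 := Qsqrt5_nat R 2.
pose d1 : R * R := (w * tau - w, - w ^+ 2 + w ^+ 2 * tau).
pose d3 : R * R := (w * tau - 2 * w, w ^+ 2 * tau - 2 * w ^+ 2).
have k1 : (K `*` K) (homoth eta (lin i b d1) + c - iter twist rot c).
  apply: (@translation_Qsqrt5 (fun u => (- u, - (2 * u))) 0 ((1 - tau) / 2)).
  - by lra.
  - by move=> x y [/oppr_inj].
  - move=> u /andP[u0 u1].
    have h : btile1 tau (- u, - (2 * u)).
      by apply/btile1P; rewrite /= bE; split; nra.
    split; last exact: base_map1.
    by move/btile1P: h => /= [h1 h2 h3]; apply/base_domP; rewrite /= w2; split=> //; nra.
have k3 : (K `*` K) (homoth eta (lin i b d3) + c - iter twist rot c).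
  apply: (@translation_Qsqrt5 (fun u => (- u, tau - w ^+ 2)) 0 tau).
  - by lra.
  - by move=> x y [/oppr_inj].
  - move=> u /andP[u0 u1].
    have h : btile3 tau (- u, tau - w ^+ 2).
      by apply/btile3P; rewrite /= bE w2; split; nra.
    split; last exact: base_map3.
    by apply/base_domP; rewrite /= bE w2; split=> //; nra.
have Keta : K eta.
  have k13 : (K `*` K) (homoth eta (lin i b (w, w ^+ 2))).
    have -> : homoth eta (lin i b (w, w ^+ 2)) =
        (homoth eta (lin i b d1) + c - iter twist rot c) -
        (homoth eta (lin i b d3) + c - iter twist rot c).
      have -> : d1 = (w, w ^+ 2) + d3 by congr pair; rewrite /=; ring.
      rewrite linD homothD.
      by move: (homoth _ _) (homoth _ _) (iter _ _ _) => [? ?] [? ?] [? ?];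
        congr pair; rewrite /=; ring.
    by split; apply: KmoduleB => //; [case: k1|case: k3|case: k1|case: k3].
  have := Kmodule_lin mK (if b then i else 4 * i)%N b k13.
  rewrite -lin_homoth -/(lin_inv i b _) linK => -[/= kw _].
  have w0 : w != 0 by rewrite gt_eqF //; lra.
  by apply: (Qsqrt5_affine_inv (Qsqrt5_nat R 0) Kw w0); rewrite add0r mulrC.
split=> //; apply: (@Qsqrt5_rot_fixpoint _ twist); first by case: (b); [right|left].
have k0 : (K `*` K) (homoth eta (lin i b d1)).
  apply: Kmodule_homoth => //; apply: Kmodule_lin => //; split; rewrite /=.
    by apply: Qsqrt5B; [exact: Qsqrt5M|].
  apply: Qsqrt5D; [apply: Qsqrt5N|apply: Qsqrt5M => //]; exact: Qsqrt5X.
have -> : c - iter twist rot c = (homoth eta (lin i b d1) + c - iter twist rot c) -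
    homoth eta (lin i b d1).
  by rewrite -(addrA _ c) addrAC subrr add0r.
by split; apply: KmoduleB => //; [case: k1|case: k0|case: k1|case: k0].
Qed.

(** The reflection of (e, 0) is the rotation by 3 of (- e, 0), so offsets keep the form of a rotated
    multiple of (1, 0). *)
Lemma lin_base j b' : exists m, forall e : R,
  lin j b' (e, 0) = iter m rot ((if b' then - e else e), 0).
Proof.
rewrite /lin; case: b'; last by exists j.
exists (j + 3)%N => e; rewrite iterD; congr (iter j rot _).
have ww := omega_sqr R; congr pair; rewrite /= betaE; ring: ww.
Qed.

(** Expresses an offset in the rhombus in the frame of B(tau), so that a shadowing point can be
    written as H (y + v). *)
Lemma rot_lin n : exists m, forall e : R,
  iter n rot (e, 0) = lin i b (iter m rot ((if b then - e else e), 0)).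
Proof.
have [m Hm] := lin_base (if b then i else 4 * i)%N b.
exists ((if b then 4 * n else n) + m)%N => e.
by rewrite iterD -Hm -(lin_invK i b (iter n rot (e, 0))) /lin_inv lin_rot.
Qed.

(** The window of R in the first coordinate is half-open of length 1. *)
Lemma same_fibre x y (j : int) : cs rhombus_tile x -> cs rhombus_tile y ->
  x = y + (j%:~R, 0) -> x = y.
Proof.
move=> /rhombus_window[x1 x1' _ _] /rhombus_window[y1 y1' _ _] E.
rewrite E /= in x1 x1'; have j0 : j = 0 by apply: small_int; lra.
by rewrite E j0; case: (y) => p q; congr pair; rewrite /= addr0.
Qed.

(** The window is half-open: the upper end is never attained and the hypothesis excludes the lower
    one. Finitely many iterates then have a common margin. *)
Lemma orbit_slack x n : cs rhombus_tile x ->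
  (forall k, (iter k rho x).2 <> - s) -> exists2 m : R, 0 < m &
  forall k, (k <= n)%N -> - s + m < (iter k rho x).2 /\ (iter k rho x).2 < 1 - s - m.
Proof.
move=> Rx ns.
have slack k : exists2 m : R, 0 < m &
    - s + m < (iter k rho x).2 /\ (iter k rho x).2 < 1 - s - m.
  have [_ _ h1 h2] := rhombus_window (iter_rho_sub st_Pi k Rx).
  have h3 : - s < (iter k rho x).2.
    by rewrite lt_neqAle h1 andbT; apply/eqP => /esym; exact: ns.
  set v := (iter k rho x).2 in h2 h3 *.
  exists (Num.min (v + s) (1 - s - v) / 2).
    by rewrite divr_gt0 // lt_min; apply/andP; split; lra.
  have m1 : Num.min (v + s) (1 - s - v) <= v + s by rewrite ge_min lexx.
  have m2 : Num.min (v + s) (1 - s - v) <= 1 - s - v by rewrite ge_min lexx orbT.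
  by split; lra.
elim: n => [|n [m m0 ih]].
  by have [m m0 h] := slack 0%N; exists m => // -[|].
have [m' m0' h] := slack n.+1.
have m1 : Num.min m m' <= m by rewrite ge_min lexx.
have m2 : Num.min m m' <= m' by rewrite ge_min lexx orbT.
exists (Num.min m m'); first by rewrite lt_min m0.
move=> k; rewrite leq_eqVlt => /orP[/eqP ->|]; first by split; lra.
by move=> /ih[h1 h2]; split; lra.
Qed.

Lemma rot2E (x : R * R) : iter 2 rot x = (- beta * x.1 - beta * x.2, beta * x.1 - x.2).
Proof.
by have ww := omega_sqr R; congr pair; rewrite /= betaE; ring: ww.
Qed.

Lemma rot3E (x : R * R) : iter 3 rot x = (- x.1 + beta * x.2, - beta * x.1 - beta * x.2).
Proof.
by have ww := omega_sqr R; rewrite iterS rot2E; congr pair; rewrite /= betaE; ring: ww.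
Qed.

Notation dl := (1 - tau).

(** In B(tau) the point z on the edge passes through B_2 and B_3, while its neighbour x0 passes
    three times through B_1. Up to time n, the second return of z, rho keeps the two orbits close.
    Whether n comes before or after the third return of x0, one of the two orbits is then in Y at a
    place where it cannot be. *)
Lemma induced_Qsqrt5 : K s.
Proof.
apply: contrapT => nKs; have [Keta [Kc1 Kc2]] := scale_Qsqrt5.
have /andP[t0 t1] := tau01; have [w2 w3 b2] := omega_powers R.
have /andP[wlo whi] := omega_bounds R; have ww := omega_sqr R; have bE := betaE R.
have Kw := Qsqrt5_omega R; have K1 := Qsqrt5_nat R 1; have Kb := Qsqrt5_beta R.
(* X > - dl keeps z off the end of the edge, X < beta - omega dl puts z2 in B_3, and X < - beta dl
   puts the second image x2 of the neighbour in B_1. *)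
have [X /andP[X0 XM] gX] : exists2 X, - dl < X < Num.min (- beta * dl) (beta - w * dl)
    & ~ Kspan1 s X.
  by apply: interval_generic; rewrite lt_min bE; apply/andP; split; nra.
move: XM; rewrite lt_min => /andP[X1 X2].
have mP := Kmodule_span1 X.
(* A relation - s = p + q X over K has q nonzero, as s is not in K; solving it for X contradicts the
   choice of X. *)
have nPs : ~ Kspan1 X (- s).
  move=> [p [q [Kp Kq E]]]; have [q0|q0] := eqVneq q 0.
    apply: nKs; have -> : s = - p by rewrite -[s]opprK E q0; ring.
    exact: Qsqrt5N.
  apply: gX; exists (- p * q^-1), (- q^-1); split.
  - by apply: Qsqrt5M; [exact: Qsqrt5N | exact: Qsqrt5V].
  - by apply: Qsqrt5N; exact: Qsqrt5V.
  - have -> : s = - (p + q * X) by rewrite -E opprK.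
    by field.
(* z is on the edge u_3 . y = omega dl, which belongs to B_2. Its image z2 is on the side u_1 . y =
   tau - omega^2, and z3 is in the interior of the triangle. *)
pose z : R * R := (X, - (w + 1) * dl - X).
pose z2 : R * R := (- w * (X + dl), - dl - w).
pose z3 : R * R := (X - beta, - X - 1 - (w + 1) * dl).
have z_in : btile2 tau z by apply/btile2P; rewrite /= w2 bE in X1 X2 *; split; nra.
have fz : f z = z2.
  rewrite base_map2 // /bmap2 /TR translE rot3E.
  by congr pair; rewrite /= ?w2 ?w3 bE; ring: ww.
have z2_in : btile3 tau z2 by apply/btile3P; rewrite /= w2 bE in X1 X2 *; split; nra.
have fz2 : f z2 = z3.
  rewrite base_map3 // /bmap3 /TR translE rot2E.
  by congr pair; rewrite /= ?w2 ?w3 bE; ring: ww.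
have dz : dom BT z by apply/base_domP; case/btile2P: z_in.
have dz2 : dom BT z2.
  by case/btile3P: z2_in => *; apply/base_domP; rewrite /= w2 bE in X1 X2 *; split; nra.
have [n1 [ret1]] := H_return dz; rewrite fz => it1.
have [n2 [ret2]] := H_return dz2; rewrite fz2 => it2.
pose n := (n1 + n2)%N.
have itn : iter n rho (H z) = H z3 by rewrite /n addnC iterD it1.
have visit k : (0 < k < n)%N -> Y (iter k rho (H z)) -> iter k rho (H z) = H z2.
  move=> /andP[k0 kn] Yk; have [_ _ no1] := ret1; have [_ _ no2] := ret2.
  case: (ltngtP k n1) => [k1|k1|->] //.
    by case: (no1 k); rewrite ?k0.
  exfalso; apply: (no2 (k - n1)%N); first by rewrite subn_gt0 k1 ltn_subLR // ltnW.
  by rewrite -it1 -iterD subnK // ltnW.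
have Pz : (Kspan1 X `*` Kspan1 X) (H z).
  have KP := @Kspan1_base _ X; have PX : Kspan1 X X.
    by exists 0, 1; split=> //; [exact: (Qsqrt5_nat _ 0) | ring].
  apply: Kmodule_pairD => //; last by split; apply: KP.
  apply: Kmodule_homoth => //; apply: Kmodule_lin => //; split=> //=.
  apply: KmoduleB => //; apply: KP; apply: Qsqrt5M; last exact: Qsqrt5B.
  by apply: Qsqrt5N; exact: Qsqrt5D.
have Rz := H_sub dz.
have [m m0 slack] : exists2 m : R, 0 < m & forall k, (k <= n)%N ->
    - s + m < (iter k rho (H z)).2 /\ (iter k rho (H z)).2 < 1 - s - m.
  apply: orbit_slack => // k E; apply: nPs; rewrite -E.
  by have [] := iter_rho_module st_Pi k mP (@Kspan1_base _ X) Rz Pz.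
(* These margins keep x0, x1, x2 in B_1 and the points within e of z3 and x3 in the triangle; the
   last one keeps eta * e below the slack of the orbit of H z. *)
have [e [e0 e1 e2 e3 e4]] : exists e : R, [/\ 0 < e, 4 * e <= 1, 4 * e <= X + dl,
    4 * e <= - w * X - dl & 4 * e <= beta - w * dl - X /\ 4 * e <= m / eta].
  pose e := Num.min (X + dl) (Num.min (- w * X - dl)
    (Num.min (beta - w * dl - X) (Num.min (m / eta) 1))).
  have eE : 4 * (e / 4) = e by field.
  exists (e / 4); rewrite eE.
  split; rewrite ?divr_gt0 //; last split; rewrite /e ?lt_min ?ge_min ?lexx ?orbT //.
  by rewrite divr_gt0 // ltr01 !andbT bE in X1 X2 *; apply/and3P; split; nra.
case: e4 => e4 e5; have {}e5 : eta * e < m by move: e5; rewrite ler_pdivlMr //; nra.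
(* x0 = z + (e, 0) is just across the edge, as u_3 . (e, 0) = - beta e; x1, x2, x3 are its next
   images under the map of B(tau). *)
pose x0 : R * R := (X + e, - (w + 1) * dl - X).
pose x1 : R * R := (- beta * e, w * X + beta * e).
pose x2 : R * R := (- X - w * dl, - w * X - (w + 1) * dl - e).
pose x3 : R * R := (w * X + dl + beta * e, X - dl + e).
have x0_in : btile1 tau x0 by apply/btile1P; rewrite /= bE in X1 X2 *; split; nra.
have x1_in : btile1 tau x1 by apply/btile1P; rewrite /= bE in X1 X2 *; split; nra.
have x2_in : btile1 tau x2 by apply/btile1P; rewrite /= bE in X1 X2 *; split; nra.
have fx0 : f x0 = x1.
  rewrite base_map1 // /bmap1 /TR translE rot2E.
  by congr pair; rewrite /= ?w2 ?w3 bE; ring: ww.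
have fx1 : f x1 = x2.
  rewrite base_map1 // /bmap1 /TR translE rot2E.
  by congr pair; rewrite /= ?w2 ?w3 bE; ring: ww.
have fx2 : f x2 = x3.
  rewrite base_map1 // /bmap1 /TR translE rot2E.
  by congr pair; rewrite /= ?w2 ?w3 bE; ring: ww.
have dx0 : dom BT x0.
  by case/btile1P: x0_in => *; apply/base_domP; rewrite /= w2 bE in X1 X2 *; split; nra.
have dx1 : dom BT x1.
  by case/btile1P: x1_in => *; apply/base_domP; rewrite /= w2 bE in X1 X2 *; split; nra.
have dx2 : dom BT x2.
  by case/btile1P: x2_in => *; apply/base_domP; rewrite /= w2 bE in X1 X2 *; split; nra.
have near_z3 v : - e <= v.1 -> v.1 <= e -> - e <= v.2 -> v.2 <= e -> dom BT (z3 + v).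
  by move=> *; apply/base_domP; rewrite /= w2 bE in X1 X2 e4 *; split; nra.
have near_x3 v : - e <= v.1 -> v.1 <= e -> - e <= v.2 -> v.2 <= e -> dom BT (x3 - v).
  by move=> *; apply/base_domP; rewrite /= w2 bE in X1 X2 e4 *; split; nra.
have [k1 [ret_x0]] := H_return dx0; rewrite fx0 => it_x0.
have [k2 [ret_x1]] := H_return dx1; rewrite fx1 => it_x1.
have [k3 [ret_x2]] := H_return dx2; rewrite fx2 => it_x2.
pose N := (k1 + k2 + k3)%N.
have itx2 : iter (k1 + k2) rho (H x0) = H x2 by rewrite addnC iterD it_x0.
have itN : iter N rho (H x0) = H x3 by rewrite /N addnC iterD itx2.
have YN : Y (iter N rho (H x0)).
  by rewrite itN -it_x2; have [_] := ret_x2.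
have N0 : (0 < N)%N by have [k10 _ _] := ret_x0; rewrite /N !addn_gt0 k10.
have visit_x k : (0 < k <= N)%N -> Y (iter k rho (H x0)) ->
    [\/ k = k1, k = (k1 + k2)%N | k = N].
  move=> /andP[k0 kN] Yk; have [_ _ no1] := ret_x0.
  have [_ _ no2] := ret_x1; have [_ _ no3] := ret_x2.
  case: (ltngtP k k1) => [kk|kk|]; last by constructor 1.
    by case: (no1 k); rewrite ?k0.
  case: (ltngtP k (k1 + k2)) => [kk'|kk'|]; last by constructor 2.
    exfalso; apply: (no2 (k - k1)%N); first by rewrite subn_gt0 kk ltn_subLR // ltnW.
    by rewrite -it_x0 -iterD subnK // ltnW.
  move: kN; rewrite leq_eqVlt => /orP[/eqP ->|kN]; first by constructor 3.
  exfalso; apply: (no3 (k - (k1 + k2))%N); first by rewrite subn_gt0 kk' ltn_subLR // ltnW.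
  by rewrite -itx2 -iterD subnK // ltnW.
have track k : (k <= n)%N -> exists v (j : int),
    [/\ - e <= v.1, v.1 <= e, - e <= v.2 & v.2 <= e] /\
    iter k rho (H x0) = iter k rho (H z) + homoth eta (lin i b v) + (j%:~R, 0).
  (* The sign compensates the one that [lin_base] produces when H reverses orientation. *)
  move=> kn; pose e' := if b then - e else e.
  have ne' : `|e'| = e by rewrite /e'; case: (b); rewrite ?normrN gtr0_norm.
  have [m0' Hm0] := lin_base i b.
  have qE : H x0 = H z + homoth eta (iter m0' rot (e', 0)).
    by rewrite -Hm0 -H_add; congr H; congr pair; rewrite /= ?addr0.
  have [|q [j ->]] := tracking st_Pi Rz (H_sub dx0) (ltW eta0) qE _ kn.
    by move=> k' /andP[_ k'n]; rewrite ne'; have [h1 h2] := slack k' k'n; split; lra.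
  have [q' ->] := rot_lin q.
  exists (iter q' rot ((if b then - e' else e'), 0)), j; split=> //.
  by have := rot_bound q' (if b then - e' else e'); case: (b); rewrite ?normrN ne'.
have n0 : (0 < n)%N by have [n10 _ _] := ret1; rewrite /n addn_gt0 n10.
(* At time n both points are in R, so the integer shift left by [tracking] vanishes. *)
have z3_hit : exists v, [/\ - e <= v.1, v.1 <= e, - e <= v.2 & v.2 <= e] /\
    iter n rho (H x0) = H (z3 + v).
  have [v [j [[v1 v2 v3 v4] E]]] := track n (leqnn n).
  exists v; split=> //; rewrite itn -H_add in E; apply: same_fibre E.
    by apply: iter_rho_sub; [exact: st_Pi | exact: H_sub].
  by apply: H_sub; apply: near_z3.
case: z3_hit => v [[v1 v2 v3 v4] E].
have Yn : Y (iter n rho (H x0)) by rewrite E; apply/H_dom; apply: near_z3.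
(* If n <= N, time n is one of the first three returns of H x0, so x1, x2 or x3 would be within e of
   z3. *)
case: (leqP n N) => nN.
  have [|nE|nE|nE] := visit_x n _ Yn; first by rewrite n0.
  - move: E; rewrite nE it_x0 => /H_inj[/= E1 E2].
    by rewrite bE in E1 E2 X1 X2 e4; nra.
  - move: E; rewrite nE itx2 => /H_inj[/= E1 E2].
    by rewrite bE in E1 E2 X1 X2 e4; nra.
  - move: E; rewrite nE itN => /H_inj[/= E1 E2].
    by rewrite bE in E1 E2 X1 X2 e4; nra.
(* If N < n, the orbit of H z is close to H x3 at time N, hence in Y. Its only visit to Y before
   time n is H z2, and z2 is far from x3. *)
have [v' [j [[v1' v2' v3' v4'] E']]] := track N (ltnW nN).
have {}E' : iter N rho (H z) = H (x3 - v').
  apply: (@same_fibre _ _ (- j)).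
  - by apply: iter_rho_sub; [exact: st_Pi | exact: H_sub].
  - by apply: H_sub; apply: near_x3.
  have -> : H (x3 - v') = H x3 - homoth eta (lin i b v').
    by apply/eqP; rewrite eq_sym subr_eq -H_add subrK.
  rewrite -itN E' rmorphN; move: (iter N rho (H z)) (homoth _ _) => [? ?] [? ?].
  by congr pair; rewrite /=; ring.
have : H (x3 - v') = H z2.
  rewrite -E'; apply: visit; first by rewrite N0.
  by rewrite E'; apply/H_dom; apply: near_x3.
by move/H_inj => [/= _ E2]; lra.
Qed.

End InducedBaseTriangle.

(** * Self-similarity of the rhombus map *)

Section SelfSimilarity.
Variables (R : realType) (s t : R).
Hypothesis st_Pi : Pi_triangle R (s, t).
Notation rho := (rhombus_map s t).
Notation D := (rhombus s t).
Notation K := (Qsqrt5 R).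

Lemma mergeable_atom (D' : dressed R) A B : atoms D' A -> mergeable D' A B -> atoms D' B.
Proof. by move=> AD AB; elim: AB AD => // [A' B' [] //|A' B' C' _ h1 _ h2 /h1/h2]. Qed.

Lemma merged_return Y U x : atoms (merge_atoms (subdomain D Y)) U -> U x ->
  exists n, is_return_time D Y x n.
Proof.
move=> [A /mergeable_atom AD ->] [B /AD[_ [W ->]]] [_ xW _].
by exists (size W).
Qed.

Lemma base_atom_cover (tau : R) y : dom (base_triangle tau) y ->
  exists2 U, atoms (base_triangle tau) U & U y.
Proof.
have mem U : U \in [:: btile1 tau; btile2 tau; btile3 tau] ->
  atoms (base_triangle tau) U by [].
by case/base_cover => yU; eexists; try exact: yU; apply: mem; rewrite !inE eqxx ?orbT.
Qed.

Lemma rhombus_self_similar_Qsqrt5 : self_similar D -> K s.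
Proof.
move=> [Y [tau [Ysub tau01 [G [simG GY Gatoms Gmap]] _]]].
move=> /(base_self_similarP tau01) Ktau.
have [eta [i [b [c [eta0 GE]]]]] := simgroup_similitude simG.
have eta_neq0 : eta != 0 by rewrite gt_eqF.
pose H := similitude_inv eta i b c.
have GK x : H (G x) = x by rewrite GE /H similitudeK.
have HK y : G (H y) = y by rewrite GE /H similitude_invK.
have Hdom y : Y (H y) <-> dom (base_triangle tau) y.
  split=> [YHy|]; first by rewrite -[y]HK -GY; exists (H y).
  by rewrite -GY => -[x Yx <-]; rewrite GK.
have Hsub y : dom (base_triangle tau) y -> cset s t rhombus_tile (H y).
  by move=> /Hdom/Ysub; rewrite domE.
apply: (@induced_Qsqrt5 R s t st_Pi Y tau eta^-1 (if b then i else 4 * i)%N b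
  (homoth eta^-1 (lin_inv i b (- c))) tau01 Ktau _ Hsub Hdom).
  by rewrite invr_gt0.
(* Every point of Y does return: its image lies in an atom of B(tau), which corresponds to a union
   of return pieces. So [first_return] is here a true return and not the default identity. *)
move=> y dy; have [U] := base_atom_cover dy; rewrite -Gatoms => -[A hA <-] [x Ax xy].
have Hy : H y = x by rewrite -xy GK.
have [n xn] := merged_return hA Ax.
have Yx : Y x by rewrite -Hy; apply/Hdom.
change (exists n, is_return_time D Y (H y) n /\
  iter n rho (H y) = H (dmap (base_triangle tau) y)).
rewrite Hy; exists n; split=> //.
by rewrite -(first_returnE xn) -[LHS]GK -(Gmap x Yx) xy.
Qed.

Lemma tauC_self_similarP : base_self_similar (tauC s) <-> K s.
Proof.
rewrite -Qsqrt5_tauC; apply: base_self_similarP; exact: tauC_bounds st_Pi.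
Qed.

Lemma rhombus_self_similarP : self_similar D <-> K s.
Proof.
split=> [|/tauC_self_similarP Ks]; first exact: rhombus_self_similar_Qsqrt5.
exists (triangleC s), (tauC s); split=> //.
- by rewrite domE (triangleCE s t) => x; exact: triangle_sub.
- exact: tauC_bounds st_Pi.
- exact: rhombus_similar.
- by exists 13%N; exact: rhombus_orbits_tile.
Qed.

End SelfSimilarity.

Theorem mainTheorem1 (R : realType) :
  (forall s t : R, Pi_triangle R (s, t) ->
     [/\ 0 < tauC s < 1,
         dressed_similar (merge_atoms (subdomain (rhombus s t) (triangleC s)))
                 (base_triangle (tauC s))
       & orbits_tile (rhombus s t) (triangleC s) 13]
     /\
     [/\ self_similar (rhombus s t) <-> base_self_similar (tauC s)
       & self_similar (rhombus s t) <-> Qsqrt5 R s])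
  /\
  [set p : R * R | Pi_triangle R p /\ self_similar (rhombus p.1 p.2)] =
  Pi_triangle R `&` (Qsqrt5 R `*` setT).
Proof.
split=> [s t st_Pi|].
  split; split.
  - exact: tauC_bounds st_Pi.
  - exact: rhombus_similar.
  - exact: rhombus_orbits_tile.
  - by rewrite (rhombus_self_similarP st_Pi) (tauC_self_similarP st_Pi).
  - exact: rhombus_self_similarP.
apply/seteqP; split=> -[s t] [st_Pi].
- by move=> /(rhombus_self_similarP st_Pi) Ks; split.
- by move=> [Ks _]; split=> //; exact/(rhombus_self_similarP st_Pi).
Qed.
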